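(* Let $a\ge3$ be odd, $b>a$, and write $b=ma+r$ with integers $m\ge0$ and $r$ even, $0<r\le 2a$. Then $$\rho^*(\alpha)=\begin{cases}\delta_0,&\text{if } 2\le r\le a-1 \text{ and } a\ge5,\ \text{or } a=3,\ m\ge2 \ (r=2),\\ \delta_{-1},&\text{if } r=a+1 \text{ and } (a\ge5 \text{ or } (a=3, m\ge1)),\\ \delta_{-2},&\text{if } a+3\le r\le 2a,\\ \delta_{-6},&\text{if } (a,b)=(3,4),\\ \delta_{-7},&\text{if } (a,b)=(3,5).\end{cases}$$
   Context: Negative continued fractions: $[0;c_1,c_2,\dots]^-:=\cfrac{1}{c_1-\cfrac{1}{c_2-\cdots}}$. Fix integers $2\le a<b$ and set $\alpha=\eta:=[0;\overline{a,b}]^-=\tfrac12\big(b-\sqrt{b^2-4b/a}\big)$, $\beta:=[0;\overline{b,a}]^-=\tfrac12\big(a-\sqrt{a^2-4a/b}\big)$, $D:=\eta\beta$. For real $\gamma$, $M(\alpha,\gamma):=\liminf_{|n|\to\infty,\ n\in\mathbb Z}|n|\,\|n\alpha-\gamma\|$ ($\|x\|$ = distance from $x$ to the nearest integer) and $M^*(\alpha,\gamma):=4(1-D)M(\alpha,\gamma)$. Let $\mathcal L^*:=\{M^*(\alpha,\gamma):\gamma\in\mathbb R\setminus(\mathbb Z+\alpha\mathbb Z)\}$ and $\rho^*(\alpha):=\max\mathcal L^*$. Expansions: to a bounded integer sequence $(b_i)_{i\ge1}$ associate $\gamma((b_i)):=\sum_{i\ge1}(b_{2i-1}\eta+b_{2i}D)D^{i-1}$;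 a block is a pair $(b_{2i-1},b_{2i})$. For a finite word $P$ of blocks, $\gamma_P$ is $\gamma((b_i))$ for the purely periodic sequence repeating $P$. With $m,r$ as in the claim, put $n:=m+2$. Blocks (for $a$ odd, $t\equiv b \pmod 2$): $B_t=\big(\tfrac{a-3}{2},\tfrac{b-2+t}{2}\big)$, $F_t=\big(a-1,\tfrac{b-2-t}{2}\big)$. $\delta_0:=M^*(\alpha,\gamma_{B_m})$, $\delta_{-1}:=M^*(\alpha,\gamma_{B_mB_n})$, $\delta_{-2}:=M^*(\alpha,\gamma_{B_n})$, $\delta_{-6}:=M^*(\alpha,\gamma_{F_2})$ ($b$ even), $\delta_{-7}:=M^*(\alpha,\gamma_{F_1})$ ($b$ odd). *)

(* Defs.v *)
From Stdlib Require Import Reals Lra Lia ZArith List ClassicalEpsilon.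
Open Scope R_scope.

(* eta = alpha = [0; (a,b)-bar]^- ,  beta = [0; (b,a)-bar]^- ,  D = eta*beta *)
Definition eta (a b : Z) : R :=
  (IZR b - sqrt (IZR b ^ 2 - 4 * IZR b / IZR a)) / 2.
Definition beta (a b : Z) : R :=
  (IZR a - sqrt (IZR a ^ 2 - 4 * IZR a / IZR b)) / 2.
Definition Dc (a b : Z) : R := eta a b * beta a b.

Definition distZ (x : R) : R :=
  Rmin (x - IZR (Int_part x)) (IZR (Int_part x) + 1 - x).

Definition is_liminf_absZ (f : Z -> R) (l : R) : Prop :=
  (forall eps, 0 < eps -> exists N : nat, forall n : Z,
      (Z.of_nat N <= Z.abs n)%Z -> l - eps < f n) /\
  (forall eps, 0 < eps -> forall N : nat, exists n : Z,
      (Z.of_nat N <= Z.abs n)%Z /\ f n < l + eps).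

Definition is_M (alpha gamma l : R) : Prop :=
  is_liminf_absZ (fun n => IZR (Z.abs n) * distZ (IZR n * alpha - gamma)) l.

Definition is_Mstar (a b : Z) (gamma v : R) : Prop :=
  exists l, is_M (eta a b) gamma l /\ v = 4 * (1 - Dc a b) * l.

Definition in_Z_alphaZ (alpha gamma : R) : Prop :=
  exists p q : Z, gamma = IZR p + alpha * IZR q.

Definition is_rho_star (a b : Z) (v : R) : Prop :=
  (exists gamma, ~ in_Z_alphaZ (eta a b) gamma /\ is_Mstar a b gamma v) /\
  (forall gamma w, ~ in_Z_alphaZ (eta a b) gamma -> is_Mstar a b gamma w -> w <= v).

Definition series_sum (s : nat -> R) : R :=
  epsilon (inhabits 0) (fun l => infinite_sum s l).

(* gamma((b_i)) for a sequence given block by block: blk i = (b_{2i+1}, b_{2i+2})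
   (0-indexed blocks), gamma = sum_i (b_{2i+1} eta + b_{2i+2} D) D^i *)
Definition gamma_blocks (a b : Z) (blk : nat -> Z * Z) : R :=
  series_sum (fun i => (IZR (fst (blk i)) * eta a b + IZR (snd (blk i)) * Dc a b)
                        * Dc a b ^ i).

Definition gamma_word (a b : Z) (P : list (Z * Z)) : R :=
  gamma_blocks a b (fun i => nth (i mod length P) P (0%Z, 0%Z)).

(* blocks, for a odd and t = b mod 2 *)
Definition Bblk (a b t : Z) : Z * Z := (((a - 3) / 2)%Z, ((b - 2 + t) / 2)%Z).
Definition Fblk (a b t : Z) : Z * Z := ((a - 1)%Z, ((b - 2 - t) / 2)%Z).

(* Main.v *)
Require Import Defs.
From Stdlib Require Import Reals ZArith List.
From Stdlib Require Import Lra Lia ClassicalEpsilon.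
Open Scope R_scope.

(** Put f(s,t) = a s^2 + ab st + b t^2. With y = s + eta t and x = beta s + t one has
    ab xy = (1 + D) f, so that M^*(alpha,gamma) is governed by the values of |f| on the
    part of the grid (s0,t0) + Z^2 (gamma = s0 + eta t0) lying close to the line y = 0.
    The form f is invariant under (s,t) -> (-s-bt, t) and (s,t) -> (s, -t-as), and their
    composition contracts y by the factor D.

    Upper bound: following these reflections along a grid on which |f| > M near y = 0 gives
    fractional parts p_i, q_i, hence u_i = p_i - 1/2, v_i = q_i - 1/2 with
    a u_i = h_i + v_i + v_(i+1) and b v_(i+1) = k_(i+1) + u_i + u_(i+1), such that the four
    corners of every unit cell have |f| > M. When M exceeds the claimed value, these corner
    inequalities force |h_i| = 1/2, then a constant sign of h_i, then k_i = -m/2 always,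
    or k_i = -m/2 - 1 always, or these two values alternately; the affine recursion
    contracts to the periodic point with these digits, where |f| is the claimed value.

    Lower bound: the grid of the periodic point is mapped to itself (or interchanged with
    its companion) by the reflections, so by descent the minimum of |f| is taken at a
    corner of the central cell. For (a,b) = (3,4), (3,5) congruences give the minimum and
    the upper bound is an explicit covering of the plane by translates of |f| <= mu. *)

(** Why so few digits survive: along a chain, H = a u_i - 2 v_(i+1) equals h_i + v_i - v_(i+1), and
    K = b v_(i+1) - 2 u_i equals k_(i+1) + u_(i+1) - u_i. So (H, K) is the pair of digits up to
    differences that vanish at a fixed point, and a corner inequality compares M with the value of f
    at a fixed point with nearby digits. The obstacle is the lack of slack. A change of sign of h
    survives this first comparison when m = 0 and for (a,b) = (3,7), (3,8), (3,10). It is then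
    refuted on a longer window of neighbours, and for b = a + 1 the leading terms cancel, so that
    lower-order terms decide. The pairs (3,4) and (3,5) lie below the range b >= 6 of these
    estimates, which is why they get arguments of their own. All corner inequalities are multiplied
    by 4 (ab - 4). This clears the denominators of the fixed points and lets M enter through [gap],
    so the same estimates serve a hypothetical M above the claimed value and the claimed value
    itself. *)

Definition qf (a b s t : R) : R := a * s ^ 2 + a * b * s * t + b * t ^ 2.

(* Up to sign, the corners of the unit cell at the origin of the grid through
   (1/2 + u, - (1/2 + v)). Below, H = a u - 2 v and K = b v - 2 u are the coordinates in which the first two
   corner inequalities read 0 < gap + quad +- lin. *)
Record edge (a b M u v : R) : Prop := {
  edge_pp : M < - qf a b (1/2 + u) (- (1/2 + v));
  edge_mm : M < - qf a b (1/2 - u) (- (1/2 - v));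
  edge_pm : M < qf a b (1/2 + u) (1/2 - v);
  edge_mp : M < qf a b (1/2 - u) (1/2 + v) }.

Lemma edge_opp (a b M u v : R) : edge a b M u v -> edge a b M (- u) (- v).
Proof.
  intros [H1 H2 H3 H4]; split; unfold qf in *; nra.
Qed.

(** [gap], [quad] and [lin] are the constant, quadratic and linear parts of 4 (ab - 4) (-f - M) at
    the two corners where f is negative. The factor ab - 4 is the determinant of (u, v) -> (H, K);
    [gap] is the value at the centre u = v = 0. *)
Definition gap (a b M : R) : R := (a * b - 4) * (a * b - a - b - 4 * M).
Definition quad (a b H K : R) : R := 4 * (a * b * H * K + a * K ^ 2 + b * H ^ 2).
Definition lin (a b H K : R) : R := 2 * (a * b - 4) * (b * H + a * K).

(* The bounds [adm_m_gap] and [adm_n_gap] say that M is at least the value of f at the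
   fixed points of digits (h, k) = (1/2, -m/2) and (1/2, -m/2 - 1). *)
Record admissible (a b m M : R) : Prop := {
  adm_a : 3 <= a;
  adm_m : 0 <= m;
  adm_r : 2 <= b - a * m <= 2 * a;
  adm_ab : a + 1 <= b;
  adm_M : a * b - 4 * M <= 2 * a + b + m - 1;
  adm_m_gap : gap a b M <= (b - a * m) * (a * b - 4) + a * m * (b - m) - b;
  adm_n_gap : gap a b M <= (a * (m + 2) - b) * (a * b - 4) + a * (m + 2) * (b - (m + 2)) - b }.

Lemma edge_HK (a b M u v : R) : 0 < a * b - 4 -> edge a b M u v ->
  let H := a * u - 2 * v in let K := b * v - 2 * u in
  0 < gap a b M + quad a b H K + lin a b H K /\
  0 < gap a b M + quad a b H K - lin a b H K.
Proof.
  intros HN [H1 H2 _ _] H K.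
  assert (E1 : gap a b M + quad a b H K + lin a b H K
     = 4 * (a * b - 4) * (- qf a b (1/2 + u) (- (1/2 + v)) - M)).
  { unfold gap, quad, lin, H, K, qf; field. }
  assert (E2 : gap a b M + quad a b H K - lin a b H K
     = 4 * (a * b - 4) * (- qf a b (1/2 - u) (- (1/2 - v)) - M)).
  { unfold gap, quad, lin, H, K, qf; field. }
  rewrite E1, E2; split; apply Rmult_lt_0_compat; lra.
Qed.

(** Along a side of the cell f changes by an affine amount: f(1/2+u, 1/2-v) - f(1/2+u, -(1/2+v)) =
    ab/2 + bH, and the sides in the other direction give ab/2 + aK in the same way. Adding the
    inequalities at two adjacent corners therefore removes the quadratic terms. *)
Lemma edge_HK_bound (a b M u v : R) : edge a b M u v ->
  Rabs (2 * b * (a * u - 2 * v)) < a * b - 4 * M /\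
  Rabs (2 * a * (b * v - 2 * u)) < a * b - 4 * M.
Proof.
  intros [H1 H2 H3 H4]; unfold qf in *.
  split; apply Rabs_def1; nra.
Qed.

(** Polynomial estimates are given as certificates: [prod] records that a product of two nonnegative
    factors is nonnegative, and with enough such products the goal is linear in its monomials. *)
Ltac rpos := repeat (apply Rmult_le_pos || apply pow_le); lra.
Tactic Notation "prod" constr(x) constr(y) :=
  assert (0 <= x * y) by rpos.

Lemma adm_basic (a b m M : R) : admissible a b m M ->
  3 <= a /\ 0 <= m /\ 3 * m + 2 <= b /\ a * m + 2 <= b /\ 4 <= b /\ 8 <= a*b - 4 /\ 2*a+m-1 <= 2*b.
Proof.
  intros [Ha Hm Hr Hab HM _ _].
  prod (a-3) m. prod (a-3) (b-4). repeat split; try lra.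
  destruct (Rle_or_lt m 3); [lra|]. prod (a-3) (m-3). lra.
Qed.

(** * Consecutive digits *)

(** By [adm_m_gap] the corner inequality [edge_mm] fails at the digits (1/2, -m/2). Moving from
    there to H = 1/2 + d, K = -m/2 + k lowers its left side by 2 a k D1 + b d D2, where D1 and D2
    are the factors shown to be nonnegative in the proof. [K_lower] is the analogue for [edge_pp]
    and the digits (1/2, -m/2 - 1). *)
Lemma K_upper (a b m M H K : R) : admissible a b m M -> (b = 6 /\ m = 0 \/ 7 <= b) -> 1/2 <= H ->
  2 * b * H < 2 * a + b + m - 1 -> 2 * a * K < 2 * a + b + m - 1 ->
  0 < gap a b M + quad a b H K - lin a b H K -> K < - (m / 2).
Proof.
  intros A Hb6 HH BH BK F.
  destruct (adm_basic _ _ _ _ A) as (Ha & Hm & Hb & Hb' & _ & HN & HB).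
  assert (G := adm_m_gap _ _ _ _ A).
  assert (Hab := adm_ab _ _ _ _ A).
  destruct (Rlt_or_le K (-(m/2))) as [|C]; [assumption|exfalso].
  assert (exists d, H = 1/2 + d) as [d ->] by (exists (H - 1/2); lra).
  assert (exists k, K = -(m/2) + k) as [k ->] by (exists (K + m/2); lra).
  assert (0 <= d) by lra. assert (0 <= k) by lra.
  assert (6 <= b) by lra.
  prod a k. prod (a-3) (b-6). prod (a-3) m.
  assert (D1 : 0 <= a*b - 4 - b + 2*m - 2*k).
  { apply Rmult_le_reg_l with a; [lra|].
    prod (a-3) (a*(b-6)). prod (a-3) (a-3). lra. }
  assert (D2 : 0 <= 2*(a*b-4) + 2*a*m - 4 - 4*d - 4*a*k).
  { prod (b-6) d.
    destruct Hb6 as [[-> ->]|Hb7]. lra.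
    prod (a-3) (b-7). prod (b-7) d.
    lra. }
  assert (0 <= k*a*(a*b - 4 - b + 2*m - 2*k)) by rpos.
  assert (0 <= d*b*(2*(a*b-4) + 2*a*m - 4 - 4*d - 4*a*k)) by rpos.
  unfold quad, lin in F. lra.
Qed.

Lemma K_lower (a b m M H K : R) : admissible a b m M -> (b = 6 /\ m = 0 \/ 7 <= b) -> H <= 1/2 ->
  - (2 * a + b + m - 1) < 2 * b * H -> - (2 * a + b + m - 1) < 2 * a * K ->
  0 < gap a b M + quad a b H K + lin a b H K -> - ((m + 2) / 2) < K.
Proof.
  intros A Hb6 HH BH BK F.
  destruct (adm_basic _ _ _ _ A) as (Ha & Hm & Hb & Hb' & _ & HN & HB).
  assert (G := adm_n_gap _ _ _ _ A).
  assert (Hab := adm_ab _ _ _ _ A).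
  destruct (Rlt_or_le (-((m+2)/2)) K) as [|C]; [assumption|exfalso].
  assert (exists d, H = 1/2 - d) as [d ->] by (exists (1/2 - H); lra).
  assert (exists k, K = -((m+2)/2) - k) as [k ->] by (exists (-((m+2)/2) - K); lra).
  assert (0 <= d) by lra. assert (0 <= k) by lra.
  assert (6 <= b) by lra.
  prod a k. prod (a-3) (b-6). prod (a-3) m.
  assert (d <= 2).
  { apply Rmult_le_reg_l with b; lra. }
  assert (D1 : 0 <= a*b - 4 + b - 2*(m+2) - 2*k).
  { prod (a-3) k. lra. }
  assert (D2 : 0 <= 2*(a*b-4) - 2*a*(m+2) +4 - 4*d - 4*a*k).
  { destruct Hb6 as [[-> ->]|Hb7]; [lra|]. prod (a-3) (b-7). lra. }
  assert (0 <= k*a*(a*b - 4 + b - 2*(m+2) - 2*k)) by rpos.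
  assert (0 <= d*b*(2*(a*b-4) - 2*a*(m+2) + 4 - 4*d - 4*a*k)) by rpos.
  unfold quad, lin in F. lra.
Qed.

(** The two edges at a vertex with h = 1/2 have H = 1/2 + (K2 - K1)/b and 1/2 - (K2 - K1)/b, so
    [K_upper] applies to the first and [K_lower] to the second. The opposite bounds come from
    [edge_pp] at the first edge and [edge_mm] at the second; for a = 3 they are tight enough to need
    each residue b - 3m separately. *)
Lemma K_pair (a b m M K1 K2 : R) : admissible a b m M -> (b = 6 /\ m = 0 \/ 7 <= b) ->
  (5 <= a \/ a = 3 /\ (b - 3 * m = 2 \/ b - 3 * m = 4 \/ b - 3 * m = 6)) ->
  K1 <= K2 ->
  let H1 := 1/2 + (K2 - K1) / b in let H2 := 1/2 - (K2 - K1) / b in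
  Rabs (2 * b * H1) < 2 * a + b + m - 1 -> Rabs (2 * a * K1) < 2 * a + b + m - 1 ->
  Rabs (2 * b * H2) < 2 * a + b + m - 1 -> Rabs (2 * a * K2) < 2 * a + b + m - 1 ->
  0 < gap a b M + quad a b H1 K1 + lin a b H1 K1 ->
  0 < gap a b M + quad a b H1 K1 - lin a b H1 K1 ->
  0 < gap a b M + quad a b H2 K2 + lin a b H2 K2 ->
  0 < gap a b M + quad a b H2 K2 - lin a b H2 K2 ->
  - (m / 2) - 2 < K1 /\ K1 < - (m / 2) /\ - (m / 2) - 1 < K2 /\ K2 < - (m / 2) + 1 /\
  (5 <= a -> K2 <= - (m / 2) + 31/50) /\ (b - a * m = 2 * a -> a <> 3).
Proof.
  intros A Hb6 Ha5 HK H1 H2 BH1 BK1 BH2 BK2 F1 F2 F3 F4.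
  apply Rabs_def2 in BH1, BK1, BH2, BK2.
  destruct (adm_basic _ _ _ _ A) as (Ha & Hm & Hb & Hb' & _ & HN & HB).
  assert (G0 := adm_m_gap _ _ _ _ A).
  assert (G2 := adm_n_gap _ _ _ _ A).
  assert (Hab := adm_ab _ _ _ _ A).
  assert (Hr := adm_r _ _ _ _ A).
  assert (b6 : 6 <= b) by lra.
  assert (exists d, b * d = K2 - K1 /\ H1 = 1/2 + d /\ H2 = 1/2 - d /\ 0 <= d) as (d & Hd & E1 & E2 & d0).
  { exists ((K2-K1)/b). unfold H1, H2. repeat split; try lra. field; lra.
    apply Rmult_le_pos; [lra|]. left; apply Rinv_0_lt_compat; lra. }
  rewrite E1, E2 in *. clear E1 E2 H1 H2.
  assert (C1 : K1 < - (m/2)) by (apply (K_upper a b m M (1/2+d)); auto; lra).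
  assert (C2 : - ((m+2)/2) < K2) by (apply (K_lower a b m M (1/2-d)); auto; lra).
  assert (exists x, K1 = -(m/2) - x) as [x ->] by (exists (-(m/2) - K1); lra).
  assert (exists y, K2 = -(m/2) + y) as [y ->] by (exists (K2 + m/2); lra).
  assert (Hx : 0 < x) by lra. assert (Hy : -1 < y) by lra.
  assert (Hd' : b * d = x + y) by lra.
  assert (P : (a*b-4) * ((a-1)*y - x) < a*b*y + a*m*(x-y) - 2*a*x*y - 2*(x+y) + 2*d*(x+y)).
  { clear -F4 G0 Hd'. unfold quad, lin in F4.
    assert (a*b*d*m = a*m*(x+y)) by (rewrite <- Hd'; ring).
    assert (a*b*d*y = a*y*(x+y)) by (rewrite <- Hd'; ring).
    assert (b*d*d = d*(x+y)) by (rewrite <- Hd'; ring).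
    assert (a*b*b*d = a*b*(x+y)) by (rewrite <- Hd'; ring).
    lra. }
  assert (Q : (a*b-4) * ((a-1)*(x-1) - (y+1)) < - a*b*(x-1) + a*(m+2)*(x-1-(y+1)) - 2*a*(x-1)*(y+1) + 2*(x+y) + 2*d*(x+y)).
  { clear -F1 G2 Hd'. unfold quad, lin in F1.
    assert (a*b*d*m = a*m*(x+y)) by (rewrite <- Hd'; ring).
    assert (a*b*d*x = a*x*(x+y)) by (rewrite <- Hd'; ring).
    assert (a*b*d = a*(x+y)) by (rewrite <- Hd'; ring).
    assert (b*d*d = d*(x+y)) by (rewrite <- Hd'; ring).
    assert (a*b*b*d = a*b*(x+y)) by (rewrite <- Hd'; ring).
    lra. }
  assert (HS : 0 <= x + y) by (rewrite <- Hd'; rpos).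
  destruct Ha5 as [Ha5|[-> Hr3]].
  - assert (d5 : d <= 3/5).
    { assert (a * (b * d) < 2*a+b+m-1) by (rewrite Hd'; lra).
      apply Rmult_le_reg_l with (a*b); [apply Rmult_lt_0_compat; lra|].
      prod (a-5) (b-6). prod (a-5) m. lra. }
    prod (3/5 - d) (x+y). prod (a-5) (b-6). prod (a-5) m. prod (a-5) (a-5). prod m m.
    assert (Y : 5 * y <= 2 * x).
    { apply Rnot_lt_le; intro Z.
      assert (0 <= y) by lra.
      assert (0 <= y * (a*b*(a-2) - 4*a+6+a*m - 5/2*(a*b+a*m-6) - 42/10)).
      { apply Rmult_le_pos; [lra|]. prod (a-5) (a*b). lra. }
      assert (0 <= (5*y-2*x) * (a*b+a*m-6+12/10)).
      { apply Rmult_le_pos; lra. }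
      assert (0 <= a*x*y) by rpos.
      lra. }
    assert (X : 3 * (x-1) <= y+1).
    { apply Rnot_lt_le; intro Z.
      assert (0 <= x-1) by lra.
      assert (0 <= (x-1) * (a*b*(a-3)+2*a*(m+2)-4*a+8-48/10)).
      { apply Rmult_le_pos; [lra|]. prod (a-5) (a*b). lra. }
      assert (0 <= (3*(x-1)-(y+1)) * (a*b-a*(m+2)-2+12/10)).
      { apply Rmult_le_pos; [lra|]. lra. }
      assert (0 <= a*(x-1)*(y+1)) by rpos.
      lra. }
    (* Together, 5 y <= 2 x and 3 (x - 1) <= y + 1 give x <= 20/13 and y <= 8/13, and 31/50 is 8/13
       rounded up. *)
    repeat split; lra.
  - assert (P2 : (3*b-4) * (2*(y+1) - (x-1)) < (3*(m+2)-b)*(3*b-4) + 3*b*(y+1) + 3*(m+2)*(x-1-(y+1)) - 6*(x-1)*(y+1) - 2*(x+y) + 2*d*(x+y)).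
    { clear -F4 G2 Hd'. unfold quad, lin in F4.
      assert (3*b*d*m = 3*m*(x+y)) by (rewrite <- Hd'; ring).
      assert (3*b*d*y = 3*y*(x+y)) by (rewrite <- Hd'; ring).
      assert (b*d*d = d*(x+y)) by (rewrite <- Hd'; ring).
      assert (b*b*d = b*(x+y)) by (rewrite <- Hd'; ring).
      lra. }
    assert (Q0 : (3*b-4) * (2*x - y) < (b-3*m)*(3*b-4) - 3*b*x + 3*m*(x-y) - 6*x*y + 2*(x+y) + 2*d*(x+y)).
    { clear -F1 G0 Hd'. unfold quad, lin in F1.
      assert (3*b*d*m = 3*m*(x+y)) by (rewrite <- Hd'; ring).
      assert (3*b*d*x = 3*x*(x+y)) by (rewrite <- Hd'; ring).
      assert (b*d*d = d*(x+y)) by (rewrite <- Hd'; ring).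
      assert (b*b*d = b*(x+y)) by (rewrite <- Hd'; ring).
      lra. }
    assert (d3 : d <= 2/3).
    { apply Rmult_le_reg_l with b; [lra|]. rewrite Hd'. destruct Hb6; lra. }
    prod (2/3 - d) (x+y).
    destruct Hr3 as [Hr3|[Hr3|Hr3]].
    + assert (Em : m = (b-2)/3) by lra. subst m. assert (7 <= b) by lra.
      assert (y1 : y < 1).
      { apply Rnot_le_lt; intro Z.
        assert (x >= y).
        { apply Rle_ge, Rnot_lt_le; intro W.
          assert (0 <= (y-x)*(4*b-28/3)) by rpos.
          assert (0 <= x*(6*y-8/3)) by rpos. lra. }
        assert (0 <= (x-y)*(8*b-28/3)) by rpos.
        assert (0 <= (y-1)*(6*b-32/3)) by rpos.
        prod (x-1) y. lra. }
      assert (x < 2).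
      { apply Rnot_le_lt; intro Z.
        prod (x-2) (b-7).
        destruct (Rle_or_lt y 0).
        - assert (0 <= (-y)*(2*b+4/3)) by rpos. prod x (y+1). lra.
        - prod x y. assert (0 <= (1-y)*(2*b+4/3)) by rpos. lra. }
      repeat split; lra.
    + assert (Em : m = (b-4)/3) by lra. subst m. assert (7 <= b) by lra.
      assert (t1 : x - 1 < 1).
      { apply Rnot_le_lt; intro Z.
        assert (3*(x-1) <= y+1).
        { apply Rnot_lt_le; intro W.
          assert (0 <= (3*(x-1)-(y+1))*(2*b-8/3)) by rpos.
          assert (0 <= (x-1)*(2*b-16/3)) by rpos.
          prod (x-1) (y+1). lra. }
        assert (0 <= ((y+1)-3*(x-1))*(4*b-16/3)) by rpos.
        assert (0 <= (x-2)*(8*b-40/3)) by rpos.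
        prod (x-1) (y+1). lra. }
      assert (y < 1).
      { apply Rnot_le_lt; intro Z.
        assert (0 <= (y-1)*(3*b-4)) by rpos.
        assert (0 <= (y-1)*(4*b-34/3)) by rpos.
        destruct (Rle_or_lt 1 x).
        - prod (x-1) (y-1). lra.
        - prod (y-1) x. prod (1-x) (b-7). lra. }
      repeat split; lra.
    (* For a = 3 and b - 3m = 6 the corner inequalities contradict each other: no vertex with h =
       1/2 exists, which is the source of the last clause of the conclusion. *)
    + assert (Em : m = (b-6)/3) by lra. subst m.
      exfalso.
      destruct (Rle_or_lt x 1).
      * assert (0 <= (1-x)*(4*b-14/3)) by rpos.
        assert (0 < (y+1)*(4*b-40/3)) by (apply Rmult_lt_0_compat; lra).
        prod x (y+1). lra.
      * assert (0 < (y+1)*(2*b-20/3)) by (apply Rmult_lt_0_compat; lra).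
        assert (0 <= (x-1)*(4*b-20/3)) by rpos.
        prod (x-1) (y+1). lra.
Qed.

Record regular (a b m M : R) : Prop := {
  reg_adm : admissible a b m M;
  reg_m : exists z, m = IZR z;
  reg_b : b = 6 /\ m = 0 \/ 7 <= b;
  reg_a : 5 <= a \/ a = 3 /\ (b - 3 * m = 2 \/ b - 3 * m = 4 \/ b - 3 * m = 6) }.

Record vertex (a b M h u v w : R) : Prop := {
  vert_eq : a * u = h + v + w;
  vert_v : edge a b M u v;
  vert_w : edge a b M u w }.

Lemma vertex_sym (a b M h u v w : R) : vertex a b M h u v w -> vertex a b M h u w v.
Proof. intros [H1 H2 H3]; split; auto; lra. Qed.

Lemma vertex_opp (a b M h u v w : R) :
  vertex a b M h u v w -> vertex a b M (- h) (- u) (- v) (- w).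
Proof. intros [H1 H2 H3]; split; auto using edge_opp; lra. Qed.

Lemma edge_bounds (a b m M u v : R) : admissible a b m M -> edge a b M u v ->
  Rabs (2 * b * (a * u - 2 * v)) < 2 * a + b + m - 1 /\
  Rabs (2 * a * (b * v - 2 * u)) < 2 * a + b + m - 1.
Proof.
  intros A E. destruct (edge_HK_bound _ _ _ _ _ E) as [E1 E2].
  assert (X := adm_M _ _ _ _ A). lra.
Qed.

(** h is the mean of the values of H at its two edges, and each of these is below 3/2 in absolute
    value. *)
Lemma vertex_h (a b m M h u v w : R) : admissible a b m M -> vertex a b M h u v w ->
  Rabs h < 3/2.
Proof.
  intros A [E V W].
  destruct (edge_bounds _ _ _ _ _ _ A V) as [X1 _]. destruct (edge_bounds _ _ _ _ _ _ A W) as [X2 _].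
  destruct (adm_basic _ _ _ _ A) as (Ha & Hm & Hb & Hb' & b4 & HN & HB).
  apply Rabs_def2 in X1, X2.
  replace h with (a*u - v - w) by lra.
  apply Rabs_def1; apply Rmult_lt_reg_l with (4*b); lra.
Qed.

Lemma vertex_K_le (a b m M u v w : R) : regular a b m M -> vertex a b M (1/2) u v w ->
  w >= v ->
  - (m / 2) - 2 < b * v - 2 * u /\ b * v - 2 * u < - (m / 2) /\
  - (m / 2) - 1 < b * w - 2 * u /\ b * w - 2 * u < - (m / 2) + 1 /\
  (5 <= a -> b * w - 2 * u <= - (m / 2) + 31/50) /\ (b - a * m = 2 * a -> a <> 3).
Proof.
  intros [A _ B R] [E V W] HK.
  destruct (adm_basic _ _ _ _ A) as (Ha & Hm & Hb & Hb' & b4 & HN & HB).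
  assert (EQ1 : 1/2 + ((b*w-2*u) - (b*v-2*u))/b = a*u - 2*v) by (rewrite E; field; lra).
  assert (EQ2 : 1/2 - ((b*w-2*u) - (b*v-2*u))/b = a*u - 2*w) by (rewrite E; field; lra).
  assert (P := K_pair a b m M (b*v-2*u) (b*w-2*u) A B R).
  cbv zeta in P. rewrite EQ1, EQ2 in P.
  destruct (edge_bounds _ _ _ _ _ _ A V) as [X1 X2]. destruct (edge_bounds _ _ _ _ _ _ A W) as [Y1 Y2].
  assert (HN' : 0 < a*b-4) by lra.
  destruct (edge_HK _ _ _ _ _ HN' V) as [F1 F2]. destruct (edge_HK _ _ _ _ _ HN' W) as [F3 F4].
  apply P; auto.
  prod (w - v) b. lra.
Qed.

Lemma vertex_K (a b m M u v w : R) : regular a b m M -> vertex a b M (1/2) u v w ->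
  - (m / 2) - 2 < b * v - 2 * u /\ b * v - 2 * u < - (m / 2) + 1 /\
  (5 <= a -> b * v - 2 * u <= - (m / 2) + 31/50) /\ (b - a * m = 2 * a -> a <> 3).
Proof.
  intros R V.
  destruct (Rle_or_lt v w) as [L|L].
  - destruct (vertex_K_le _ _ _ _ _ _ _ R V) as (P1 & P2 & P3 & P4 & P5 & P6); [lra|].
    repeat split; auto; intros; lra.
  - apply vertex_sym in V.
    destruct (vertex_K_le _ _ _ _ _ _ _ R V) as (P1 & P2 & P3 & P4 & P5 & P6); [lra|].
    repeat split; auto; intros; lra.
Qed.

Lemma IZR_between (z lo hi : Z) : IZR lo < IZR z -> IZR z < IZR hi -> (lo < z < hi)%Z.
Proof. intros; split; now apply lt_IZR. Qed.

(** k is the mean of the two values bv - 2u and bv - 2u' of K, so it lies strictly between -m/2 - 2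
    and -m/2 + 1, where Z - m/2 has two elements. *)
Lemma pair_same (a b m M k u u' v w w' : R) : regular a b m M ->
  vertex a b M (1/2) u w v -> vertex a b M (1/2) u' v w' ->
  b * v = k + u + u' -> (exists z, k = IZR z - m / 2) ->
  k = - (m / 2) \/ k = - (m / 2) - 1.
Proof.
  intros R V V' E [z Hz].
  destruct (vertex_K _ _ _ _ _ _ _ R (vertex_sym _ _ _ _ _ _ _ V)) as (P1 & P2 & _).
  destruct (vertex_K _ _ _ _ _ _ _ R V') as (P3 & P4 & _).
  destruct (IZR_between z (-2) 1); [lra|lra|].
  assert (z = 0 \/ z = -1)%Z as [-> | ->] by lia; lra.
Qed.

(** At a change of sign the bounds seen from u' are reflected, so k has to be close to -m/2 and to
    m/2 at once. This leaves small m only. *)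
Lemma pair_flip (a b m M k u u' v w w' : R) : regular a b m M ->
  vertex a b M (1/2) u w v -> vertex a b M (-(1/2)) u' v w' ->
  b * v = k + u + u' -> (exists z, k = IZR z - m / 2) -> 0 <= k ->
  5 <= a /\ m = 0 /\ k = 0 \/
  a = 3 /\ (b = 7 /\ m = 1 /\ k = 1/2 \/ b = 8 /\ m = 2 /\ k = 0 \/ b = 10 /\ m = 2 /\ k = 0).
Proof.
  intros R V V' E [z Hz] Hk.
  destruct (vertex_K _ _ _ _ _ _ _ R V) as (P1 & P2 & _ & P3).
  destruct (vertex_K _ _ _ _ _ _ _ R (vertex_sym _ _ _ _ _ _ _ V)) as (P4 & P5 & P6 & _).
  assert (V2 := vertex_opp _ _ _ _ _ _ _ V'). rewrite Ropp_involutive in V2.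
  destruct (vertex_K _ _ _ _ _ _ _ R (vertex_sym _ _ _ _ _ _ _ V2)) as (P7 & P8 & _ & _).
  destruct (adm_basic _ _ _ _ (reg_adm _ _ _ _ R)) as (Ha & Hm & Hb & Hb' & b4 & HN & HB).
  destruct (reg_m _ _ _ _ R) as [mz Em].
  assert (b6 : 6 <= b) by (destruct (reg_b _ _ _ _ R); lra).
  destruct V as [V _ _]. destruct V' as [V' _ _].
  assert (Q : - (b + 2 - m) < (u' - u) * (a*b-2)).
  { assert (b * (a * u' - a * u) = b * (-1 + w' - w)) by (rewrite V', V; f_equal; lra).
    lra. }
  destruct (reg_a _ _ _ _ R) as [a5 | [-> Hr]].
  (* 38/100 = 1 - 31/50, so that k = (bv - 2u) - (u' - u) stays below -m/2 + 1. *)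
  - left. assert (u' - u > -38/100).
    { apply Rmult_lt_reg_r with (a*b-2); [lra|]. prod (a-5) (b-6). lra. }
    specialize (P6 a5).
    destruct (IZR_between z (-1) 1); [lra|lra|].
    assert (z = 0)%Z as -> by lia. lra.
  - right; split; [reflexivity|].
    assert (u' - u > -1).
    { apply Rmult_lt_reg_r with (3*b-2); lra. }
    destruct (IZR_between z (-1) 2); [lra|lra|].
    subst m.
    assert (z = 0 \/ z = 1)%Z as [-> | ->] by lia; (destruct (IZR_between mz (-1) 3); [lra|lra|]);
    assert (mz = 0 \/ mz = 1 \/ mz = 2)%Z as [-> | [-> | ->]] by lia; destruct (reg_b _ _ _ _ R); destruct Hr as [Hr|[Hr|Hr]]; try lra;
    exfalso; apply P3; lra.
Qed.

(** * Changes of sign of h in the cases left by the first comparison *)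

(** The sign changes between u2 and u3 and the digit between them is 0, so a K = w2 - 1 with w2
    small. In [edge_mm] at (u2, v3) the leading term is then -2 (b - a - 1 + k2) (ab - 4), which is
    negative because b >= a + 3 and k2 >= -1. *)
Lemma no_flip_far (a b M h1 k1 k2 k4 u0 u1 u2 u3 u4 v1 v2 v3 v4 : R) :
  5 <= a -> a + 3 <= b ->
  gap a b M <= (2*a-b)*(a*b-4) + 2*a*(b-2) - b ->
  a * u1 = h1 + v1 + v2 -> a * u2 = 1/2 + v2 + v3 -> a * u3 = - (1/2) + v3 + v4 ->
  b * v1 = k1 + u0 + u1 -> b * v2 = k2 + u1 + u2 -> b * v3 = u2 + u3 -> b * v4 = k4 + u3 + u4 ->
  -1 <= a * u0 <= 1 -> -1 <= a * u1 <= 1 -> -1 <= a * u2 <= 1 -> -1 <= a * u3 <= 1 -> -1 <= a * u4 <= 1 ->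
  -1 <= k1 <= 1 -> 0 <= k4 <= 1 ->
  h1 = 1/2 /\ -1 <= k2 <= 0 \/ h1 = -(1/2) /\ k2 = 0 ->
  0 < gap a b M + quad a b (a*u2-2*v3) (b*v3-2*u2) - lin a b (a*u2-2*v3) (b*v3-2*u2) -> False.
Proof.
  intros a5 Hab G U1 U2 U3 V1 V2 V3 V4 A0 A1 A2 A3 A4 K1 K4 C F.
  assert (S : forall u, -1 <= a * u <= 1 -> -1/5 <= u <= 1/5).
  { intros u [L1 L2]. destruct (Rle_or_lt u 0).
    - prod (a-5) (-u). lra.
    - prod (a-5) u. lra. }
  assert (S0 := S _ A0). assert (S1 := S _ A1). assert (S2 := S _ A2). assert (S3 := S _ A3). assert (S4 := S _ A4).
  clear S.
  assert (v4 <= 7/40). { apply Rmult_le_reg_l with b; lra. }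
  assert (-1/20 <= v4). { apply Rmult_le_reg_l with b; lra. }
  assert (-1/20 <= v3 <= 1/20). { split; apply Rmult_le_reg_l with b; lra. }
  assert (-7/40 <= v2 <= 1/20). { split; apply Rmult_le_reg_l with b; lra. }
  assert (-7/40 <= v1 <= 7/40). { split; apply Rmult_le_reg_l with b; lra. }
  set (w1 := u1 - u3). set (w2 := v4 - v2). set (B := b/2 + k2 + w1). set (e := u3 - u2).
  assert (Ee : a * e = w2 - 1) by (unfold e, w2; lra).
  assert (EH : b * (a*u2-2*v3) = B).
  { unfold B, w1. replace (a*u2-2*v3) with (1/2 + v2 - v3) by lra. lra. }
  assert (EK : b*v3-2*u2 = e) by (unfold e; lra).
  assert (Eq : gap a b M + quad a b (a*u2-2*v3) (b*v3-2*u2) - lin a b (a*u2-2*v3) (b*v3-2*u2)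
    = gap a b M + 4 * B * (v4 - v3 - 1/2) + 4 * e * (w2 - 1) - 2*(a*b-4)*(B - 1 + w2)).
  { rewrite EK. unfold quad, lin.
    replace (a * b * (a*u2-2*v3) * e) with ((b * (a*u2-2*v3)) * (a * e)) by ring.
    replace (b * (a*u2-2*v3)^2) with ((b * (a*u2-2*v3)) * (a*u2-2*v3)) by ring.
    replace (a * e^2) with (e * (a * e)) by ring.
    rewrite EH, Ee. replace (a*u2-2*v3) with (1/2+v2-v3) by lra. unfold w2. field. }
  rewrite Eq in F. clear Eq.
  assert (0 <= B * (1/2 + v3 - v4)) by (apply Rmult_le_pos; unfold B, w1; lra).
  assert (Ee2 : e * (w2-1) <= 4/5).
  { rewrite <- Ee. unfold e.
    apply Rmult_le_reg_l with a; [lra|].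
    assert (0 <= (2 - a*(u3-u2)) * (2 + a*(u3-u2))) by rpos. lra. }
  assert (W1 : a*b*w1 = b*(h1+1/2) + (k2 + u1 + u2) + (k1 + u0 + u1) - (u2+u3) - (k4+u3+u4)).
  { rewrite <- V1, <- V2, <- V3, <- V4. unfold w1.
    replace (a*b*(u1-u3)) with (b*(a*u1 - a*u3)) by ring. rewrite U1, U3. ring. }
  assert (W2 : a*b*w2 = a*k4 + a*u3 + a*u4 - a*k2 - a*u1 - a*u2).
  { unfold w2. replace (a*b*(v4-v2)) with (a*(b*v4)-a*(b*v2)) by ring. rewrite V4, V2. ring. }
  prod (a-5) k4.
  assert (0 <= (b-a-3)*(a*b-4)) by (apply Rmult_le_pos; [lra|]; prod (a-5) (b-8); lra).
  prod (a-5) (b-8).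
  unfold B, w1, w2 in *.
  destruct C as [[-> C]|[-> ->]].
  - prod (k2+1) (a*b-4). prod (a-5) (-k2). lra.
  - lra.
Qed.

(** For b = a + 1 the leading terms (a-1)(ab-4) of [gap] and (b-2)(ab-4) of [lin] cancel. What
    remains depends on w1 + w2, which W1 and W2 compute from the digits further out on both
    sides. *)
Lemma no_flip_near_zero (a b M h1 k1 k4 u0 u1 u2 u3 u4 v1 v2 v3 v4 : R) :
  5 <= a -> b = a + 1 ->
  gap a b M <= (a-1)*(a*b-4) - b + 4 ->
  a * u1 = h1 + v1 + v2 -> a * u2 = 1/2 + v2 + v3 -> a * u3 = - (1/2) + v3 + v4 ->
  b * v1 = k1 + u0 + u1 -> b * v2 = u1 + u2 -> b * v3 = u2 + u3 -> b * v4 = k4 + u3 + u4 ->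
  -1 <= a * u0 <= 1 -> -1 <= a * u1 <= 1 -> -1 <= a * u2 <= 1 -> -1 <= a * u3 <= 1 -> -1 <= a * u4 <= 1 ->
  0 <= k4 <= 1 ->
  h1 = 1/2 /\ -1 <= k1 <= 1 \/ h1 = -(1/2) /\ 0 <= k1 <= 1 ->
  0 < gap a b M + quad a b (a*u2-2*v3) (b*v3-2*u2) - lin a b (a*u2-2*v3) (b*v3-2*u2) -> False.
Proof.
  intros a5 Hab G U1 U2 U3 V1 V2 V3 V4 A0 A1 A2 A3 A4 K4 C F.
  assert (S : forall u, -1 <= a * u <= 1 -> -1/5 <= u <= 1/5).
  { intros u [L1 L2]. destruct (Rle_or_lt u 0).
    - prod (a-5) (-u). lra.
    - prod (a-5) u. lra. }
  assert (S0 := S _ A0). assert (S1 := S _ A1). assert (S2 := S _ A2). assert (S3 := S _ A3). assert (S4 := S _ A4).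
  clear S.
  assert (v4 <= 7/30). { apply Rmult_le_reg_l with b; lra. }
  assert (-1/15 <= v4). { apply Rmult_le_reg_l with b; lra. }
  assert (-1/15 <= v3 <= 1/15). { split; apply Rmult_le_reg_l with b; lra. }
  assert (-1/15 <= v2 <= 1/15). { split; apply Rmult_le_reg_l with b; lra. }
  assert (-7/30 <= v1 <= 7/30). { split; apply Rmult_le_reg_l with b; lra. }
  set (w1 := u1 - u3). set (w2 := v4 - v2). set (B := b/2 + w1). set (e := u3 - u2).
  assert (Ee : a * e = w2 - 1) by (unfold e, w2; lra).
  assert (EH : b * (a*u2-2*v3) = B).
  { unfold B, w1. replace (a*u2-2*v3) with (1/2 + v2 - v3) by lra. lra. }
  assert (EK : b*v3-2*u2 = e) by (unfold e; lra).
  assert (Eq : gap a b M + quad a b (a*u2-2*v3) (b*v3-2*u2) - lin a b (a*u2-2*v3) (b*v3-2*u2)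
    = gap a b M + 4 * B * (v4 - v3 - 1/2) + 4 * e * (w2 - 1) - 2*(a*b-4)*(B - 1 + w2)).
  { rewrite EK. unfold quad, lin.
    replace (a * b * (a*u2-2*v3) * e) with ((b * (a*u2-2*v3)) * (a * e)) by ring.
    replace (b * (a*u2-2*v3)^2) with ((b * (a*u2-2*v3)) * (a*u2-2*v3)) by ring.
    replace (a * e^2) with (e * (a * e)) by ring.
    rewrite EH, Ee. replace (a*u2-2*v3) with (1/2+v2-v3) by lra. unfold w2. field. }
  rewrite Eq in F. clear Eq.
  assert (BB : 0 <= (B - (b/2 - 1/5)) * (1/2 + v3 - v4)).
  { apply Rmult_le_pos; unfold B, w1; [|lra].
    destruct C as [[-> C]|[-> C]].
    - assert (u3 <= 1/5) by lra. assert (0 <= a * u1) by lra.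
      assert (0 <= u1). { apply Rmult_le_reg_l with a; lra. } lra.
    - assert (a * u3 <= 0) by lra. assert (u3 <= 0). { apply Rmult_le_reg_l with a; lra. }
      lra. }
  assert (Ee2 : e * (w2-1) <= 1/3).
  { rewrite <- Ee. unfold e.
    apply Rmult_le_reg_l with a; [lra|].
    assert (0 <= (129/100 - a*(u3-u2)) * (129/100 + a*(u3-u2))) by rpos. lra. }
  assert (W1 : a*b*w1 = b*(h1+1/2) + (u1 + u2) + (k1 + u0 + u1) - (u2+u3) - (k4+u3+u4)).
  { rewrite <- V1, <- V2, <- V3, <- V4. unfold w1.
    replace (a*b*(u1-u3)) with (b*(a*u1 - a*u3)) by ring. rewrite U1, U3. ring. }
  assert (W2 : a*b*w2 = a*k4 + a*u3 + a*u4 - a*u1 - a*u2).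
  { unfold w2. replace (a*b*(v4-v2)) with (a*(b*v4)-a*(b*v2)) by ring. rewrite V4, V2. ring. }
  prod (a-5) k4.
  assert (ab : 30 <= a * b) by (subst b; prod (a-5) (a-5); lra).
  (* The sign of w1 + w2 is unknown; ab - 4 >= (26/30) ab is used when it is nonnegative, ab - 4 <=
     ab otherwise. Hence 26/15 and 2. *)
  assert (NW : - 2*(a*b-4)*(w1+w2) <= - (26/15) * (a*b*w1+a*b*w2) \/ - 2*(a*b-4)*(w1+w2) <= - 2 * (a*b*w1+a*b*w2)).
  { destruct (Rle_or_lt 0 (w1+w2)).
    - left. prod (a*b-30) (w1+w2). lra.
    - right. lra. }
  assert (F' : 0 < - b + 4 + 4/3 - 4 * (B * (1/2+v3-v4)) - 2*(a*b-4)*(w1+w2)).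
  { unfold B in *. subst b. lra. }
  clear F G.
  unfold B, w1, w2 in *.
  destruct C as [[-> C]|[-> C]]; destruct NW as [NW|NW]; lra.
Qed.

(** With the digit -1 before the change of sign, the contradiction comes from [edge_pp] at (u2, v2).
    The leading terms cancel here too; the term -4/b of the bound on [gap] absorbs the 4/b that the
    square of B produces. The alternative k4 <= 0 or u4 <= 0 sharpens the bound on v4 to 1/6. *)
Lemma no_flip_near_neg (a b M k1 k4 u0 u1 u2 u3 u4 v1 v2 v3 v4 : R) :
  (a = 5 \/ 7 <= a) -> b = a + 1 ->
  gap a b M <= (a-1)*(a*b-4) - b + 4 - 4 * / b ->
  a * u1 = 1/2 + v1 + v2 -> a * u2 = 1/2 + v2 + v3 -> a * u3 = - (1/2) + v3 + v4 ->
  b * v1 = k1 + u0 + u1 -> b * v2 = -1 + u1 + u2 -> b * v3 = u2 + u3 -> b * v4 = k4 + u3 + u4 ->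
  -1 <= a * u0 <= 1 -> -1 <= a * u1 <= 1 -> -1 <= a * u2 <= 1 -> -1 <= a * u3 <= 1 -> -1 <= a * u4 <= 1 ->
  0 <= k4 <= 1 -> -1 <= k1 <= 0 ->
  (k4 <= 0 \/ u4 <= 0) ->
  0 < gap a b M + quad a b (a*u2-2*v2) (b*v2-2*u2) + lin a b (a*u2-2*v2) (b*v2-2*u2) -> False.
Proof.
  intros a57 Hab G U1 U2 U3 V1 V2 V3 V4 A0 A1 A2 A3 A4 K4 K1 C F.
  assert (a5 : 5 <= a) by lra.
  assert (S : forall u, -1 <= a * u <= 1 -> -1/5 <= u <= 1/5).
  { intros u [L1 L2]. destruct (Rle_or_lt u 0).
    - prod (a-5) (-u). lra.
    - prod (a-5) u. lra. }
  assert (S0 := S _ A0). assert (S1 := S _ A1). assert (S2 := S _ A2). assert (S3 := S _ A3). assert (S4 := S _ A4).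
  clear S.
  assert (Pos : forall u, 0 <= a*u -> 0 <= u) by (intros u Hu; apply Rmult_le_reg_l with a; lra).
  assert (v4 <= 7/30). { apply Rmult_le_reg_l with b; lra. }
  assert (-1/15 <= v4). { apply Rmult_le_reg_l with b; lra. }
  assert (-1/15 <= v3 <= 1/15). { split; apply Rmult_le_reg_l with b; lra. }
  assert (-7/30 <= v2 <= 0). { split; apply Rmult_le_reg_l with b; lra. }
  assert (-7/30 <= v1 <= 1/15). { split; apply Rmult_le_reg_l with b; lra. }
  assert (0 <= u1) by (apply Pos; lra).
  assert (0 <= u2) by (apply Pos; lra).
  assert (0 <= -u3) by (apply Pos; lra).
  assert (-1/6 <= v2). { apply Rmult_le_reg_l with b; lra. }
  assert (v4 <= 1/6). { apply Rmult_le_reg_l with b; [lra|]. destruct C; lra. }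
  set (w := u1 - u3). set (nu := v1 - v3). set (B := b/2 + 1 - w). set (e := u1 - u2).
  assert (Ee : a * e = nu) by (unfold e, nu; lra).
  assert (Hw : 0 <= w <= 2/5) by (unfold w; lra).
  assert (Hnu : nu <= 1/10).
  { unfold nu. assert (v1 <= 1/18).
    { apply Rmult_le_reg_l with b; [lra|].
      assert (u1 <= 2/15).
      { apply Rmult_le_reg_l with a; [lra|]. lra. }
      lra. }
    assert (-1/30 <= v3). { apply Rmult_le_reg_l with b; lra. }
    lra. }
  assert (Hnu' : -3/5 <= nu) by (unfold nu; lra).
  assert (EH : b * (a*u2-2*v2) = B).
  { unfold B, w. replace (a*u2-2*v2) with (1/2 + v3 - v2) by lra. lra. }
  assert (EK : b*v2-2*u2 = -1 + e) by (unfold e; lra).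
  assert (Eq : gap a b M + quad a b (a*u2-2*v2) (b*v2-2*u2) + lin a b (a*u2-2*v2) (b*v2-2*u2)
    = gap a b M + 4 * B * (nu - a) + 4 * (e-1) * (nu - a) + 4 * / b * (B * B) + 2*(a*b-4)*(B - a + nu)).
  { rewrite EK. unfold quad, lin.
    replace (a * b * (a*u2-2*v2) * (-1+e)) with ((b * (a*u2-2*v2)) * (a * e - a)) by ring.
    replace (b * (a*u2-2*v2)^2) with (/ b * ((b * (a*u2-2*v2)) * (b * (a*u2-2*v2)))) by (field; lra).
    replace (a * (-1+e)^2) with ((e-1) * (a * e - a)) by ring.
    replace (a * (-1+e)) with (a * e - a) by ring.
    rewrite EH, Ee. ring. }
  rewrite Eq in F. clear Eq.
  assert (Ib : 0 < / b <= 1/6).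
  { split; [apply Rinv_0_lt_compat; lra|]. apply Rmult_le_reg_l with b; [lra|]. rewrite Rinv_r; lra. }
  assert (BB : 4 * / b * (B * B) = b + 4 * (1-w) + 4 * / b * ((1-w)*(1-w))).
  { unfold B. field. lra. }
  assert (0 <= / b * (w * (2-w))) by rpos.
  assert (0 <= (2/5-w)*(1/10-nu)) by rpos.
  assert (En : e * nu <= 1/50 - nu/10).
  { rewrite <- Ee at 1. assert (0 <= (nu+3/5)*(1/10-nu)) by rpos.
    apply Rmult_le_reg_l with a; [lra|].
    replace (a * (e * (a*e))) with (nu * nu) by (rewrite <- Ee; ring).
    prod (a-5) (1/10-nu). lra. }
  assert (W1 : a*b*w = b + (k1 + u0 + u1) + (-1 + u1 + u2) - (u2+u3) - (k4+u3+u4)).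
  { rewrite <- V1, <- V2, <- V3, <- V4. unfold w.
    replace (a*b*(u1-u3)) with (b*(a*u1 - a*u3)) by ring. rewrite U1, U3. field. }
  assert (W2 : a*b*nu = a*(k1 + u0 + u1) - a*(u2 + u3)).
  { unfold nu. replace (a*b*(v1-v3)) with (a*(b*v1)-a*(b*v3)) by ring. rewrite V1, V3. ring. }
  assert (W3 : a * w = 1 + v1 + v2 - v3 - v4) by (unfold w; lra).
  prod (a-5) (-k1).
  rewrite BB in F. clear BB.
  assert (bnu : b * nu = k1 + u0 + u1 - u2 - u3) by (unfold nu; lra).
  clear EH EK.
  unfold B in *.
  assert (F' : 0 < - 2*(a*b*w) + 8 * w + 2*(a*b*nu) - 8 * nu + 4 * (a * w) - 4 * w + 2 * (b * nu) + 4 * nu - 8*nu - 4 * (w*nu) + 4 * (e*nu)).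
  { assert (4 * a * e = 4 * nu) by lra. subst b. lra. }
  clear F G.
  destruct a57 as [-> | a7]; subst b; unfold w, nu in *; lra.
Qed.

(* - f at this corner is monotone in u and v on the relevant range, so (u, v) can be replaced
   by numerical bounds in the small cases (3,7), (3,8), (3,10). *)
Lemma edge_mm_mono (a b M u v u0 v0 : R) : 0 <= a -> 0 <= b -> u0 <= u -> v0 <= v ->
  (a*u-2*v) + (a*u0-2*v0) <= a - 2 -> (b*v-2*u) + (b*v0-2*u0) <= b - 2 ->
  edge a b M u v -> M < - qf a b (1/2-u0) (-(1/2-v0)).
Proof.
  intros Ha Hb Hu Hv HH HK [_ E _ _]. unfold qf in *.
  assert (0 <= (v-v0)*b*(a - 2 - ((a*u-2*v) + (a*u0-2*v0)))) by rpos.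
  assert (0 <= (u-u0)*a*(b - 2 - ((b*v-2*u) + (b*v0-2*u0)))) by rpos.
  lra.
Qed.

Lemma edge_pp_mono (a b M u v u0 v0 : R) : 0 <= a -> 0 <= b -> u <= u0 -> v <= v0 ->
  -(a*u-2*v) - (a*u0-2*v0) <= a - 2 -> -(b*v-2*u) - (b*v0-2*u0) <= b - 2 ->
  edge a b M u v -> M < - qf a b (1/2+u0) (-(1/2+v0)).
Proof.
  intros Ha Hb Hu Hv HH HK E.
  assert (X := edge_mm_mono a b M (-u) (-v) (-u0) (-v0) Ha Hb ltac:(lra) ltac:(lra) ltac:(lra) ltac:(lra) (edge_opp _ _ _ _ _ E)).
  unfold qf in *. lra.
Qed.

Lemma no_flip_3_7 (M h1 k2 k4 u0 u1 u2 u3 u4 v1 v2 v3 v4 : R) :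
  gap 3 7 M <= 43 ->
  3 * u1 = h1 + v1 + v2 -> 3 * u2 = 1/2 + v2 + v3 -> 3 * u3 = - (1/2) + v3 + v4 ->
  7 * v2 = k2 + u1 + u2 -> 7 * v3 = 1/2 + u2 + u3 -> 7 * v4 = k4 + u3 + u4 ->
  -1/2 <= v1 <= 1/2 -> -1/2 <= u4 <= 1/2 -> -1/2 <= k4 <= 3/2 ->
  h1 = 1/2 /\ -3/2 <= k2 <= -1/2 \/ h1 = -(1/2) /\ -1/2 <= k2 <= 1/2 ->
  edge 3 7 M u2 v3 -> False.
Proof.
  intros G U1 U2 U3 V2 V3 V4 A1 A4 K4 C E.
  (* Lower bounds for u2 and v3 that follow from the linear digit equations and the given ranges;
     the two lemmas below obtain their decimals in the same way. *)
  apply (edge_mm_mono _ _ _ _ _ (117/1000) (58/1000)) in E; try lra.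
  unfold gap, qf in *. lra.
Qed.

Lemma no_flip_3_10 (M h1 k2 k4 u0 u1 u2 u3 u4 v1 v2 v3 v4 : R) :
  gap 3 10 M <= 82 ->
  3 * u1 = h1 + v1 + v2 -> 3 * u2 = 1/2 + v2 + v3 -> 3 * u3 = - (1/2) + v3 + v4 ->
  10 * v2 = k2 + u1 + u2 -> 10 * v3 = u2 + u3 -> 10 * v4 = k4 + u3 + u4 ->
  -1/2 <= v1 <= 1/2 -> -1/2 <= u4 <= 1/2 -> 0 <= k4 <= 2 ->
  h1 = 1/2 /\ -2 <= k2 <= -1 \/ h1 = -(1/2) /\ k2 = 0 ->
  edge 3 10 M u2 v3 -> False.
Proof.
  intros G U1 U2 U3 V2 V3 V4 A1 A4 K4 C E.
  apply (edge_mm_mono _ _ _ _ _ (97/1000) (-10/1000)) in E; try lra.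
  unfold gap, qf in *. lra.
Qed.

Lemma no_flip_3_8 (M h1 k1 k2 k4 u0 u1 u2 u3 u4 v1 v2 v3 v4 : R) :
  gap 3 8 M <= 68 ->
  3 * u1 = h1 + v1 + v2 -> 3 * u2 = 1/2 + v2 + v3 -> 3 * u3 = - (1/2) + v3 + v4 ->
  8 * v1 = k1 + u0 + u1 -> 8 * v2 = k2 + u1 + u2 -> 8 * v3 = u2 + u3 -> 8 * v4 = k4 + u3 + u4 ->
  -1/2 <= v1 <= 1/2 -> -1/2 <= u4 <= 1/2 -> -1/2 <= u0 <= 1/2 -> 0 <= k4 <= 2 ->
  h1 = 1/2 /\ k2 = -1 \/ h1 = -(1/2) /\ k2 = 0 \/ h1 = 1/2 /\ k2 = -2 /\ -2 <= k1 <= 0 ->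
  edge 3 8 M u2 v2 -> edge 3 8 M u2 v3 -> False.
Proof.
  intros G U1 U2 U3 V1 V2 V3 V4 A1 A4 A0 K4 C E1 E.
  assert (h1 = 1/2 /\ k2 = -2 /\ -2 <= k1 <= 0 \/ (h1 = 1/2 /\ k2 = -1 \/ h1 = -(1/2) /\ k2 = 0)) as [C'|C'] by tauto; clear C.
  - apply (edge_pp_mono _ _ _ _ _ (94/1000) (-223/1000)) in E1; try lra.
    unfold gap, qf in *. lra.
  - apply (edge_mm_mono _ _ _ _ _ (125/1000) (-10/1000)) in E; try lra.
    unfold gap, qf in *. lra.
Qed.

Record segment (a b m M : R) (n : nat) (u v h k : nat -> R) : Prop := {
  seg_vertex : forall i, (i <= n)%nat -> vertex a b M (h i) (u i) (v i) (v (S i));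
  seg_v : forall i, (i < n)%nat -> b * v (S i) = k (S i) + u i + u (S i);
  seg_bound : forall i, (i <= S n)%nat -> -1/2 <= u i <= 1/2 /\ -1/2 <= v i <= 1/2;
  seg_h : forall i, (i <= n)%nat -> h i = 1/2 \/ h i = - (1/2);
  seg_k : forall i, (i < n)%nat -> exists z, k (S i) = IZR z - m / 2 }.

Lemma segment_opp (a b m M : R) (n : nat) (u v h k : nat -> R) :
  (exists z, m = IZR z) -> segment a b m M n u v h k ->
  segment a b m M n (fun i => - u i) (fun i => - v i) (fun i => - h i) (fun i => - k i).
Proof.
  intros [mz Hm] [S1 S2 S3 S4 S5]; split; intros i Hi.
  - apply vertex_opp; auto.
  - specialize (S2 i Hi). lra.
  - specialize (S3 i Hi). lra.
  - specialize (S4 i Hi). lra.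
  - destruct (S5 i Hi) as [z Hz]. exists (mz - z)%Z. rewrite minus_IZR. lra.
Qed.

Lemma segment_rev (a b m M : R) (n : nat) (u v h k : nat -> R) :
  segment a b m M n u v h k ->
  segment a b m M n (fun i => u (n - i)%nat) (fun i => v (S n - i)%nat)
    (fun i => h (n - i)%nat) (fun i => k (S n - i)%nat).
Proof.
  intros [S1 S2 S3 S4 S5]; split; intros i Hi.
  - apply vertex_sym. replace (S n - S i)%nat with (n - i)%nat by lia.
    replace (S n - i)%nat with (S (n - i)) by lia. apply S1; lia.
  - replace (S n - S i)%nat with (S (n - S i)) by lia. rewrite S2 by lia.
    replace (S (n - S i)) with (n - i)%nat by lia. lra.
  - split; apply S3; lia.
  - apply S4; lia.
  - replace (S n - S i)%nat with (S (n - S i)) by lia. apply S5; lia.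
Qed.

Definition flip_case (a b m k : R) : Prop :=
  5 <= a /\ m = 0 /\ k = 0 \/
  a = 3 /\ (b = 7 /\ m = 1 /\ (k = 1/2 \/ k = - (1/2)) \/ b = 8 /\ m = 2 /\ k = 0 \/ b = 10 /\ m = 2 /\ k = 0).

Lemma segment_k (a b m M : R) (n : nat) (u v h k : nat -> R) (i : nat) :
  regular a b m M -> segment a b m M n u v h k -> (i < n)%nat ->
  h i = 1/2 /\ h (S i) = 1/2 /\ (k (S i) = - (m/2) \/ k (S i) = - (m/2) - 1) \/
  h i = - (1/2) /\ h (S i) = - (1/2) /\ (k (S i) = m/2 \/ k (S i) = m/2 + 1) \/
  h i = - h (S i) /\ flip_case a b m (k (S i)).
Proof.
  intros R S Hi. assert (S' := segment_opp _ _ _ _ _ _ _ _ _ (reg_m _ _ _ _ R) S).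
  assert (V1 := seg_vertex _ _ _ _ _ _ _ _ _ S i ltac:(lia)).
  assert (V2 := seg_vertex _ _ _ _ _ _ _ _ _ S (Datatypes.S i) ltac:(lia)).
  assert (W1 := seg_vertex _ _ _ _ _ _ _ _ _ S' i ltac:(lia)).
  assert (W2 := seg_vertex _ _ _ _ _ _ _ _ _ S' (Datatypes.S i) ltac:(lia)).
  assert (K := seg_k _ _ _ _ _ _ _ _ _ S i Hi).
  assert (K' := seg_k _ _ _ _ _ _ _ _ _ S' i Hi).
  assert (E := seg_v _ _ _ _ _ _ _ _ _ S i Hi).
  cbv beta in *.
  destruct (seg_h _ _ _ _ _ _ _ _ _ S i ltac:(lia)) as [H1|H1];
  destruct (seg_h _ _ _ _ _ _ _ _ _ S (Datatypes.S i) ltac:(lia)) as [H2|H2]; rewrite H1, H2 in *;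
  rewrite ?Ropp_involutive in *.
  - left. repeat split; auto. exact (pair_same _ _ _ _ _ _ _ _ _ _ R V1 V2 E K).
  - right; right. split; [lra|]. unfold flip_case.
    destruct (Rle_or_lt 0 (k (Datatypes.S i))) as [L|L].
    + destruct (pair_flip _ _ _ _ _ _ _ _ _ _ R V1 V2 E K L); tauto.
    + assert (L' : 0 <= - k (Datatypes.S i)) by lra.
      destruct (pair_flip _ _ _ _ (- k (Datatypes.S i)) _ _ _ _ _ R (vertex_sym _ _ _ _ _ _ _ W2) (vertex_sym _ _ _ _ _ _ _ W1) ltac:(lra) K' L') as [X|X]; [left; lra|right; lra].
  - right; right. split; [lra|]. unfold flip_case.
    destruct (Rle_or_lt 0 (k (Datatypes.S i))) as [L|L].
    + destruct (pair_flip _ _ _ _ (k (Datatypes.S i)) _ _ _ _ _ R (vertex_sym _ _ _ _ _ _ _ V2) (vertex_sym _ _ _ _ _ _ _ V1) ltac:(lra) K L); tauto.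
    + assert (L' : 0 <= - k (Datatypes.S i)) by lra.
      destruct (pair_flip _ _ _ _ (- k (Datatypes.S i)) _ _ _ _ _ R W1 W2 ltac:(lra) K' L') as [X|X]; [left; lra|right; lra].
  - right; left. repeat split; auto.
    destruct (pair_same _ _ _ _ (- k (Datatypes.S i)) _ _ _ _ _ R W1 W2 ltac:(lra) K'); lra.
Qed.

(** These bound [gap] at the claimed values in the cases of [flip_case]. The first bound is
    [alternating_gap] at m = 0; 43 and 82 round up [alternating_gap 3 7 1] = 43 - 4/7 and
    [alternating_gap 3 10 2] = 82 - 2/5; 68 is the bound of [adm_m_gap] at (3,8) with m = 2. *)
Record flip_gap (a b m M : R) : Prop := {
  fg_zero : 5 <= a -> m = 0 ->
    (a = 5 \/ 7 <= a) /\ b = a + 1 /\ gap a b M <= (a-1)*(a*b-4) - b + 4 - 4 * / b \/ a + 3 <= b;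
  fg_7 : a = 3 -> b = 7 -> gap a b M <= 43;
  fg_8 : a = 3 -> b = 8 -> gap a b M <= 68;
  fg_10 : a = 3 -> b = 10 -> gap a b M <= 82 }.

(** First of two rounds of bootstrapping: |u| <= 1/2 gives |v| <= 2/6 and |a u| <= 1/2 + 2/3;
    feeding 7/6 back through a >= 5 gives |v| <= 1/4 and |a u| <= 1. Each round loses one index at
    either end. *)
Lemma scaled_u_bound (a b k k' h u u1 u2 v v' : R) : 5 <= a -> 6 <= b ->
  -1/2 <= u <= 1/2 -> -1/2 <= u1 <= 1/2 -> -1/2 <= u2 <= 1/2 ->
  -1 <= k <= 1 -> -1 <= k' <= 1 -> h = 1/2 \/ h = -(1/2) ->
  b * v = k + u1 + u -> b * v' = k' + u + u2 -> a * u = h + v + v' ->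
  -7/6 <= a * u <= 7/6.
Proof.
  intros Ha Hb A0 A1 A2 K K' H V V' U.
  assert (-1/3 <= v <= 1/3) by (split; apply Rmult_le_reg_l with b; lra).
  assert (-1/3 <= v' <= 1/3) by (split; apply Rmult_le_reg_l with b; lra).
  lra.
Qed.

Lemma scaled_u_bound_improved (a b k k' h u u1 u2 v v' : R) : 5 <= a -> 6 <= b ->
  -7/6 <= a * u <= 7/6 -> -7/6 <= a * u1 <= 7/6 -> -7/6 <= a * u2 <= 7/6 ->
  -1 <= k <= 1 -> -1 <= k' <= 1 -> h = 1/2 \/ h = -(1/2) ->
  b * v = k + u1 + u -> b * v' = k' + u + u2 -> a * u = h + v + v' ->
  -1 <= a * u <= 1.
Proof.
  intros Ha Hb A0 A1 A2 K K' H V V' U.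
  assert (S : forall x, -7/6 <= a * x <= 7/6 -> -7/30 <= x <= 7/30).
  { intros x X; split; apply Rmult_le_reg_l with a; lra. }
  apply S in A0, A1, A2.
  assert (-1/4 <= v <= 1/4) by (split; apply Rmult_le_reg_l with b; lra).
  assert (-1/4 <= v' <= 1/4) by (split; apply Rmult_le_reg_l with b; lra).
  lra.
Qed.

(** A window with indices 0 to 9 is long enough: after two rounds of bootstrapping |a u| <= 1 holds
    for the indices 2 to 7, which are the ones that the local estimates around the change from 4 to
    5 read. *)
Lemma no_flip_pos (a b m M : R) (u v h k : nat -> R) :
  regular a b m M -> flip_gap a b m M -> segment a b m M 9 u v h k ->
  h 4%nat = 1/2 -> h 5%nat = -(1/2) -> 0 <= k 5%nat -> False.
Proof.
  intros R G S H4 H5 K5.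
  assert (SK := fun i Hi => segment_k _ _ _ _ _ _ _ _ _ i R S Hi).
  assert (SH := seg_h _ _ _ _ _ _ _ _ _ S).
  assert (SB := seg_bound _ _ _ _ _ _ _ _ _ S).
  assert (SE := seg_v _ _ _ _ _ _ _ _ _ S).
  assert (SU := seg_vertex _ _ _ _ _ _ _ _ _ S).
  assert (EU : forall i, (i <= 9)%nat -> a * u i = h i + v i + v (Datatypes.S i)).
  { intros i Hi. destruct (SU i Hi); auto. }
  assert (E4 : edge a b M (u 4%nat) (v 4%nat)) by (destruct (SU 4%nat ltac:(lia)); auto).
  assert (E5 : edge a b M (u 4%nat) (v 5%nat)) by (destruct (SU 4%nat ltac:(lia)); auto).
  destruct (SK 4%nat ltac:(lia)) as [X|[X|[_ FC]]]; [lra|lra|].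
  assert (U3 := EU 3%nat ltac:(lia)). assert (U4 := EU 4%nat ltac:(lia)). assert (U5 := EU 5%nat ltac:(lia)).
  assert (V3 := SE 2%nat ltac:(lia)). assert (V4 := SE 3%nat ltac:(lia)).
  assert (V5 := SE 4%nat ltac:(lia)). assert (V6 := SE 5%nat ltac:(lia)).
  assert (KK2 := SK 2%nat ltac:(lia)). assert (KK3 := SK 3%nat ltac:(lia)). assert (KK5 := SK 5%nat ltac:(lia)).
  assert (B2 := SB 2%nat ltac:(lia)). assert (B3 := SB 3%nat ltac:(lia)). assert (B6 := SB 6%nat ltac:(lia)).
  assert (H3 := SH 3%nat ltac:(lia)). assert (H2 := SH 2%nat ltac:(lia)). assert (H6 := SH 6%nat ltac:(lia)).
  rewrite H4, H5 in *. unfold flip_case in *.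
  destruct FC as [(a5 & m0 & k0) | (a3 & FC)].
  - assert (KB : forall i, (i < 9)%nat -> -1 <= k (Datatypes.S i) <= 1).
    { intros i Hi. clear - SK m0 Hi. destruct (SK i Hi) as [X|[X|[_ X]]]; unfold flip_case in *; clear SK; lra. }
    assert (b6 : 6 <= b) by (destruct (reg_b _ _ _ _ R); lra).
    assert (AU : forall i, (1 <= i < 9)%nat -> -7/6 <= a * u i <= 7/6).
    { intros [|i] Hi; [lia|].
      apply (scaled_u_bound a b (k (Datatypes.S i)) (k (Datatypes.S (Datatypes.S i))) (h (Datatypes.S i)) _ (u i) (u (Datatypes.S (Datatypes.S i))) (v (Datatypes.S i)) (v (Datatypes.S (Datatypes.S i)))); auto;
      try (apply SB; lia); try (apply KB; lia); try (apply SH; lia); try (apply SE; lia); apply EU; lia. }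
    assert (AU' : forall i, (2 <= i < 8)%nat -> -1 <= a * u i <= 1).
    { intros [|i] Hi; [lia|].
      apply (scaled_u_bound_improved a b (k (Datatypes.S i)) (k (Datatypes.S (Datatypes.S i))) (h (Datatypes.S i)) _ (u i) (u (Datatypes.S (Datatypes.S i))) (v (Datatypes.S i)) (v (Datatypes.S (Datatypes.S i)))); auto;
      try (apply AU; lia); try (apply KB; lia); try (apply SH; lia); try (apply SE; lia); apply EU; lia. }
    assert (A2 := AU' 2%nat ltac:(lia)). assert (A3 := AU' 3%nat ltac:(lia)). assert (A4 := AU' 4%nat ltac:(lia)).
    assert (A5 := AU' 5%nat ltac:(lia)). assert (A6 := AU' 6%nat ltac:(lia)).
    assert (U6 := EU 6%nat ltac:(lia)).
    assert (KB2 := KB 2%nat ltac:(lia)).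
    assert (HN : 0 < a * b - 4) by (destruct (adm_basic _ _ _ _ (reg_adm _ _ _ _ R)) as (_&_&_&_&_&HN&_); lra).
    destruct (edge_HK _ _ _ _ _ HN E4) as [F1 F2]. destruct (edge_HK _ _ _ _ _ HN E5) as [F3 F4].
    rewrite k0 in *. rewrite Rplus_0_l in *.
    assert (k6 : 0 <= k 6%nat <= 1) by (clear - H4 H5 KK5 m0; lra).
    destruct (fg_zero _ _ _ _ G a5 m0) as [(a57 & Eb & Gb)|Hab].
    + assert (C : k 4%nat = 0 \/ h 3%nat = 1/2 /\ k 4%nat = -1) by (clear - KK3 m0; lra).
      assert (C' : h 3%nat = 1/2 \/ h 3%nat = -(1/2) /\ 0 <= k 3%nat) by (clear - H3 KK2 m0; lra).
      destruct C as [C | [C1 C2]].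
      * rewrite C in *. rewrite Rplus_0_l in *.
        eapply (no_flip_near_zero a b M (h 3%nat) (k 3%nat) (k 6%nat) (u 2%nat) (u 3%nat) (u 4%nat) (u 5%nat) (u 6%nat)); eauto.
        -- assert (0 < / b) by (apply Rinv_0_lt_compat; lra). lra.
        -- clear - C' KB2. lra.
      * rewrite C1, C2 in *.
        assert (k3 : -1 <= k 3%nat <= 0) by (clear - C1 KK2 m0; lra).
        eapply (no_flip_near_neg a b M (k 3%nat) (k 6%nat) (u 2%nat) (u 3%nat) (u 4%nat) (u 5%nat) (u 6%nat)); eauto.
        destruct KK5 as [X|[X|[X1 X2]]]; [lra| |left; lra].
        right. assert (K7 := KB 6%nat ltac:(lia)). assert (V7 := SE 6%nat ltac:(lia)).
        assert (A7 := AU' 7%nat ltac:(lia)).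
        assert (S' : forall x, -1 <= a * x <= 1 -> -1/5 <= x <= 1/5).
        { intros x Hx; split; apply Rmult_le_reg_l with a; lra. }
        apply S' in A5, A6, A7.
        assert (v 6%nat <= 7/30) by (apply Rmult_le_reg_l with b; lra).
        assert (v 7%nat <= 7/30) by (apply Rmult_le_reg_l with b; lra).
        apply Rmult_le_reg_l with a; lra.
    + eapply (no_flip_far a b M (h 3%nat) (k 3%nat) (k 4%nat) (k 6%nat) (u 2%nat) (u 3%nat) (u 4%nat) (u 5%nat) (u 6%nat)); eauto; [|clear - KK3 H3 m0; lra].
      assert (X := adm_n_gap _ _ _ _ (reg_adm _ _ _ _ R)). subst m. lra.
  - subst a. destruct FC as [(b7 & m1 & k1)|[(b8 & m2 & k0)|(b10 & m2 & k0)]]; subst b m.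
    + assert (k0 : k 5%nat = 1/2) by lra. rewrite k0 in *.
      apply (no_flip_3_7 M (h 3%nat) (k 4%nat) (k 6%nat) (u 2%nat) (u 3%nat) (u 4%nat) (u 5%nat) (u 6%nat) (v 3%nat) (v 4%nat) (v 5%nat) (v 6%nat)); auto; try lra.
      apply (fg_7 _ _ _ _ G); lra.
    + rewrite k0 in *. rewrite Rplus_0_l in *.
      apply (no_flip_3_8 M (h 3%nat) (k 3%nat) (k 4%nat) (k 6%nat) (u 2%nat) (u 3%nat) (u 4%nat) (u 5%nat) (u 6%nat) (v 3%nat) (v 4%nat) (v 5%nat) (v 6%nat)); auto; try lra.
      apply (fg_8 _ _ _ _ G); lra.
    + rewrite k0 in *. rewrite Rplus_0_l in *.
      apply (no_flip_3_10 M (h 3%nat) (k 4%nat) (k 6%nat) (u 2%nat) (u 3%nat) (u 4%nat) (u 5%nat) (u 6%nat) (v 3%nat) (v 4%nat) (v 5%nat) (v 6%nat)); auto; try lra.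
      apply (fg_10 _ _ _ _ G); lra.
Qed.

Lemma no_flip (a b m M : R) (u v h k : nat -> R) :
  regular a b m M -> flip_gap a b m M -> segment a b m M 9 u v h k ->
  h 4%nat = h 5%nat.
Proof.
  intros R G.
  assert (P : forall u v h k, segment a b m M 9 u v h k -> h 4%nat = 1/2 -> h 5%nat = -(1/2) -> False).
  { clear u v h k. intros u v h k S H4 H5.
    destruct (Rle_or_lt 0 (k 5%nat)) as [L|L].
    - exact (no_flip_pos _ _ _ _ _ _ _ _ R G S H4 H5 L).
    (* Reversal and negation together exchange the positions 4 and 5, preserve the pattern (1/2,
       -1/2) and negate k 5, which reduces to k 5 >= 0. *)
    - apply segment_rev in S. apply (segment_opp _ _ _ _ _ _ _ _ _ (reg_m _ _ _ _ R)) in S.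
      apply (no_flip_pos _ _ _ _ _ _ _ _ R G S); cbn; lra. }
  intros S.
  destruct (seg_h _ _ _ _ _ _ _ _ _ S 4 ltac:(lia)) as [H4|H4];
  destruct (seg_h _ _ _ _ _ _ _ _ _ S 5 ltac:(lia)) as [H5|H5]; try lra.
  - exfalso; eapply P; eauto.
  - exfalso. apply (segment_opp _ _ _ _ _ _ _ _ _ (reg_m _ _ _ _ R)) in S.
    eapply P; [exact S| |]; cbn; lra.
Qed.

(** * Corner values for prescribed digits and the exclusion of wrong digits *)

Lemma quad_digits (a b u v j k e y : R) : 0 < b ->
  b * (a*u-2*v) = b/2 + j -> b*v-2*u = k + e -> a * e = y ->
  quad a b (a*u-2*v) (b*v-2*u) =
    4 * (b/2 + j + k + e) * (a*k+y) + b + 4 * j + 4 * / b * (j*j).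
Proof.
  intros Hb EH EK Ee. unfold quad. rewrite EK.
  replace (a * b * (a*u-2*v) * (k+e)) with ((b * (a*u-2*v)) * (a * k + a * e)) by ring.
  replace (b * (a*u-2*v)^2) with (/ b * ((b * (a*u-2*v)) * (b * (a*u-2*v)))) by (field; lra).
  replace (a * (k+e)^2) with ((k+e) * (a * k + a * e)) by ring.
  rewrite EH, Ee. field. lra.
Qed.

Lemma lin_digits (a b u v j k e y : R) :
  b * (a*u-2*v) = b/2 + j -> b*v-2*u = k + e -> a * e = y ->
  lin a b (a*u-2*v) (b*v-2*u) = 2 * (a*b-4) * (b/2 + j + a * k + y).
Proof. intros EH EK Ee. unfold lin. rewrite EH, EK. rewrite <- Ee. ring. Qed.

Lemma abs_scale (a b c e : R) : 3 <= a -> 0 <= b -> 21 <= a * b -> - c <= a * b * e <= c ->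
  - (c / 3) <= b * e <= c / 3 /\ - (c / 21) <= e <= c / 21.
Proof.
  intros Ha Hb Hab H.
  assert (0 <= c) by lra.
  assert (-(c/3) <= b * e <= c/3) as X.
  { split; apply Rmult_le_reg_l with a; try lra; prod (a-3) c; lra. }
  split; [exact X|].
  split; apply Rmult_le_reg_l with (a*b); try lra; prod (a*b-21) c; lra.
Qed.

(** Bounds for every error monomial that the exclusion lemmas meet. The 4 comes from
    [straight_close]; dividing by ab >= 21, a >= 3 or b >= 6 gives 4/21, 4/3 and 2/3. *)
Lemma small_products (a b m j e1 e y : R) : 3 <= a -> 6 <= b -> 21 <= a * b -> 0 <= m -> a * m <= b -> a * e = y ->
  - 4 <= a * b * e1 <= 4 -> - 4 <= a * b * e <= 4 -> -1 <= j <= 1 ->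
  0 <= / b * ((j+e1)*(j+e1)) <= 1/3 /\ -4/3 <= a * m * e1 <= 4/3 /\ -4/3 <= a * m * e <= 4/3 /\
  -4/3 <= m * y <= 4/3 /\ -1/7 <= e1 * y <= 1/7 /\ -1/7 <= e * y <= 1/7 /\ 0 < / b /\
  -4/3 <= b * e1 <= 4/3 /\ -4/21 <= e1 <= 4/21 /\ -4/3 <= b * e <= 4/3 /\ -4/21 <= e <= 4/21 /\
  -2/3 <= y <= 2/3 /\ -2/3 <= a * e1 <= 2/3 /\
  -4 <= (a*b-4) * e1 <= 4 /\ -4 <= b * y <= 4.
Proof.
  intros Ha Hb Hab Hm Hr Ee E1 E2 J.
  destruct (abs_scale a b 4 e1 Ha ltac:(lra) Hab E1) as [X1 X2].
  destruct (abs_scale a b 4 e Ha ltac:(lra) Hab E2) as [X3 X4].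
  assert (Y : -4 <= b * y <= 4) by (rewrite <- Ee; lra).
  assert (Y' : -2/3 <= y <= 2/3) by (split; apply Rmult_le_reg_l with b; lra).
  assert (Ib : 0 < / b <= 1/6).
  { split; [apply Rinv_0_lt_compat; lra|]. apply Rmult_le_reg_l with b; [lra|]. rewrite Rinv_r; lra. }
  assert (Z : -2/3 <= a * e1 <= 2/3) by (split; apply Rmult_le_reg_l with b; lra).
  assert (W : -4 <= (a*b-4) * e1 <= 4).
  { destruct (Rle_or_lt 0 e1).
    - prod (a*b-4) e1. lra.
    - prod (a*b-4) (-e1). lra. }
  assert (Ab : forall t c x, 0 <= t <= c -> - (4/3) <= c * x <= 4/3 -> -4/3 <= t * x <= 4/3).
  { intros t c x Ht Hx. destruct (Rle_or_lt 0 x).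
    - prod (c-t) x. prod t x. lra.
    - prod (c-t) (-x). prod t (-x). lra. }
  assert (Sm : forall x z, -4/21 <= x <= 4/21 -> -2/3 <= z <= 2/3 -> -1/7 <= x * z <= 1/7).
  { intros x z Hx Hz.
    assert (0 <= (4/21 - x) * (2/3 + z)) by rpos. assert (0 <= (4/21 + x) * (2/3 - z)) by rpos.
    assert (0 <= (4/21 - x) * (2/3 - z)) by rpos. assert (0 <= (4/21 + x) * (2/3 + z)) by rpos. lra. }
  prod (a-3) m.
  assert (0 <= (j+e1)*(j+e1)) by apply Rle_0_sqr.
  repeat match goal with |- _ /\ _ => split end; try lra; try (apply Sm; lra).
  - apply Rmult_le_pos; lra.
  - assert (0 <= (1/6 - / b) * ((j+e1)*(j+e1))) by (apply Rmult_le_pos; lra).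
    assert (0 <= (1+4/21 - (j+e1)) * (1+4/21 + (j+e1))) by rpos. lra.
  - apply (Ab (a*m) b); lra.
  - apply (Ab (a*m) b); lra.
  - apply (Ab (a*m) b); lra.
  - apply (Ab (a*m) b); lra.
  - apply (Ab m (b/3)); lra.
  - apply (Ab m (b/3)); lra.
Qed.

(** j is the preceding digit minus the current digit -m/2 - 1, so j = 1 or j = 0, and the next digit
    being at most -m/2 bounds b y from above. The leading part of [edge_pp] is (2b - 2am - 2a +
    2j)(ab - 4) - 2ab; its first summand is at most 0 since b <= am + a - 1, and -2ab outweighs the
    errors. *)
Lemma lower_digit_excluded (a b m M u v j e1 e y : R) : 3 <= a -> 6 <= b -> 21 <= a * b -> 0 <= m ->
  a * m + 2 <= b <= a * m + a - 1 ->
  gap a b M <= (b - a * m) * (a * b - 4) + a * m * (b - m) - b ->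
  b * (a*u-2*v) = b/2 + (j + e1) -> b*v-2*u = (- (m/2) - 1) + e -> a * e = y ->
  - 4 <= a * b * e1 <= 4 -> - 4 <= a * b * e <= 4 ->
  (j = 1 /\ b * y <= 8/21 \/ j = 0 /\ b * y <= 1 + 8/21) ->
  0 < gap a b M + quad a b (a*u-2*v) (b*v-2*u) + lin a b (a*u-2*v) (b*v-2*u) -> False.
Proof.
  intros Ha Hb Hab Hm Hr G EH EK Ee E1 E2 C F.
  rewrite (quad_digits a b u v (j+e1) (-(m/2)-1) e y) in F by lra.
  rewrite (lin_digits a b u v (j+e1) (-(m/2)-1) e y) in F by lra.
  destruct (small_products a b m j e1 e y) as (P1 & P2 & P3 & P4 & P5 & P6 & P7 & X1 & X2 & X3 & X4 & Y' & Z & W & Y); auto; try lra.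
  prod (a-3) (b-6). prod (a-3) m.
  assert (0 <= (a*m+a-1-b) * (a*b-4)) by (apply Rmult_le_pos; lra).
  destruct C as [[-> C]|[-> C]].
  - assert (Wy : (a*b-4) * y <= a * (8/21)) by (prod a (8/21 - b*y); destruct (Rle_or_lt 0 y); [|prod (a*b-4) (-y)]; lra). lra.
  - assert (Wy : (a*b-4) * y <= a * (1+8/21)) by (prod a (1+8/21 - b*y); destruct (Rle_or_lt 0 y); [|prod (a*b-4) (-y)]; lra). lra.
Qed.

Lemma upper_digit_excluded (a b m M u v j e1 e y : R) : 3 <= a -> 6 <= b -> 21 <= a * b -> 0 <= m ->
  a * m + a + 3 <= b ->
  gap a b M <= (a * (m + 2) - b) * (a * b - 4) + a * (m + 2) * (b - (m + 2)) - b ->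
  b * (a*u-2*v) = b/2 + (j + e1) -> b*v-2*u = - (m/2) + e -> a * e = y ->
  - 4 <= a * b * e1 <= 4 -> - 4 <= a * b * e <= 4 ->
  (j = -1 /\ - (8/21) <= b * y \/ j = 0 /\ - (1 + 8/21) <= b * y) ->
  0 < gap a b M + quad a b (a*u-2*v) (b*v-2*u) - lin a b (a*u-2*v) (b*v-2*u) -> False.
Proof.
  intros Ha Hb Hab Hm Hr G EH EK Ee E1 E2 C F.
  rewrite (quad_digits a b u v (j+e1) (-(m/2)) e y) in F by lra.
  rewrite (lin_digits a b u v (j+e1) (-(m/2)) e y) in F by lra.
  destruct (small_products a b m j e1 e y) as (P1 & P2 & P3 & P4 & P5 & P6 & P7 & X1 & X2 & X3 & X4 & Y' & Z & W & Y); auto; try lra.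
  prod (a-3) (b-6). prod (a-3) m.
  assert (0 <= (b-(a*m+a+3)) * (a*b-4)) by (apply Rmult_le_pos; lra).
  destruct C as [[-> C]|[-> C]].
  - assert (Wy : - (a * (8/21)) <= (a*b-4) * y) by (prod a (8/21 + b*y); destruct (Rle_or_lt y 0); [|prod (a*b-4) y]; lra). lra.
  - assert (Wy : - (a * (1+8/21)) <= (a*b-4) * y) by (prod a (1+8/21 + b*y); destruct (Rle_or_lt y 0); [|prod (a*b-4) y]; lra). lra.
Qed.

(* The value of [gap] at the minimum of f on the grid of the word B_m B_n. *)
Definition alternating_gap (a b m : R) : R :=
  (a-1) * (a*b-4) + a*b*m - 2*a*m - a*m^2 - b + 4 - 4 * / b.

(** j = 0 encodes two equal consecutive digits. With [gap] near (a-1)(ab-4) and [lin] near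
    (a+1)(ab-4), the inequality [edge_mm] misses by about 2 (ab - 4). For the lower digit the terms
    in ab - 4 cancel and the deficit of about 2ab comes from [quad]. *)
Lemma upper_pair_excluded (a b m M u v e1 e y : R) : 3 <= a -> 6 <= b -> 21 <= a * b -> 0 <= m ->
  b = a * m + a + 1 -> 7 <= b \/ 5 <= a ->
  gap a b M <= alternating_gap a b m ->
  b * (a*u-2*v) = b/2 + (0 + e1) -> b*v-2*u = - (m/2) + e -> a * e = y ->
  - 4 <= a * b * e1 <= 4 -> - 4 <= a * b * e <= 4 -> - (1 + 8/21) <= b * y ->
  0 < gap a b M + quad a b (a*u-2*v) (b*v-2*u) - lin a b (a*u-2*v) (b*v-2*u) -> False.
Proof.
  intros Ha Hb Hab Hm Hr D G EH EK Ee E1 E2 C F. set (j := 0) in EH. assert (H : j = 0) by reflexivity.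
  rewrite (quad_digits a b u v (j+e1) (-(m/2)) e y) in F by lra.
  rewrite (lin_digits a b u v (j+e1) (-(m/2)) e y) in F by lra.
  destruct (small_products a b m j e1 e y) as (P1 & P2 & P3 & P4 & P5 & P6 & P7 & X1 & X2 & X3 & X4 & Y' & Z & W & Y); auto; try lra.
  assert (P0 : / b * ((j+e1)*(j+e1)) <= 1/100).
  { apply Rmult_le_reg_l with b; [lra|]. rewrite <- Rmult_assoc, Rinv_r by lra.
    assert (0 <= (4/21 - e1) * (4/21 + e1)) by rpos. rewrite H. lra. }
  clearbody j. subst j. unfold alternating_gap in G.
  prod (a-3) (b-6). prod (a-3) m. assert (Wy : - (a * (1+8/21)) <= (a*b-4) * y) by (prod a (1+8/21 + b*y); destruct (Rle_or_lt y 0); [|prod (a*b-4) y]; lra).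
  assert ((b - a*m-a-1) * (a*b-4) = 0) by (rewrite Hr; ring).
  destruct D; lra.
Qed.

Lemma lower_pair_excluded (a b m M u v e1 e y : R) : 3 <= a -> 6 <= b -> 21 <= a * b -> 0 <= m ->
  b = a * m + a + 1 -> 7 <= b \/ 5 <= a ->
  gap a b M <= alternating_gap a b m ->
  b * (a*u-2*v) = b/2 + (0 + e1) -> b*v-2*u = (- (m/2) - 1) + e -> a * e = y ->
  - 4 <= a * b * e1 <= 4 -> - 4 <= a * b * e <= 4 -> b * y <= 1 + 8/21 ->
  0 < gap a b M + quad a b (a*u-2*v) (b*v-2*u) + lin a b (a*u-2*v) (b*v-2*u) -> False.
Proof.
  intros Ha Hb Hab Hm Hr D G EH EK Ee E1 E2 C F. set (j := 0) in EH. assert (H : j = 0) by reflexivity.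
  rewrite (quad_digits a b u v (j+e1) (-(m/2)-1) e y) in F by lra.
  rewrite (lin_digits a b u v (j+e1) (-(m/2)-1) e y) in F by lra.
  destruct (small_products a b m j e1 e y) as (P1 & P2 & P3 & P4 & P5 & P6 & P7 & X1 & X2 & X3 & X4 & Y' & Z & W & Y); auto; try lra.
  assert (P0 : / b * ((j+e1)*(j+e1)) <= 1/100).
  { apply Rmult_le_reg_l with b; [lra|]. rewrite <- Rmult_assoc, Rinv_r by lra.
    assert (0 <= (4/21 - e1) * (4/21 + e1)) by rpos. rewrite H. lra. }
  clearbody j. subst j. unfold alternating_gap in G.
  prod (a-3) (b-6). prod (a-3) m. assert (Wy : (a*b-4) * y <= a * (1+8/21)) by (prod a (1+8/21 - b*y); destruct (Rle_or_lt 0 y); [|prod (a*b-4) (-y)]; lra).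
  assert ((b - a*m-a-1) * (a*b-4) = 0) by (rewrite Hr; ring).
  assert (Em : a*m*e = m*y) by (rewrite <- Ee; ring).
  (* 29/126 is (1 + 8/21)/6, and 29/378 below is this divided by 3, as a e = y. *)
  assert (Y2 : y <= 29/126).
  { apply Rmult_le_reg_l with 6; [lra|]. destruct (Rle_or_lt y 0); [lra|]. prod (b-6) y. lra. }
  assert (Q1 : (2*(a*b-4) - 2*a*m-4*a+4)*e1 <= 8).
  { assert (0 <= a * (b - m - 2) - 2).
    { assert (3 <= a * (b-m-2)); [|lra]. apply Rle_trans with (3 * (b-m-2)); [lra|].
      apply Rmult_le_compat_r; lra. }
    destruct (Rle_or_lt 0 e1).
    - prod (a*m+2*a-2) e1. lra.
    - assert (0 <= (2*(a*b-4) - 2*a*m-4*a+4)*(-e1)) by rpos. lra. }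
  clear Wy P2 W Z.
  destruct (Rle_or_lt 0 y) as [y0|y0].
  - prod (4/21-e1) y. prod (29/126-y) y. prod m y. prod (4/21 - e) y.
    assert (Wy : (a*b-4) * y <= a * (1+8/21)) by (prod a (1+8/21-b*y); lra).
    assert (E3 : e <= 29/378).
    { apply Rmult_le_reg_l with a; [lra|]. lra. }
    prod (29/378-e) y.
    destruct D as [D|D].
    + assert (X : 302/20 <= a*(2*b-2*m-4-58/21)).
      { prod (a-3) m. prod (a-3) (b-7). prod (a-3) (a-3). lra. }
      lra.
    + assert (X : 25 <= a*(2*b-2*m-4-58/21)).
      { prod (a-3) m. prod (a-5) (b-6). prod (a-5) (a-3). lra. }
      lra.
  - assert (0 <= (2*b-4*m-8+2*(a*b-4))*(-y)) by (apply Rmult_le_pos; lra).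
    assert (X : 15 <= a*(2*b-2*m-4)).
    { prod (a-3) m. prod (a-3) (b-6). lra. }
    lra.
Qed.

(** * Convergence of the digit recursion *)

Record chain (a b m M : R) (u v h k : nat -> R) : Prop := {
  chain_vertex : forall i, vertex a b M (h i) (u i) (v i) (v (S i));
  chain_v : forall i, b * v (S i) = k (S i) + u i + u (S i);
  chain_bound : forall i, -1/2 <= u i <= 1/2 /\ -1/2 <= v i <= 1/2;
  chain_h : forall i, h i = 1/2 \/ h i = - (1/2);
  chain_k : forall i, exists z, k (S i) = IZR z - m / 2 }.

Record straight (a b m M : R) (u v k : nat -> R) : Prop := {
  str_vertex : forall i, vertex a b M (1/2) (u i) (v i) (v (S i));
  str_v : forall i, b * v (S i) = k (S i) + u i + u (S i);
  str_bound : forall i, -1/2 <= u i <= 1/2 /\ -1/2 <= v i <= 1/2;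
  str_k : forall i, k (S i) = - (m/2) \/ k (S i) = - (m/2) - 1 }.

Lemma chain_shift (a b m M : R) (u v h k : nat -> R) (j : nat) : chain a b m M u v h k ->
  chain a b m M (fun i => u (j + i)%nat) (fun i => v (j + i)%nat) (fun i => h (j + i)%nat) (fun i => k (j + i)%nat).
Proof.
  intros [C1 C2 C3 C4 C5]; split; intros i; rewrite ?Nat.add_succ_r; auto.
Qed.

Lemma chain_opp (a b m M : R) (u v h k : nat -> R) : (exists z, m = IZR z) -> chain a b m M u v h k ->
  chain a b m M (fun i => - u i) (fun i => - v i) (fun i => - h i) (fun i => - k i).
Proof.
  intros [mz Hm] [C1 C2 C3 C4 C5]; split; intros i.
  - apply vertex_opp; auto.
  - specialize (C2 i). lra.
  - specialize (C3 i). lra.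
  - specialize (C4 i). lra.
  - destruct (C5 i) as [z Hz]. exists (mz - z)%Z. rewrite minus_IZR. lra.
Qed.

Lemma chain_segment (a b m M : R) (u v h k : nat -> R) (n : nat) :
  chain a b m M u v h k -> segment a b m M n u v h k.
Proof. intros [C1 C2 C3 C4 C5]; split; auto. Qed.

Lemma chain_straight (a b m M : R) (u v h k : nat -> R) :
  regular a b m M -> flip_gap a b m M -> chain a b m M u v h k ->
  exists u' v' k', straight a b m M u' v' k'.
Proof.
  intros R G C.
  assert (P : forall u v h k, chain a b m M u v h k -> h 4%nat = 1/2 -> exists u' v' k', straight a b m M u' v' k').
  { clear u v h k C. intros u v h k C H4.
    assert (H : forall i, h (4 + i)%nat = 1/2).
    { induction i as [|i IH]; [exact H4|].
      assert (X := no_flip _ _ _ _ _ _ _ _ R G (chain_segment _ _ _ _ _ _ _ _ 9 (chain_shift _ _ _ _ _ _ _ _ i C))).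
      cbv beta in X. replace (i + 4)%nat with (4 + i)%nat in X by lia.
      replace (i + 5)%nat with (4 + S i)%nat in X by lia. lra. }
    apply (chain_shift _ _ _ _ _ _ _ _ 4) in C.
    exists (fun i => u (4 + i)%nat), (fun i => v (4 + i)%nat), (fun i => k (4 + i)%nat).
    split; intros i.
    - rewrite <- (H i). apply (chain_vertex _ _ _ _ _ _ _ _ C).
    - apply (chain_v _ _ _ _ _ _ _ _ C).
    - apply (chain_bound _ _ _ _ _ _ _ _ C).
    - destruct (segment_k _ _ _ _ (S i) _ _ _ _ i R (chain_segment _ _ _ _ _ _ _ _ (S i) C) ltac:(lia)) as [X|[X|X]];
      rewrite ?(H i), ?(H (S i)) in X; lra. }
  destruct (chain_h _ _ _ _ _ _ _ _ C 4) as [H4|H4].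
  - eapply P; eauto.
  - apply (chain_opp _ _ _ _ _ _ _ _ (reg_m _ _ _ _ R)) in C. eapply P; [exact C|]. cbv beta. lra.
Qed.

(** * Digits of a chain without change of sign *)

Section Straight.

Context {a b m M : R} {u v k : nat -> R} (R : regular a b m M) (S : straight a b m M u v k).

(** 21 = 3 * 7 is the least product that remains once (3,6) is removed by the last clause of
    [vertex_K]. *)
Lemma straight_ab : 21 <= a * b.
Proof.
  destruct (vertex_K _ _ _ _ _ _ _ R (str_vertex _ _ _ _ _ _ _ S 0)) as (_ & _ & _ & N).
  destruct (reg_a _ _ _ _ R) as [a5|[a3 _]]; destruct (reg_b _ _ _ _ R) as [[b6 m0]|b7].
  - prod (a-5) b. lra.
  - prod (a-5) (b-7). lra.
  - exfalso. apply N; rewrite ?a3, ?b6, ?m0; lra.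
  - subst a; lra.
Qed.

Lemma straight_u (i : nat) : a * u i = 1/2 + v i + v (Datatypes.S i).
Proof. apply (str_vertex _ _ _ _ _ _ _ S). Qed.

(** Bootstrapping: ab (u_i - u_j) is at most 2 from the digits, which take two values at distance 1,
    plus four differences of u. The trivial bound 1 on these gives 6, hence differences of at most
    6/21 = 2/7, hence 2 + 8/7 <= 4. The two rounds account for the shift of the indices by 2. *)
Lemma straight_close (i j : nat) :
  -4 <= a * b * (u (2+i)%nat - u (2+j)%nat) <= 4.
Proof.
  assert (Hab := straight_ab).
  assert (D : forall i j, a * b * (u i - u j) = b * v i + b * v (Datatypes.S i) - b * v j - b * v (Datatypes.S j)).
  { intros i' j'. replace (a*b*(u i' - u j')) with (b * (a * u i' - a * u j')) by ring.
    rewrite !straight_u. ring. }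
  assert (D1 : forall i j, a * b * (u (1+i)%nat - u (1+j)%nat) <= 6).
  { intros i' j'. rewrite D. cbn [Nat.add]. rewrite !(str_v _ _ _ _ _ _ _ S).
    assert (B1 := str_bound _ _ _ _ _ _ _ S i'). assert (B2 := str_bound _ _ _ _ _ _ _ S (1+i')).
    assert (B3 := str_bound _ _ _ _ _ _ _ S (2+i')). assert (B4 := str_bound _ _ _ _ _ _ _ S j').
    assert (B5 := str_bound _ _ _ _ _ _ _ S (1+j')). assert (B6 := str_bound _ _ _ _ _ _ _ S (2+j')).
    assert (K1 := str_k _ _ _ _ _ _ _ S i'). assert (K2 := str_k _ _ _ _ _ _ _ S (1+i')).
    assert (K3 := str_k _ _ _ _ _ _ _ S j'). assert (K4 := str_k _ _ _ _ _ _ _ S (1+j')).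
    cbn [Nat.add] in *. lra. }
  assert (D2 : forall i j, u (1+i)%nat - u (1+j)%nat <= 2/7).
  { intros i' j'. apply Rmult_le_reg_l with (a*b); [lra|]. specialize (D1 i' j'). lra. }
  assert (D3 : forall i j, a * b * (u (2+i)%nat - u (2+j)%nat) <= 4).
  { intros i' j'. rewrite D. cbn [Nat.add]. rewrite !(str_v _ _ _ _ _ _ _ S).
    assert (B1 := D2 i' j'). assert (B2 := D2 (1+i')%nat (1+j')%nat). assert (B3 := D2 (2+i')%nat (2+j')%nat).
    assert (K1 := str_k _ _ _ _ _ _ _ S (1+i')). assert (K2 := str_k _ _ _ _ _ _ _ S (2+i')).
    assert (K3 := str_k _ _ _ _ _ _ _ S (1+j')). assert (K4 := str_k _ _ _ _ _ _ _ S (2+j')).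
    cbn [Nat.add] in *. lra. }
  assert (X := D3 i j). assert (Y := D3 j i). lra.
Qed.

End Straight.

Section Digits.

Context {a b m M : R} {u v k : nat -> R} (R : regular a b m M) (S : straight a b m M u v k).

Lemma straight_params : 3 <= a /\ 6 <= b /\ 21 <= a * b /\ 0 <= m /\ (7 <= b \/ 5 <= a).
Proof.
  assert (X := straight_ab R S).
  destruct (adm_basic _ _ _ _ (reg_adm _ _ _ _ R)) as (Ha & Hm & _).
  destruct (reg_b _ _ _ _ R) as [[b6 m0]|b7]; destruct (reg_a _ _ _ _ R) as [a5|[a3 _]]; subst; repeat split; lra.
Qed.

(** The edge (u_(3+i), v_(4+i)) expressed by three consecutive digits. The errors e1 and e are
    differences of u; b y differs from k_(5+i) - k_(3+i) by two such differences, whence 8/21 = 2 *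
    4/21. *)
Lemma straight_window (i : nat) :
  exists j e1 e y,
  j = k (3+i)%nat - k (4+i)%nat /\
  b * (a * u (3+i)%nat - 2 * v (4+i)%nat) = b/2 + (j + e1) /\
  b * v (4+i)%nat - 2 * u (3+i)%nat = k (4+i)%nat + e /\ a * e = y /\
  -4 <= a*b*e1 <= 4 /\ -4 <= a*b*e <= 4 /\
  k (5+i)%nat - k (3+i)%nat - 8/21 <= b * y <= k (5+i)%nat - k (3+i)%nat + 8/21 /\
  0 < gap a b M + quad a b (a * u (3+i)%nat - 2 * v (4+i)%nat) (b * v (4+i)%nat - 2 * u (3+i)%nat)
    + lin a b (a * u (3+i)%nat - 2 * v (4+i)%nat) (b * v (4+i)%nat - 2 * u (3+i)%nat) /\
  0 < gap a b M + quad a b (a * u (3+i)%nat - 2 * v (4+i)%nat) (b * v (4+i)%nat - 2 * u (3+i)%nat)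
    - lin a b (a * u (3+i)%nat - 2 * v (4+i)%nat) (b * v (4+i)%nat - 2 * u (3+i)%nat).
Proof.
  destruct straight_params as (Ha & Hb & Hab & Hm & _).
  assert (U3 := straight_u S (3+i)). assert (U4 := straight_u S (4+i)).
  assert (V3 := str_v _ _ _ _ _ _ _ S (2+i)). assert (V4 := str_v _ _ _ _ _ _ _ S (3+i)). assert (V5 := str_v _ _ _ _ _ _ _ S (4+i)).
  assert (C1 := straight_close R S i (2+i)). assert (C2 := straight_close R S (2+i) (1+i)).
  assert (C3 := straight_close R S (2+i) (i)). assert (C4 := straight_close R S (3+i) (1+i)).
  cbn [Nat.add] in *.
  exists (k (3+i)%nat - k (4+i)%nat), (u (2+i)%nat - u (4+i)%nat), (u (4+i)%nat - u (3+i)%nat), (v (5+i)%nat - v (3+i)%nat).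
  cbn [Nat.add] in *.
  split; [reflexivity|]. split; [rewrite U3; lra|]. split; [lra|]. split; [lra|]. split; [lra|]. split; [lra|]. split.
  - assert (D : forall x, -4 <= a*b*x <= 4 -> -4/21 <= x <= 4/21).
    { intros x Hx; split; apply Rmult_le_reg_l with (a*b); lra. }
    apply D in C3, C4. lra.
  - apply edge_HK; [lra|]. apply (str_vertex _ _ _ _ _ _ _ S).
Qed.

Lemma digit_cases (i : nat) : k (Datatypes.S i) = - (m/2) \/ k (Datatypes.S i) = - (m/2) - 1.
Proof. apply (str_k _ _ _ _ _ _ _ S). Qed.

Lemma all_upper (i : nat) : b <= a * m + a - 1 -> k (4+i)%nat = - (m/2).
Proof.
  intros Hr.
  destruct straight_params as (Ha & Hb & Hab & Hm & _).
  destruct (adm_basic _ _ _ _ (reg_adm _ _ _ _ R)) as (_ & _ & _ & Hr' & _).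
  destruct (straight_window i) as (j & e1 & e & y & Ej & EH & EK & Ee & E1 & E2 & Y & F1 & F2).
  assert (D3 := digit_cases (2+i)). assert (D4 := digit_cases (3+i)). assert (D5 := digit_cases (4+i)).
  cbn [Nat.add] in *. destruct D4 as [D4|D4]; [exact D4|exfalso].
  rewrite D4 in *.
  apply (lower_digit_excluded a b m M (u (3+i)%nat) (v (4+i)%nat) j e1 e y); auto; try lra.
  apply (adm_m_gap _ _ _ _ (reg_adm _ _ _ _ R)).
Qed.

Lemma all_lower (i : nat) : a * m + a + 3 <= b -> k (4+i)%nat = - (m/2) - 1.
Proof.
  intros Hr.
  destruct straight_params as (Ha & Hb & Hab & Hm & _).
  destruct (straight_window i) as (j & e1 & e & y & Ej & EH & EK & Ee & E1 & E2 & Y & F1 & F2).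
  assert (D3 := digit_cases (2+i)). assert (D4 := digit_cases (3+i)). assert (D5 := digit_cases (4+i)).
  cbn [Nat.add] in *. destruct D4 as [D4|D4]; [exfalso|exact D4].
  rewrite D4 in *.
  apply (upper_digit_excluded a b m M (u (3+i)%nat) (v (4+i)%nat) j e1 e y); auto; try lra.
  apply (adm_n_gap _ _ _ _ (reg_adm _ _ _ _ R)).
Qed.

Lemma alternate (i : nat) : b = a * m + a + 1 -> gap a b M <= alternating_gap a b m ->
  k (3+i)%nat + k (4+i)%nat = - m - 1.
Proof.
  intros Hr G.
  destruct straight_params as (Ha & Hb & Hab & Hm & D).
  destruct (straight_window i) as (j & e1 & e & y & Ej & EH & EK & Ee & E1 & E2 & Y & F1 & F2).
  assert (D3 := digit_cases (2+i)). assert (D4 := digit_cases (3+i)). assert (D5 := digit_cases (4+i)).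
  cbn [Nat.add] in *.
  destruct D3 as [D3|D3]; destruct D4 as [D4|D4]; try lra; exfalso; rewrite D3, D4 in *;
    replace j with 0 in * by lra.
  - apply (upper_pair_excluded a b m M (u (3+i)%nat) (v (4+i)%nat) e1 e y); auto; lra.
  - apply (lower_pair_excluded a b m M (u (3+i)%nat) (v (4+i)%nat) e1 e y); auto; lra.
Qed.

End Digits.

(** * Convergence to the periodic point *)

Lemma contraction (a b : R) (p q : nat -> R) : 3 <= a -> 3 <= b ->
  (forall i, -1 <= p i <= 1) -> (forall i, -1 <= q i <= 1) ->
  (forall i, a * p i = q i + q (S i)) -> (forall i, b * q (S i) = p i + p (S i)) ->
  forall j i, Rabs (p (j + i)%nat) <= (2/3)^j /\ Rabs (q (j + i)%nat) <= (2/3)^j.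
Proof.
  intros Ha Hb Bp Bq P Q.
  assert (T : forall c x y z t, 3 <= c -> c * x = y + z -> Rabs y <= t -> Rabs z <= t -> Rabs x <= 2/3 * t).
  { intros c x y z t Hc E Y Z.
    assert (X : Rabs (c * x) <= 2 * t) by (rewrite E; eapply Rle_trans; [apply Rabs_triang|lra]).
    rewrite Rabs_mult, (Rabs_right c) in X by lra.
    assert (0 <= Rabs x) by apply Rabs_pos. prod (c-3) (Rabs x). lra. }
  induction j as [|j IH]; intros i.
  - cbn. split; apply Rabs_le; [specialize (Bp i)|specialize (Bq i)]; lra.
  - destruct (IH i) as [P0 Q0]. destruct (IH (S i)) as [P1 Q1]. destruct (IH (S (S i))) as [P2 Q2].
    rewrite !Nat.add_succ_r in *. cbn [pow Nat.add]. split.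
    + apply (T a _ (q (S (j+i))) (q (S (S (j+i))))); auto.
    + apply (T b _ (p (j+i)%nat) (p (S (j+i)))); auto.
Qed.

Lemma qf_continuous (a b s t s0 t0 e : R) : 0 <= a -> 0 <= b -> 0 <= e ->
  Rabs (s - s0) <= e -> Rabs (t - t0) <= e -> -1 <= s <= 1 -> -1 <= t <= 1 -> -1 <= s0 <= 1 -> -1 <= t0 <= 1 ->
  qf a b s0 t0 - qf a b s t <= 2 * (a + b + a * b) * e.
Proof.
  intros Ha Hb He Hs Ht S1 T1 S0 T0.
  assert (B : forall x c d, Rabs x <= e -> 0 <= c -> -d <= c <= d -> True) by auto. clear B.
  assert (M : forall x y, Rabs x <= e -> -2 <= y <= 2 -> x * y <= 2 * e).
  { intros x y Hx Hy. eapply Rle_trans; [apply Rle_abs|]. rewrite Rabs_mult, Rmult_comm.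
    assert (Rabs y <= 2) by (apply Rabs_le; lra).
    apply Rmult_le_compat; auto using Rabs_pos. }
  rewrite Rabs_minus_sym in Hs, Ht.
  assert (X1 := M (s0-s) (s0+s) Hs ltac:(lra)).
  assert (X2 := M (t0-t) (t0+t) Ht ltac:(lra)).
  assert (Y1 := M (s0-s) (2*t0) Hs ltac:(lra)).
  assert (Y2 := M (t0-t) (2*s) Ht ltac:(lra)).
  unfold qf.
  assert (0 <= a * (2*e - (s0-s)*(s0+s))) by rpos.
  assert (0 <= b * (2*e - (t0-t)*(t0+t))) by rpos.
  assert (0 <= a * b * (4*e - (s0-s)*(2*t0) - (t0-t)*(2*s))) by rpos.
  lra.
Qed.

(** Eliminating v from a w = 1/2 + v_i + v_(i+1) and b v_i = k_i + 2w gives (ab - 4) w = b/2 + c, so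
    digits of constant consecutive sum c share one u-coordinate w. The distance to this point obeys
    the homogeneous recursion and tends to 0; along the indices with digit kap the strict corner
    inequalities become weak ones in the limit. *)
Lemma straight_limit (a b m M c kap w : R) (u v k : nat -> R) :
  regular a b m M -> straight a b m M u v k -> - m - 2 <= c <= - m ->
  (forall i, k (S i) + k (S (S i)) = c) -> (forall n, exists i, (n <= i)%nat /\ k (S i) = kap) ->
  (a * b - 4) * w = b / 2 + c ->
  M <= - qf a b (1/2 - w) (-(1/2 - (kap + 2 * w)/b)) /\
  M <= - qf a b (1/2 + w) (-(1/2 + (kap + 2 * w)/b)).
Proof.
  intros R S Hc K Inf W.
  destruct (straight_params R S) as (Ha & Hb & Hab & Hm & _).
  destruct (adm_basic _ _ _ _ (reg_adm _ _ _ _ R)) as (_ & _ & Hb3 & Hb' & _).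
  prod (a-3) (b-6).
  assert (Bw : -1/2 <= w <= 1/2) by (split; apply Rmult_le_reg_l with (a*b-4); lra).
  set (vs := fun i => (k i + 2 * w) / b).
  assert (Evs : forall i, b * vs i = k i + 2 * w) by (intros i; unfold vs; field; lra).
  assert (Bvs : forall i, -1/2 <= vs (Datatypes.S i) <= 1/2).
  { intros i. destruct (str_k _ _ _ _ _ _ _ S i); split; apply Rmult_le_reg_l with b; rewrite ?Evs; lra. }
  assert (Ew : forall i, a * w = 1/2 + vs (Datatypes.S i) + vs (Datatypes.S (Datatypes.S i))).
  { intros i. apply Rmult_eq_reg_l with b; [|lra]. specialize (K i).
    rewrite !Rmult_plus_distr_l, !Evs. lra. }
  assert (Conv := contraction a b (fun i => u (1+i)%nat - w) (fun i => v (1+i)%nat - vs (1+i)%nat) Ha ltac:(lra)).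
  assert (Cv : forall j i, Rabs (u (Datatypes.S (j+i)) - w) <= (2/3)^j /\ Rabs (v (Datatypes.S (j+i)) - vs (Datatypes.S (j+i))) <= (2/3)^j).
  { apply Conv; intros i; cbn [Nat.add].
    - assert (X := str_bound _ _ _ _ _ _ _ S (Datatypes.S i)). lra.
    - assert (X := str_bound _ _ _ _ _ _ _ S (Datatypes.S i)). specialize (Bvs i). lra.
    - assert (X := straight_u S (Datatypes.S i)). specialize (Ew i). lra.
    - assert (X := str_v _ _ _ _ _ _ _ S (Datatypes.S i)). specialize (Evs (Datatypes.S (Datatypes.S i))). lra. }
  assert (Key : forall j, exists s t, edge a b M s t /\ Rabs (s - w) <= (2/3)^j /\ Rabs (t - (kap + 2*w)/b) <= (2/3)^j /\
     -1/2 <= s <= 1/2 /\ -1/2 <= t <= 1/2 /\ -1/2 <= (kap + 2*w)/b <= 1/2).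
  { intros j. destruct (Inf (1+j)%nat) as (i & Hi & Ek).
    replace i with (Datatypes.S (j + (i - 1 - j)))%nat in Ek by lia.
    set (i0 := (j + (i - 1 - j))%nat) in *.
    exists (u (Datatypes.S i0)), (v (Datatypes.S (Datatypes.S i0))).
    destruct (Cv j (i-1-j)%nat) as [X1 _]. destruct (Cv j (Datatypes.S (i-1-j))%nat) as [_ X2].
    rewrite Nat.add_succ_r in X2. fold i0 in X1, X2.
    assert (Ev : vs (Datatypes.S (Datatypes.S i0)) = (kap + 2*w)/b) by (unfold vs; rewrite Ek; reflexivity).
    rewrite Ev in X2. rewrite <- Ev at 2 3.
    split; [apply (str_vertex _ _ _ _ _ _ _ S)|].
    split; [exact X1|]. split; [exact X2|]. split; [apply (str_bound _ _ _ _ _ _ _ S)|].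
    split; [apply (str_bound _ _ _ _ _ _ _ S)|]. apply Bvs. }
  assert (Lim : forall x y, (forall j, x <= y + 2 * (a + b + a * b) * (2/3)^j) -> x <= y).
  { intros x y Hxy. apply Rnot_lt_le; intros L.
    destruct (pow_lt_1_zero (2/3)) with (y := (x-y)/(2*(a+b+a*b))) as [N HN].
    - rewrite Rabs_right; lra.
    - apply Rdiv_lt_0_compat; lra.
    - specialize (HN N (le_n N)). specialize (Hxy N).
      assert (0 <= (2/3)^N) by (apply pow_le; lra).
      rewrite Rabs_right in HN by lra.
      apply Rmult_lt_compat_l with (r := 2*(a+b+a*b)) in HN; [|lra].
      replace (2*(a+b+a*b)*((x-y)/(2*(a+b+a*b)))) with (x-y) in HN by (field; lra). lra. }
  split; apply Lim; intros j; destruct (Key j) as (s & t & E & Hs & Ht & Bs & Bt & Bk);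
  assert (He : 0 <= (2/3)^j) by (apply pow_le; lra).
  - assert (X := edge_mm _ _ _ _ _ E).
    assert (Y := qf_continuous a b (1/2 - s) (-(1/2-t)) (1/2-w) (-(1/2-(kap+2*w)/b)) ((2/3)^j)).
    assert (qf a b (1/2-w) (-(1/2-(kap+2*w)/b)) - qf a b (1/2-s) (-(1/2-t)) <= 2*(a+b+a*b)*(2/3)^j); [|lra].
    apply Y; try lra.
    + replace (1/2-s-(1/2-w)) with (-(s-w)) by ring. rewrite Rabs_Ropp; lra.
    + replace (-(1/2-t) - -(1/2-(kap+2*w)/b)) with (t-(kap+2*w)/b) by ring. lra.
  - assert (X := edge_pp _ _ _ _ _ E).
    assert (Y := qf_continuous a b (1/2 + s) (-(1/2+t)) (1/2+w) (-(1/2+(kap+2*w)/b)) ((2/3)^j)).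
    assert (qf a b (1/2+w) (-(1/2+(kap+2*w)/b)) - qf a b (1/2+s) (-(1/2+t)) <= 2*(a+b+a*b)*(2/3)^j); [|lra].
    apply Y; try lra.
    + replace (1/2+s-(1/2+w)) with (s-w) by ring. lra.
    + replace (-(1/2+t) - -(1/2+(kap+2*w)/b)) with (-(t-(kap+2*w)/b)) by ring. rewrite Rabs_Ropp; lra.
Qed.

(** * From grids to digit sequences *)

(** If f(p,-q) > M as well, averaging f(p,1-q) and f(p,-q) with weights q and 1-q cancels the mixed
    term and forces p >= 1/4; a similar average over p forces q >= 1/b. But f(p,-q) is convex in p,
    and for such q it is at most M at both ends of [1/4, 1]. *)
Lemma vertices_small (a b M p q : R) : 3 <= a -> a + 1 <= b -> b/4 + a/16 <= M ->
  0 <= p <= 1 -> 0 <= q <= 1 ->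
  M < qf a b p (1-q) -> M < qf a b (1-p) q -> qf a b p (-q) <= M.
Proof.
  intros Ha Hb HM Hp Hq F3 F4. apply Rnot_lt_le; intros F1. unfold qf in *.
  prod q (1-q). prod p (1-p).
  assert (Hp2 : 1/4 <= p).
  { assert (M < a * p^2 + b * (q*(1-q))).
    { destruct (Req_dec q 0) as [->|]; [lra|].
      assert (0 < q * (a * p ^ 2 + a * b * p * (1 - q) + b * (1 - q) ^ 2 - M)) by (apply Rmult_lt_0_compat; lra).
      assert (0 <= (1-q) * (a * p ^ 2 + a * b * p * - q + b * (- q) ^ 2 - M)) by rpos. lra. }
    assert (0 <= (q-1/2)^2) by apply pow2_ge_0.
    assert (0 <= b * (q-1/2)^2) by (apply Rmult_le_pos; lra).
    apply Rnot_lt_le; intros L.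
    assert (0 <= a * ((1/4-p)*(1/4+p))) by rpos. lra. }
  assert (Ib : 0 < / b) by (apply Rinv_0_lt_compat; lra).
  assert (bI : b * / b = 1) by (apply Rinv_r; lra).
  assert (Ib4 : / b <= 1/4) by (apply Rmult_le_reg_l with b; lra).
  assert (Hq2 : / b <= q).
  { assert (M < b * q^2 + a * (p*(1-p))).
    { destruct (Req_dec p 0) as [->|]; [lra|].
      assert (0 < p * (a * (1-p) ^ 2 + a * b * (1-p) * q + b * q ^ 2 - M)) by (apply Rmult_lt_0_compat; lra).
      assert (0 <= (1-p) * (a * p ^ 2 + a * b * p * - q + b * (- q) ^ 2 - M)) by rpos. lra. }
    assert (0 <= (p-1/2)^2) by apply pow2_ge_0.
    assert (0 <= a * (p-1/2)^2) by (apply Rmult_le_pos; lra).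
    apply Rnot_lt_le; intros L.
    assert (0 <= b * ((/b-q)*(/b+q))) by rpos.
    assert (b * (/ b * / b) = / b) by (field; lra). lra. }
  assert (Q : 0 <= (b*q-1)*(1-q)).
  { apply Rmult_le_pos; [|lra]. prod b (q - / b). lra. }
  assert (C1 : 0 <= M - (a/16 + b*q^2 - a*b*q/4)).
  { destruct (Rle_or_lt 0 (b+1-a*b/4)).
    - prod (1-q) (b+1-a*b/4). prod (a-3) b. lra.
    - prod q (-(b+1-a*b/4)). lra. }
  assert (C2 : 0 <= M - (a + b*q^2 - a*b*q)).
  { assert (0 <= (q - / b) * (a*b-b-1)).
    { apply Rmult_le_pos; [lra|]. prod (a-3) b. lra. }
    assert (a * b * / b = a) by (field; lra). lra. }
  prod (1-p) (M - (a/16 + b*q^2 - a*b*q/4)).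
  prod (p-1/4) (M - (a + b*q^2 - a*b*q)).
  assert (0 <= a * ((p-1/4)*(1-p))) by rpos.
  lra.
Qed.

Lemma vertices_edge (a b M p q : R) : 3 <= a -> a + 1 <= b -> b/4 + a/16 <= M ->
  0 <= p <= 1 -> 0 <= q <= 1 ->
  M < Rabs (qf a b p (-q)) -> M < Rabs (qf a b (p-1) (1-q)) ->
  M < Rabs (qf a b p (1-q)) -> M < Rabs (qf a b (p-1) (-q)) ->
  edge a b M (p - 1/2) (q - 1/2).
Proof.
  intros Ha Hb HM Hp Hq F1 F2 F3 F4.
  assert (G3 : M < qf a b p (1-q)).
  { rewrite Rabs_right in F3; [exact F3|]. apply Rle_ge. unfold qf.
    assert (0 <= a * p^2) by (apply Rmult_le_pos; [lra|apply pow2_ge_0]).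
    assert (0 <= b * (1-q)^2) by (apply Rmult_le_pos; [lra|apply pow2_ge_0]).
    assert (0 <= a*b*p*(1-q)) by rpos. lra. }
  assert (E4 : qf a b (p-1) (-q) = qf a b (1-p) q) by (unfold qf; ring).
  assert (G4 : M < qf a b (1-p) q).
  { rewrite E4, Rabs_right in F4; [exact F4|]. apply Rle_ge. unfold qf.
    assert (0 <= a * (1-p)^2) by (apply Rmult_le_pos; [lra|apply pow2_ge_0]).
    assert (0 <= b * q^2) by (apply Rmult_le_pos; [lra|apply pow2_ge_0]).
    assert (0 <= a*b*(1-p)*q) by rpos. lra. }
  assert (G1 := vertices_small a b M p q Ha Hb HM Hp Hq G3 G4).
  assert (G2 : qf a b (1-p) (-(1-q)) <= M).
  { apply vertices_small; try lra; [replace (1-(1-q)) with q by ring | replace (1-(1-p)) with p by ring]; lra. }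
  assert (E2 : qf a b (p-1) (1-q) = qf a b (1-p) (-(1-q))) by (unfold qf; ring).
  rewrite E2 in F2.
  split.
  - replace (1/2+(p-1/2)) with p by field. replace (1/2+(q-1/2)) with q by field.
    revert F1. unfold Rabs; destruct Rcase_abs; lra.
  - replace (1/2-(p-1/2)) with (1-p) by field. replace (1/2-(q-1/2)) with (1-q) by field.
    revert F2. unfold Rabs; destruct Rcase_abs; lra.
  - replace (1/2+(p-1/2)) with p by field. replace (1/2-(q-1/2)) with (1-q) by field. lra.
  - replace (1/2-(p-1/2)) with (1-p) by field. replace (1/2+(q-1/2)) with q by field. lra.
Qed.

(** * The coordinates x and y under the reflections *)

Lemma eta_beta (a b : Z) : (3 <= a)%Z -> (a < b)%Z ->
  IZR a * eta a b = 1 + Dc a b /\ IZR b * beta a b = 1 + Dc a b /\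
  0 < eta a b < 1 /\ 0 < beta a b < 1 /\ 0 < Dc a b < 1.
Proof.
  intros Ha Hb. apply IZR_le in Ha. assert (Hb' : IZR a + 1 <= IZR b) by (rewrite <- plus_IZR; apply IZR_le; lia).
  unfold Dc. set (A := IZR a) in *. set (B := IZR b) in *.
  set (s := sqrt (B^2 - 4*B/A)).
  assert (HBA : B / A * A = B) by (field; lra).
  assert (P : 0 <= B^2 - 4*B/A).
  { apply Rmult_le_reg_r with A; [lra|].
    replace ((B^2 - 4*B/A)*A) with (B*(A*B-4)) by (field; lra).
    rewrite Rmult_0_l. apply Rmult_le_pos; [lra|]. prod (A-3) B. lra. }
  assert (Hs : s * s = B^2 - 4*B/A) by (apply sqrt_sqrt; exact P).
  assert (s0 : 0 <= s) by apply sqrt_pos.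
  assert (Hbeta : beta a b = A / B * eta a b).
  { unfold beta, eta. fold A B s.
    replace (sqrt (A^2 - 4*A/B)) with (A / B * s).
    - field; lra.
    - symmetry. apply sqrt_lem_1.
      + replace (A^2 - 4*A/B) with ((A/B)*(A/B) * (B^2-4*B/A)) by (field; lra).
        apply Rmult_le_pos; [|exact P]. apply Rle_0_sqr.
      + apply Rmult_le_pos; [|exact s0]. apply Rlt_le, Rdiv_lt_0_compat; lra.
      + replace (A / B * s * (A/B*s)) with ((A/B)*(A/B) * (s*s)) by ring. rewrite Hs. field; lra. }
  assert (He : eta a b = (B - s)/2) by reflexivity.
  assert (Hq : A * (eta a b * eta a b) = A * B * eta a b - B).
  { rewrite He. replace ((B - s) / 2 * ((B - s) / 2)) with ((B*B - 2*B*s + s*s)/4) by field.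
    rewrite Hs. field; lra. }
  assert (AB : 0 < A * B) by (apply Rmult_lt_0_compat; lra).
  assert (BA : 4 * B / A * A = 4 * B) by (field; lra).
  assert (BAp : 0 < 4 * B / A) by (apply Rdiv_lt_0_compat; lra).
  assert (s1 : s < B).
  { apply Rnot_le_lt; intro L. assert (B * B <= s * s) by (apply Rmult_le_compat; lra). lra. }
  assert (s2 : B - 2 < s).
  { apply Rnot_le_lt; intro L. assert (s * s <= (B-2)*(B-2)) by (apply Rmult_le_compat; lra).
    assert (4 * B / A <= 4 * B / 3).
    { apply Rmult_le_compat_l; [lra|]. apply Rinv_le_contravar; lra. }
    lra. }
  assert (e0 : 0 < eta a b < 1) by (rewrite He; lra).
  assert (r0 : 0 < A / B < 1).
  { split; [apply Rdiv_lt_0_compat; lra|]. apply Rmult_lt_reg_r with B; [lra|].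
    unfold Rdiv. rewrite Rmult_assoc, Rinv_l; lra. }
  assert (D1 : eta a b * beta a b = A * eta a b - 1).
  { rewrite Hbeta. apply Rmult_eq_reg_l with B; [|lra].
    replace (B * (eta a b * (A / B * eta a b))) with (A * (eta a b * eta a b)) by (field; lra).
    rewrite Hq. ring. }
  assert (D2 : B * beta a b = A * eta a b) by (rewrite Hbeta; field; lra).
  assert (b0 : 0 < beta a b < 1).
  { rewrite Hbeta. split; [apply Rmult_lt_0_compat; lra|].
    assert (A / B * eta a b < 1 * 1) by (apply Rmult_le_0_lt_compat; lra). lra. }
  repeat split; try lra.
  - apply Rmult_lt_0_compat; lra.
  - assert (eta a b * beta a b < 1 * 1) by (apply Rmult_le_0_lt_compat; lra). lra.
Qed.

Definition ycoord (a b : Z) (s t : R) : R := s + eta a b * t.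
Definition xcoord (a b : Z) (s t : R) : R := beta a b * s + t.

Lemma xy_qf (a b : Z) (s t : R) : (3 <= a)%Z -> (a < b)%Z ->
  IZR a * IZR b * (xcoord a b s t * ycoord a b s t) = (1 + Dc a b) * qf (IZR a) (IZR b) s t.
Proof.
  intros Ha Hb. destruct (eta_beta a b Ha Hb) as (E & B & _).
  unfold xcoord, ycoord, qf.
  replace (IZR a * IZR b * ((beta a b * s + t) * (s + eta a b * t))) with
    (IZR a * (IZR b * beta a b) * s^2 + IZR a * IZR b * (1 + Dc a b) * s * t + (IZR a * eta a b) * IZR b * t^2)
    by (unfold Dc; ring).
  rewrite B, E. ring.
Qed.

Lemma qf_reflect_t (a b s t : R) : qf a b s (- t - a * s) = qf a b s t.
Proof. unfold qf. ring. Qed.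

Lemma qf_reflect_s (a b s t : R) : qf a b (- s - b * t) t = qf a b s t.
Proof. unfold qf. ring. Qed.

Lemma ycoord_reflect_t (a b : Z) (s t : R) : (3 <= a)%Z -> (a < b)%Z ->
  ycoord a b s (- t - IZR a * s) = - eta a b * xcoord a b s t.
Proof.
  intros Ha Hb. destruct (eta_beta a b Ha Hb) as (E & B & _).
  unfold xcoord, ycoord.
  replace (eta a b * (- t - IZR a * s)) with (- eta a b * t - (IZR a * eta a b) * s) by ring.
  rewrite E. unfold Dc. ring.
Qed.

Lemma xcoord_reflect_s (a b : Z) (s t : R) : (3 <= a)%Z -> (a < b)%Z ->
  xcoord a b (- s - IZR b * t) t = - beta a b * ycoord a b s t.
Proof.
  intros Ha Hb. destruct (eta_beta a b Ha Hb) as (E & B & _).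
  unfold xcoord, ycoord.
  replace (beta a b * (- s - IZR b * t)) with (- beta a b * s - (IZR b * beta a b) * t) by ring.
  rewrite B. unfold Dc. ring.
Qed.

(* The scale l decreases geometrically along the reflections while y0 stays fixed. *)
Definition large_y (a b : Z) (M y0 l s t : R) : Prop := forall i j : Z,
  l * Rabs (ycoord a b (s + IZR i) (t + IZR j)) < y0 -> M < Rabs (qf (IZR a) (IZR b) (s + IZR i) (t + IZR j)).
Definition large_x (a b : Z) (M y0 l s t : R) : Prop := forall i j : Z,
  l * Rabs (xcoord a b (s + IZR i) (t + IZR j)) < y0 -> M < Rabs (qf (IZR a) (IZR b) (s + IZR i) (t + IZR j)).

Lemma large_step_t (a b : Z) (M y0 l s t : R) (A : Z) : (3 <= a)%Z -> (a < b)%Z ->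
  large_y a b M y0 l s t -> large_x a b M y0 (l * eta a b) s (- t - IZR a * s + IZR A).
Proof.
  intros Ha Hb L i j H. destruct (eta_beta a b Ha Hb) as (_ & _ & E & _).
  assert (Eq : - (- t - IZR a * s + IZR A + IZR j) - IZR a * (s + IZR i) = t + IZR (- A - j - a * i)).
  { rewrite !minus_IZR, mult_IZR, opp_IZR. ring. }
  rewrite <- (qf_reflect_t _ _ (s + IZR i)), Eq. apply L. rewrite <- Eq, ycoord_reflect_t by auto.
  rewrite Rabs_mult, Rabs_Ropp, (Rabs_right (eta a b)) by lra. lra.
Qed.

Lemma large_step_s (a b : Z) (M y0 l s t : R) (B : Z) : (3 <= a)%Z -> (a < b)%Z ->
  large_x a b M y0 l s t -> large_y a b M y0 (l * beta a b) (- s - IZR b * t + IZR B) t.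
Proof.
  intros Ha Hb L i j H. destruct (eta_beta a b Ha Hb) as (_ & _ & _ & E & _).
  assert (Eq : - (- s - IZR b * t + IZR B + IZR i) - IZR b * (t + IZR j) = s + IZR (- B - i - b * j)).
  { rewrite !minus_IZR, mult_IZR, opp_IZR. ring. }
  rewrite <- (qf_reflect_s _ _ _ (t + IZR j)), Eq. apply L. rewrite <- Eq, xcoord_reflect_s by auto.
  rewrite Rabs_mult, Rabs_Ropp, (Rabs_right (beta a b)) by lra. lra.
Qed.

Lemma large_y_translate (a b : Z) (M y0 l s t : R) (A B : Z) :
  large_y a b M y0 l s t -> large_y a b M y0 l (s + IZR A) (t + IZR B).
Proof.
  intros L i j. replace (s + IZR A + IZR i) with (s + IZR (A + i)) by (rewrite plus_IZR; ring).
  replace (t + IZR B + IZR j) with (t + IZR (B + j)) by (rewrite plus_IZR; ring). apply L.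
Qed.

(* Any finite range would do; the covering for (3,5) needs shifts beyond 20. *)
Definition grid_avoids (a b : Z) (M s t : R) : Prop :=
  forall i j : Z, (-100 <= i <= 100)%Z -> (-100 <= j <= 100)%Z ->
    M < Rabs (qf (IZR a) (IZR b) (s + IZR i) (t + IZR j)).

Lemma large_chain (a b : Z) (M y0 s t : R) : (3 <= a)%Z -> (a < b)%Z -> 0 < y0 ->
  large_y a b M y0 1 s t ->
  exists (p q : nat -> R) (A B : nat -> Z),
    (forall i, 0 <= p i < 1 /\ 0 <= q i < 1) /\
    (forall i, IZR a * p i = q i + q (S i) + IZR (A i)) /\
    (forall i, IZR b * q (S i) = p i + p (S i) + IZR (B (S i))) /\
    (forall i, grid_avoids a b M (p i) (- q i) /\ grid_avoids a b M (p i) (- q (S i))).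
Proof.
  intros Ha Hb Hy L. destruct (eta_beta a b Ha Hb) as (_ & _ & E & E' & D).
  (* [next] performs both reflections with reduction modulo 1. The second coordinate is stored with
     the opposite sign, since the grid passes through (p, -q). *)
  set (next := fun x : R * R =>
     let q' := frac_part (IZR a * fst x - snd x) in (frac_part (IZR b * q' - fst x), q')).
  set (st := fix st (n : nat) : R * R := match n with O => (frac_part s, frac_part (- t)) | S n => next (st n) end).
  assert (fp : forall r, 0 <= frac_part r < 1) by (intros r; destruct (base_fp r); lra).
  assert (fI : forall r, frac_part r = r + IZR (- Int_part r)) by (intros r; unfold frac_part; rewrite opp_IZR; ring).
  assert (Hst : forall n, (0 <= fst (st n) < 1 /\ 0 <= snd (st n) < 1)).
  { intros [|n]; cbn; split; apply fp. }
  assert (HL : forall n, large_y a b M y0 (Dc a b ^ n) (fst (st n)) (- snd (st n)) /\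
     large_x a b M y0 (Dc a b ^ n * eta a b) (fst (st n)) (- snd (st (S n)))).
  { assert (X : forall n, large_y a b M y0 (Dc a b ^ n) (fst (st n)) (- snd (st n)) ->
      large_x a b M y0 (Dc a b ^ n * eta a b) (fst (st n)) (- snd (st (S n)))).
    { intros n Hn. cbn [st next fst snd]. unfold next. cbn [fst snd]. rewrite fI.
      replace (- (IZR a * fst (st n) - snd (st n) + IZR (- Int_part (IZR a * fst (st n) - snd (st n))))) with
        (- (- snd (st n)) - IZR a * fst (st n) + IZR (Int_part (IZR a * fst (st n) - snd (st n)))) by (rewrite opp_IZR; ring).
      apply large_step_t; auto. }
    induction n as [|n [IH1 IH2]].
    - assert (Y : large_y a b M y0 (Dc a b ^ 0) (fst (st 0%nat)) (- snd (st 0%nat))).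
      { cbn [st fst snd pow]. rewrite !fI.
        replace (- (- t + IZR (- Int_part (- t)))) with (t + IZR (Int_part (- t))) by (rewrite opp_IZR; ring).
        apply large_y_translate; auto. }
      split; [exact Y|apply X; exact Y].
    - assert (Y : large_y a b M y0 (Dc a b ^ (S n)) (fst (st (S n))) (- snd (st (S n)))).
      { apply (large_step_s a b M y0 _ _ _ (- Int_part (IZR b * snd (st (S n)) - fst (st n)))) in IH2; auto.
        replace (Dc a b ^ S n) with (Dc a b ^ n * eta a b * beta a b) by (cbn [pow]; unfold Dc; ring).
        replace (fst (st (S n))) with (- fst (st n) - IZR b * - snd (st (S n)) + IZR (- Int_part (IZR b * snd (st (S n)) - fst (st n)))); [exact IH2|].
        cbn [st]. unfold next. cbn [fst snd]. rewrite (fI (IZR b * _ - _)). ring. }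
      split; [exact Y|apply X; exact Y]. }
  (* A point of the unit cell shifted by at most 100 has |x| and |y| at most 101 + 101 = 202. Once
     the scale is below y0/210 the hypothesis of [large_y] holds on the whole range of shifts, so
     the first N states are dropped. *)
  destruct (pow_lt_1_zero (Dc a b)) with (y := y0 / 210) as [N HN]; [rewrite Rabs_right; lra|lra|].
  assert (GA : forall n, grid_avoids a b M (fst (st (N+n)%nat)) (- snd (st (N+n)%nat)) /\
      grid_avoids a b M (fst (st (N+n)%nat)) (- snd (st (S (N+n))))).
  { intros n. destruct (HL (N+n)%nat) as [L1 L2]. specialize (HN (N+n)%nat ltac:(lia)).
    assert (Dp : 0 <= Dc a b ^ (N+n)) by (apply pow_le; lra).
    rewrite Rabs_right in HN by lra.
    destruct (Hst (N+n)%nat) as [P Q]. destruct (Hst (S (N+n))) as [_ Q'].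
    assert (Bd : forall z x y i j, 0 < z < 1 -> 0 <= x < 1 -> 0 <= y < 1 -> (-100 <= i <= 100)%Z -> (-100 <= j <= 100)%Z ->
      Rabs ((x + IZR i) + z * (- y + IZR j)) <= 202 /\ Rabs (z * (x + IZR i) + (- y + IZR j)) <= 202).
    { intros z x y i j Hz Hx Hy' [Hi1 Hi2] [Hj1 Hj2]. apply IZR_le in Hi1, Hi2, Hj1, Hj2.
      assert (T : forall u, -101 <= u <= 101 -> -101 <= z * u <= 101).
      { intros u Hu. split.
        - destruct (Rle_or_lt 0 u); [prod z u; lra|]. prod (1-z) (-u). lra.
        - destruct (Rle_or_lt u 0); [prod z (-u); lra|]. prod (1-z) u. lra. }
      assert (T1 := T (- y + IZR j) ltac:(lra)). assert (T2 := T (x + IZR i) ltac:(lra)).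
      split; apply Rabs_le; lra. }
    split; intros i j Hi Hj.
    - apply L1. destruct (Bd _ _ _ i j E P Q Hi Hj) as [X _]. unfold ycoord.
      eapply Rle_lt_trans; [apply Rmult_le_compat_l; [lra|exact X]|]. lra.
    - apply L2. destruct (Bd _ _ _ i j E' P Q' Hi Hj) as [_ X]. unfold xcoord.
      eapply Rle_lt_trans; [apply Rmult_le_compat_l; [apply Rmult_le_pos; lra|exact X]|].
      assert (0 <= (Dc a b ^ (N+n)) * (1 - eta a b)) by (apply Rmult_le_pos; lra). lra. }
  exists (fun n => fst (st (N+n)%nat)), (fun n => snd (st (N+n)%nat)),
    (fun n => Int_part (IZR a * fst (st (N+n)%nat) - snd (st (N+n)%nat))),
    (fun n => Int_part (IZR b * snd (st (N+n)%nat) - fst (st (N+n-1)%nat))).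
  split; [|split; [|split]]; intros n.
  - apply Hst.
  - rewrite Nat.add_succ_r. cbn [st]. unfold next at 1. cbn [fst snd]. rewrite (fI (IZR a * _ - _)), opp_IZR. ring.
  - rewrite Nat.add_succ_r. replace (S (N+n) - 1)%nat with (N+n)%nat by lia.
    cbn [st]. unfold next at 2. cbn [fst snd]. change (frac_part (IZR a * fst (st (N + n)%nat) - snd (st (N + n)%nat))) with (snd (next (st (N+n)%nat))).
    rewrite (fI (IZR b * _ - _)), opp_IZR. ring.
  - rewrite Nat.add_succ_r. apply GA.
Qed.

(** * From the lower limit to values of the form *)

Lemma distZ_le (x : R) (i : Z) : distZ x <= Rabs (x + IZR i).
Proof.
  unfold distZ. destruct (base_Int_part x) as [H1 H2]. set (n := Int_part x) in *.
  destruct (Z_le_gt_dec (- n) i) as [L|L].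
  - apply IZR_le in L. rewrite opp_IZR in L.
    eapply Rle_trans; [apply Rmin_l|]. rewrite Rabs_right; lra.
  - assert (L' : (i <= - n - 1)%Z) by lia. apply IZR_le in L'. rewrite minus_IZR, opp_IZR in L'.
    eapply Rle_trans; [apply Rmin_r|]. rewrite Rabs_left1; lra.
Qed.

Lemma distZ_attained (x : R) : exists i : Z, distZ x = Rabs (x + IZR i).
Proof.
  unfold distZ, Rmin. destruct (base_Int_part x) as [H1 H2].
  destruct Rle_dec.
  - exists (- Int_part x)%Z. rewrite opp_IZR, Rabs_right; lra.
  - exists (- Int_part x - 1)%Z. rewrite minus_IZR, opp_IZR, Rabs_left1; lra.
Qed.

Lemma distZ_pos (x : R) : 0 <= distZ x.
Proof. destruct (distZ_attained x) as [i ->]. apply Rabs_pos. Qed.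

Lemma dist_lower (alpha gamma : R) (N : nat) : ~ in_Z_alphaZ alpha gamma ->
  exists y, 0 < y /\ forall n : Z, (Z.abs n < Z.of_nat N)%Z -> y <= distZ (IZR n * alpha - gamma).
Proof.
  intros H.
  assert (P : forall n : Z, 0 < distZ (IZR n * alpha - gamma)).
  { intros n. destruct (distZ_pos (IZR n * alpha - gamma)) as [|E]; [assumption|exfalso].
    destruct (distZ_attained (IZR n * alpha - gamma)) as [i Hi]. rewrite <- E in Hi.
    apply H. exists i, n. symmetry in Hi.
    destruct (Req_dec (IZR n * alpha - gamma + IZR i) 0) as [Z|Z]; [lra|]. apply Rabs_no_R0 in Z. contradiction. }
  induction N as [|N (y & Hy & IH)].
  - exists 1. split; [lra|]. intros n Hn. lia.
  - set (d1 := distZ (IZR (Z.of_nat N) * alpha - gamma)). set (d2 := distZ (IZR (- Z.of_nat N) * alpha - gamma)).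
    exists (Rmin y (Rmin d1 d2)). split.
    + apply Rmin_glb_lt; [exact Hy|]. apply Rmin_glb_lt; apply P.
    + intros n Hn. assert (Z.abs n < Z.of_nat N \/ n = Z.of_nat N \/ n = - Z.of_nat N)%Z as [L|[-> | ->]] by lia.
      * eapply Rle_trans; [apply Rmin_l|auto].
      * eapply Rle_trans; [apply Rmin_r|apply Rmin_l].
      * eapply Rle_trans; [apply Rmin_r|apply Rmin_r].
Qed.

Lemma xcoord_ycoord (a b : Z) (s t : R) : xcoord a b s t = t * (1 - Dc a b) + beta a b * ycoord a b s t.
Proof. unfold xcoord, ycoord, Dc. ring. Qed.

(** Near y = 0 the index |j| must be large, because finitely many distances have a positive minimum.
    There |x| is |j| (1 - D) up to |y|, so the lower limit bounds |xy| = c |f|. Of the margin d, at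
    most d/2 is spent on the lower limit and d/4 on replacing |x|. *)
Lemma is_M_large (a b : Z) (gamma l M : R) : (3 <= a)%Z -> (a < b)%Z ->
  ~ in_Z_alphaZ (eta a b) gamma -> is_M (eta a b) gamma l ->
  (1 + Dc a b) * M < IZR a * IZR b * ((1 - Dc a b) * l) ->
  exists y0, 0 < y0 /\ large_y a b M y0 1 (- gamma) 0.
Proof.
  intros Ha Hb NI [L _] HM. destruct (eta_beta a b Ha Hb) as (_ & _ & E & B & D).
  assert (Ha' := Ha). assert (Hb' : (3 <= b)%Z) by lia. apply IZR_le in Ha', Hb'.
  assert (AB : 0 < IZR a * IZR b) by (apply Rmult_lt_0_compat; lra).
  set (c := (1 + Dc a b) / (IZR a * IZR b)).
  assert (Hc : 0 < c) by (apply Rdiv_lt_0_compat; lra).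
  assert (Hc' : IZR a * IZR b * c = 1 + Dc a b) by (unfold c; field; lra).
  set (d := (1 - Dc a b) * l - c * M).
  assert (Hd : 0 < d).
  { unfold d. apply Rmult_lt_reg_l with (IZR a * IZR b); [exact AB|].
    rewrite Rmult_0_r, Rmult_minus_distr_l, <- Rmult_assoc with (r2 := c), Hc'. lra. }
  destruct (L (d/2) ltac:(lra)) as [N HN].
  destruct (dist_lower _ _ N NI) as (y1 & Hy1 & HL).
  exists (Rmin y1 (Rmin 1 (d/4))). split; [repeat apply Rmin_glb_lt; lra|].
  intros i j Hy. rewrite Rmult_1_l in Hy.
  assert (Hya := Rmin_l y1 (Rmin 1 (d/4))). assert (Hyb := Rmin_r y1 (Rmin 1 (d/4))).
  assert (Hyc := Rmin_l 1 (d/4)). assert (Hyd := Rmin_r 1 (d/4)).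
  set (y := ycoord a b (- gamma + IZR i) (0 + IZR j)) in *.
  assert (Hdist : distZ (IZR j * eta a b - gamma) <= Rabs y).
  { eapply Rle_trans; [apply (distZ_le _ i)|]. apply Req_le. f_equal. unfold y, ycoord. ring. }
  assert (Hj : (Z.of_nat N <= Z.abs j)%Z).
  { destruct (Z_lt_ge_dec (Z.abs j) (Z.of_nat N)) as [C|C]; [|lia]. specialize (HL j C). lra. }
  specialize (HN j Hj).
  set (q := qf (IZR a) (IZR b) (- gamma + IZR i) (0 + IZR j)).
  assert (Q : c * Rabs q = Rabs (xcoord a b (- gamma + IZR i) (0 + IZR j)) * Rabs y).
  { apply Rmult_eq_reg_l with (IZR a * IZR b); [|lra].
    assert (X := xy_qf a b (- gamma + IZR i) (0 + IZR j) Ha Hb). fold y q in X.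
    apply (f_equal Rabs) in X. rewrite !Rabs_mult in X.
    rewrite (Rabs_right (IZR a)), (Rabs_right (IZR b)), (Rabs_right (1 + Dc a b)) in X by lra.
    rewrite X, <- Hc'. ring. }
  rewrite xcoord_ycoord in Q. fold y in Q. rewrite Rplus_0_l in Q.
  assert (T : Rabs (IZR j) * (1 - Dc a b) - Rabs y <= Rabs (IZR j * (1 - Dc a b) + beta a b * y)).
  { assert (X := Rabs_triang (IZR j * (1 - Dc a b) + beta a b * y) (- (beta a b * y))).
    replace (IZR j * (1 - Dc a b) + beta a b * y + - (beta a b * y)) with (IZR j * (1 - Dc a b)) in X by ring.
    rewrite Rabs_Ropp, (Rabs_mult (IZR j)), (Rabs_mult (beta a b)) in X.
    rewrite (Rabs_right (1 - Dc a b)), (Rabs_right (beta a b)) in X by lra.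
    assert (0 <= (1 - beta a b) * Rabs y) by (apply Rmult_le_pos; [lra|apply Rabs_pos]). lra. }
  assert (Y0 := Rabs_pos y). rewrite abs_IZR in HN.
  assert (P1 : 0 <= (Rabs (IZR j * (1 - Dc a b) + beta a b * y) - (Rabs (IZR j) * (1 - Dc a b) - Rabs y)) * Rabs y) by (apply Rmult_le_pos; lra).
  assert (P2 : 0 <= Rabs (IZR j) * (1 - Dc a b) * (Rabs y - distZ (IZR j * eta a b - gamma))).
  { repeat apply Rmult_le_pos; try lra. apply Rabs_pos. }
  assert (P3 : 0 < (1 - Dc a b) * (Rabs (IZR j) * distZ (IZR j * eta a b - gamma) - (l - d/2))) by (apply Rmult_lt_0_compat; lra).
  assert (P4 : 0 <= Rabs y * (1 - Rabs y)) by (apply Rmult_le_pos; lra).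
  assert (P5 : 0 <= Dc a b * d) by (apply Rmult_le_pos; lra).
  apply Rmult_lt_reg_l with c; [exact Hc|]. fold q. unfold d in *. lra.
Qed.

Lemma regular_M (a b m M : R) : regular a b m M -> b/4 + a/16 <= M.
Proof.
  intros [A [z Hz] B R].
  destruct (adm_basic _ _ _ _ A) as (Ha & Hm & Hb & Hb' & b4 & HN & HB).
  assert (HM := adm_M _ _ _ _ A). assert (b6 : 6 <= b) by lra.
  destruct R as [a5|[-> R]].
  - prod (a-5) (b-6). lra.
  - destruct B as [[-> ->]|b7]; [lra|].
    destruct R as [R|[R|R]]; try lra.
    assert (IZR 1 < IZR z) by lra. apply lt_IZR in H.
    assert (2 <= z)%Z by lia. apply IZR_le in H0. lra.
Qed.

Lemma straight_of_large (a b m : Z) (M y0 s t : R) : (3 <= a)%Z -> Z.odd a = true -> (a < b)%Z ->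
  Z.even (b - m) = true -> regular (IZR a) (IZR b) (IZR m) M -> flip_gap (IZR a) (IZR b) (IZR m) M ->
  0 < y0 -> large_y a b M y0 1 s t ->
  exists u v k, straight (IZR a) (IZR b) (IZR m) M u v k.
Proof.
  intros Ha Hodd Hb Hev R G Hy L.
  destruct (large_chain a b M y0 s t Ha Hb Hy L) as (p & q & A & B & H1 & H2 & H3 & H4).
  apply Z.odd_spec in Hodd as [c Hc]. apply Z.even_spec in Hev as [d Hd].
  assert (Hc' : IZR a = 2 * IZR c + 1) by (rewrite <- mult_IZR, <- plus_IZR; f_equal; lia).
  assert (Hd' : IZR b = IZR m + 2 * IZR d) by (rewrite <- mult_IZR, <- plus_IZR; f_equal; lia).
  (* With a = 2c + 1 and b = m + 2d, centring at 1/2 turns the integers A and B into h in Z + 1/2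
     and k in Z - m/2; this is where the parities of a and b - m enter. *)
  apply (chain_straight _ _ _ _ (fun i => p i - 1/2) (fun i => q i - 1/2)
    (fun i => IZR (A i - c) + 1/2) (fun i => IZR (1 + B i - d) - IZR m / 2)); auto.
  assert (a3 := IZR_le _ _ Ha). assert (ab := adm_ab _ _ _ _ (reg_adm _ _ _ _ R)).
  assert (HM := regular_M _ _ _ _ R).
  assert (E : forall p q, 0 <= p < 1 -> 0 <= q < 1 -> grid_avoids a b M p (- q) ->
    edge (IZR a) (IZR b) M (p - 1/2) (q - 1/2)).
  { intros x y Hx Hy' GA. apply vertices_edge; try lra.
    - specialize (GA 0%Z 0%Z ltac:(lia) ltac:(lia)). rewrite !Rplus_0_r in GA. exact GA.
    - specialize (GA (-1)%Z 1%Z ltac:(lia) ltac:(lia)).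
      replace (x - 1) with (x + -1) by ring. replace (1 - y) with (- y + 1) by ring. exact GA.
    - specialize (GA 0%Z 1%Z ltac:(lia) ltac:(lia)). rewrite Rplus_0_r in GA.
      replace (1 - y) with (- y + 1) by ring. exact GA.
    - specialize (GA (-1)%Z 0%Z ltac:(lia) ltac:(lia)). rewrite Rplus_0_r in GA.
      replace (x - 1) with (x + -1) by ring. exact GA. }
  assert (V : forall i, vertex (IZR a) (IZR b) M (IZR (A i - c) + 1/2) (p i - 1/2) (q i - 1/2) (q (S i) - 1/2)).
  { intros i. destruct (H4 i). split; [|apply E; auto; apply H1|apply E; auto; apply H1].
    rewrite minus_IZR. specialize (H2 i). lra. }
  split; intros i; auto.
  - rewrite minus_IZR, plus_IZR. specialize (H3 i). lra.
  - specialize (H1 i). lra.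
  - assert (X := vertex_h _ _ _ _ _ _ _ _ (reg_adm _ _ _ _ R) (V i)). apply Rabs_def2 in X.
    destruct (IZR_between (A i - c) (-2) 1); [lra|lra|].
    assert (A i - c = 0 \/ A i - c = -1)%Z as [-> | ->] by lia; lra.
  - eexists; reflexivity.
Qed.

(** * Upper bounds in the three general families *)

(** Each family supplies a single bound on [gap], from its own periodic point. Its range of r makes
    the remaining bounds of [admissible] and [flip_gap] consequences. *)
Lemma regular_d0 (a b m M : R) : 3 <= a -> 1 <= m -> a * m + 2 <= b <= a * m + a - 1 ->
  (exists z, m = IZR z) -> (5 <= a \/ a = 3 /\ b = 3 * m + 2 /\ 2 <= m) ->
  gap a b M <= (b - a * m) * (a * b - 4) + a * m * (b - m) - b ->
  regular a b m M /\ flip_gap a b m M.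
Proof.
  intros Ha Hm Hr Hz C G.
  prod (a-3) (m-1). prod a (m-1). prod a (m*(m-1)).
  assert (HN : 0 < a*b-4) by (prod (a-3) b; lra).
  split; split; auto; try lra.
  - split; try lra.
    + apply Rmult_le_reg_l with (a*b-4); [exact HN|]. unfold gap in G.
      prod (a*m+a-1-b) (a*b-4). lra.
    + prod (a*m+a-1-b) (a*b-4).
      assert (0 <= a*(b - 2*m-2)). { prod (a-3) (m-1). rpos. } lra.
  - intros -> ->. destruct C as [C|[_ [C1 C2]]]; [lra|]. replace m with 2 in G by lra. lra.
  - intros -> ->. destruct C as [C|[_ [C1 C2]]]; [lra|]. destruct Hz as [z ->]. exfalso.
    assert (IZR 2 < IZR z) by lra. apply lt_IZR in H2. assert (3 <= z)%Z by lia. apply IZR_le in H3. lra.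
Qed.

Lemma regular_d1 (a b m M : R) : 3 <= a -> 0 <= m -> b = a * m + a + 1 ->
  (exists z, m = IZR z) -> (a = 5 \/ 7 <= a \/ a = 3 /\ 1 <= m) ->
  gap a b M <= alternating_gap a b m ->
  regular a b m M /\ flip_gap a b m M.
Proof.
  intros Ha Hm Hr Hz C G. unfold alternating_gap in G.
  prod (a-3) m. prod a m. prod a (m*m). prod m m.
  assert (HN : 0 < a*b-4) by (prod (a-3) b; lra).
  assert (Ib : 0 < / b) by (apply Rinv_0_lt_compat; lra).
  assert (W : b*(a*b) = (a*m+a+1)*(a*b)) by (rewrite Hr at 1; ring).
  assert (0 <= a*(b-m)) by (apply Rmult_le_pos; lra).
  assert (E7 : 7 <= b \/ b = 6 /\ m = 0).
  { destruct Hz as [z ->]. destruct C as [-> |[C|[-> C]]]; [|left; lra|left; lra].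
    destruct (Z_le_gt_dec z 0) as [L|L].
    - apply IZR_le in L. assert (IZR z = 0) as -> by lra. right; lra.
    - left. assert (1 <= z)%Z as L' by lia. apply IZR_le in L'. lra. }
  split; split; auto; try lra.
  - assert (B2 : (b - a*m) * (a*b-4) = (a+1) * (a*b-4)) by (rewrite Hr at 1; ring).
    assert (B3 : (a * (m+2) - b) * (a*b-4) = (a-1) * (a*b-4)) by (rewrite Hr at 1; ring).
    assert (0 <= a * (b - 2*m - 4)) by rpos.
    split; try lra.
    apply Rmult_le_reg_l with (a*b-4); [exact HN|]. unfold gap in G. lra.
  - destruct C as [C|[C|[C C']]]; [left; lra|left; lra|right]. subst a. lra.
  - intros a5 ->. left. split; [lra|]. split; lra.
  - intros -> ->. replace m with 1 in G by lra. lra.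
  - intros -> ->. destruct Hz as [z ->]. exfalso.
    assert (Z1 : IZR 1 < IZR z) by lra. apply lt_IZR in Z1. assert (Z2 : (2 <= z)%Z) by lia. apply IZR_le in Z2. lra.
  - intros -> ->. replace m with 2 in G by lra. lra.
Qed.

Lemma regular_d2 (a b m M : R) : 3 <= a -> 0 <= m -> a * m + a + 3 <= b <= a * m + 2 * a ->
  (exists z, m = IZR z) -> (5 <= a \/ a = 3) ->
  gap a b M <= (a * (m + 2) - b) * (a * b - 4) + a * (m + 2) * (b - (m + 2)) - b ->
  regular a b m M /\ flip_gap a b m M.
Proof.
  intros Ha Hm Hr Hz C G.
  prod (a-3) m. prod a m. prod a (m*m). prod m m.
  assert (HN : 0 < a*b-4) by (prod (a-3) b; lra).
  assert (P : 0 <= (b-(a*m+a+3))*(a*b-4)) by rpos.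
  assert (Hz' : a = 3 -> m = 0 \/ 1 <= m).
  { intros _. destruct Hz as [z ->]. destruct (Z_le_gt_dec z 0) as [L|L].
    - apply IZR_le in L. left. lra.
    - right. apply IZR_le. lia. }
  split; split; auto; try lra.
  - split; try lra.
    apply Rmult_le_reg_l with (a*b-4); [exact HN|]. unfold gap in G. lra.
  - destruct C as [C| ->]; [right; lra|]. destruct (Hz' eq_refl) as [-> | ?]; lra.
  - destruct C as [C| ->]; [left; lra|right; lra].
  - intros -> ->. destruct (Hz' eq_refl); lra.
  - intros -> ->. destruct (Hz' eq_refl); lra.
  - intros -> ->. destruct Hz as [z ->]. exfalso.
    assert (Z1 : IZR 1 < IZR z) by lra. assert (Z2 : IZR z < IZR 2) by lra. apply lt_IZR in Z1, Z2. lia.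
Qed.

Lemma Mstar_upper (a b : Z) (mu : R) : (3 <= a)%Z -> (a < b)%Z ->
  (forall M y0 s t, mu < M -> 0 < y0 -> ~ large_y a b M y0 1 s t) ->
  forall gamma w, ~ in_Z_alphaZ (eta a b) gamma -> is_Mstar a b gamma w ->
  w <= 4 * (1 + Dc a b) * mu / (IZR a * IZR b).
Proof.
  intros Ha Hb U gamma w NI (l & HM & ->).
  destruct (eta_beta a b Ha Hb) as (_ & _ & E & B & D).
  assert (Ha' := Ha). assert (Hb' : (3 <= b)%Z) by lia. apply IZR_le in Ha', Hb'.
  assert (AB : 0 < IZR a * IZR b) by (apply Rmult_lt_0_compat; lra).
  apply Rnot_lt_le. intros L.
  assert (L' : (1 + Dc a b) * mu < IZR a * IZR b * ((1 - Dc a b) * l)).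
  { apply Rmult_lt_compat_r with (r := IZR a * IZR b / 4) in L; [|lra].
    replace (4 * (1 + Dc a b) * mu / (IZR a * IZR b) * (IZR a * IZR b / 4)) with ((1 + Dc a b) * mu) in L by (field; lra).
    lra. }
  set (d := IZR a * IZR b * ((1 - Dc a b) * l) - (1 + Dc a b) * mu) in *.
  assert (d0 : 0 < d) by (unfold d; lra).
  (* An increment of d/4 is admissible because (1 + D)/4 < 1. *)
  destruct (is_M_large a b gamma l (mu + d / 4) Ha Hb NI HM) as (y0 & Hy & HL).
  - assert (0 < (1 - Dc a b) * d) by (apply Rmult_lt_0_compat; lra). unfold d in *. lra.
  - apply (U (mu + d/4) y0 (- gamma) 0); auto. lra.
Qed.

Section Upper.

Context {a b m : Z} (Ha : (3 <= a)%Z) (Hodd : Z.odd a = true) (Hab : (a < b)%Z)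
  (Hm : (0 <= m)%Z) (Hev : Z.even (b - m) = true).

Local Notation N := (IZR a * IZR b - 4).

Lemma parameter_bounds : 3 <= IZR a /\ 0 <= IZR m /\ IZR a + 1 <= IZR b /\ 8 <= N /\ (IZR a = 3 \/ IZR a = 5 \/ 7 <= IZR a).
Proof.
  assert (A := IZR_le _ _ Ha). assert (B := IZR_le _ _ Hm).
  assert (C : IZR a + 1 <= IZR b) by (rewrite <- plus_IZR; apply IZR_le; lia).
  repeat split; try lra.
  - prod (IZR a - 3) (IZR b - 4). lra.
  - apply Z.odd_spec in Hodd as [c Hc].
    assert (a = 3 \/ a = 5 \/ 7 <= a)%Z as [-> | [-> | L]] by lia; auto.
    apply IZR_le in L. auto.
Qed.

Lemma gap_eq_mm (M w v h k : R) : IZR a * w - 2 * v = h -> IZR b * v - 2 * w = k ->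
  gap (IZR a) (IZR b) M = lin (IZR a) (IZR b) h k - quad (IZR a) (IZR b) h k
     + 4 * N * (- qf (IZR a) (IZR b) (1/2 - w) (- (1/2 - v)) - M).
Proof. intros <- <-. unfold gap, lin, quad, qf. field. Qed.

Lemma gap_eq_pp (M w v h k : R) : IZR a * w - 2 * v = h -> IZR b * v - 2 * w = k ->
  gap (IZR a) (IZR b) M = - lin (IZR a) (IZR b) h k - quad (IZR a) (IZR b) h k
     + 4 * N * (- qf (IZR a) (IZR b) (1/2 + w) (- (1/2 + v)) - M).
Proof. intros <- <-. unfold gap, lin, quad, qf. field. Qed.

Lemma upper_d0 (w v M y0 s t : R) :
  (1 <= m)%Z -> (a * m + 2 <= b <= a * m + a - 1)%Z -> (5 <= a \/ b = 3 * m + 2 /\ 2 <= m)%Z ->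
  IZR a * w - 2 * v = 1/2 -> IZR b * v - 2 * w = - (IZR m / 2) ->
  - qf (IZR a) (IZR b) (1/2 - w) (- (1/2 - v)) < M -> 0 < y0 -> ~ large_y a b M y0 1 s t.
Proof.
  intros H1 H2 H3 Hw Hv HM Hy L.
  destruct parameter_bounds as (A & B & C & D & E).
  destruct (regular_d0 (IZR a) (IZR b) (IZR m) M) as [R G].
  - lra.
  - apply (IZR_le 1); auto.
  - split; [rewrite <- mult_IZR, <- plus_IZR | rewrite <- mult_IZR, <- plus_IZR, <- minus_IZR]; apply IZR_le; lia.
  - eexists; eauto.
  - destruct (Z_le_gt_dec 5 a) as [a5|a5]; [left; apply (IZR_le 5); auto|].
    right. destruct E as [E|[E|E]]; [|apply eq_IZR in E; lia|apply (le_IZR 7) in E; lia].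
    split; [exact E|]. destruct H3 as [H3|[H3 H4]]; [lia|].
    split; [rewrite H3, plus_IZR, mult_IZR; reflexivity|apply (IZR_le 2); auto].
  - rewrite (gap_eq_mm M w v _ _ Hw Hv).
    assert (0 <= N * (M - - qf (IZR a) (IZR b) (1/2 - w) (- (1/2 - v)))) by (apply Rmult_le_pos; lra).
    unfold lin, quad. lra.
  - destruct (straight_of_large a b m M y0 s t Ha Hodd Hab Hev R G Hy L) as (u & vv & k & S).
    (* The digits are determined from index 4 on, while [straight_limit] reads k from index 1; three
       terms are dropped. *)
    assert (S' : straight (IZR a) (IZR b) (IZR m) M (fun i => u (3+i)%nat) (fun i => vv (3+i)%nat) (fun i => k (3+i)%nat)).
    { destruct S as [S1 S2 S3 S4]. split; intros i; rewrite ?Nat.add_succ_r; auto. }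
    assert (K : forall i, k (4+i)%nat = - (IZR m/2)).
    { intros i. apply (all_upper R S). rewrite <- mult_IZR, <- plus_IZR, <- minus_IZR; apply IZR_le; lia. }
    destruct (straight_limit (IZR a) (IZR b) (IZR m) M (- IZR m) (- (IZR m / 2)) w _ _ _ R S') as [X _].
    + lra.
    + intros i. assert (X := K i). assert (Y := K (Datatypes.S i)). cbn [Nat.add] in *. lra.
    + intros n. exists n. split; [lia|]. apply K.
    + replace v with ((- (IZR m/2) + 2 * w) / IZR b) in Hw by (rewrite <- Hv; field; lra).
      apply Rmult_eq_reg_l with (/ IZR b); [|apply Rinv_neq_0_compat; lra].
      apply Rminus_diag_uniq. rewrite <- (Rminus_diag_eq _ _ Hw). field. lra.
    + replace ((- (IZR m / 2) + 2 * w) / IZR b) with v in X by (rewrite <- Hv; field; lra). lra.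
Qed.

Lemma upper_d2 (w v M y0 s t : R) :
  (a * m + a + 3 <= b <= a * m + 2 * a)%Z ->
  IZR a * w - 2 * v = 1/2 -> IZR b * v - 2 * w = - (IZR m / 2) - 1 ->
  - qf (IZR a) (IZR b) (1/2 + w) (- (1/2 + v)) < M -> 0 < y0 -> ~ large_y a b M y0 1 s t.
Proof.
  intros H2 Hw Hv HM Hy L.
  destruct parameter_bounds as (A & B & C & D & E).
  assert (H2' : IZR a * IZR m + IZR a + 3 <= IZR b <= IZR a * IZR m + 2 * IZR a).
  { rewrite <- !mult_IZR, <- !plus_IZR; split; apply IZR_le; lia. }
  destruct (regular_d2 (IZR a) (IZR b) (IZR m) M) as [R G]; auto.
  - eexists; eauto.
  - lra.
  - rewrite (gap_eq_pp M w v _ _ Hw Hv).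
    assert (0 <= N * (M - - qf (IZR a) (IZR b) (1/2 + w) (- (1/2 + v)))) by (apply Rmult_le_pos; lra).
    unfold lin, quad. lra.
  - destruct (straight_of_large a b m M y0 s t Ha Hodd Hab Hev R G Hy L) as (u & vv & k & S).
    assert (S' : straight (IZR a) (IZR b) (IZR m) M (fun i => u (3+i)%nat) (fun i => vv (3+i)%nat) (fun i => k (3+i)%nat)).
    { destruct S as [S1 S2 S3 S4]. split; intros i; rewrite ?Nat.add_succ_r; auto. }
    assert (K : forall i, k (4+i)%nat = - (IZR m/2) - 1).
    { intros i. apply (all_lower R S). lra. }
    destruct (straight_limit (IZR a) (IZR b) (IZR m) M (- IZR m - 2) (- (IZR m / 2) - 1) w _ _ _ R S') as [_ X].
    + lra.
    + intros i. assert (X := K i). assert (Y := K (Datatypes.S i)). cbn [Nat.add] in *. lra.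
    + intros n. exists n. split; [lia|]. apply K.
    + replace v with ((- (IZR m/2) - 1 + 2 * w) / IZR b) in Hw by (rewrite <- Hv; field; lra).
      apply Rmult_eq_reg_l with (/ IZR b); [|apply Rinv_neq_0_compat; lra].
      apply Rminus_diag_uniq. rewrite <- (Rminus_diag_eq _ _ Hw). field. lra.
    + replace ((- (IZR m / 2) - 1 + 2 * w) / IZR b) with v in X by (rewrite <- Hv; field; lra). lra.
Qed.

(** The limit has two alternating values v and v' = v - 1/b over one w. The edge (w, v) has H = 1/2
    - 1/b and K = -m/2, and [lin] - [quad] there is [alternating_gap]. *)
Lemma upper_d1 (w v v' M y0 s t : R) :
  (b = a * m + a + 1)%Z -> (5 <= a \/ 1 <= m)%Z ->
  IZR a * w - v - v' = 1/2 -> IZR b * v - 2 * w = - (IZR m / 2) -> IZR b * v' - 2 * w = - (IZR m / 2) - 1 ->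
  - qf (IZR a) (IZR b) (1/2 - w) (- (1/2 - v)) < M -> 0 < y0 -> ~ large_y a b M y0 1 s t.
Proof.
  intros H2 H3 Hw Hv Hv' HM Hy L.
  destruct parameter_bounds as (A & B & C & D & E).
  assert (H2' : IZR b = IZR a * IZR m + IZR a + 1) by (rewrite <- !mult_IZR, <- !plus_IZR; f_equal; lia).
  assert (Ev : v' = v - / IZR b).
  { apply Rmult_eq_reg_l with (IZR b); [|lra]. rewrite Rmult_minus_distr_l, Rinv_r; lra. }
  assert (G0 : gap (IZR a) (IZR b) M <= alternating_gap (IZR a) (IZR b) (IZR m)).
  { assert (Hw' : IZR a * w - 2 * v = 1/2 - / IZR b) by lra.
    rewrite (gap_eq_mm M w v _ _ Hw' Hv).
    assert (0 <= N * (M - - qf (IZR a) (IZR b) (1/2 - w) (- (1/2 - v)))) by (apply Rmult_le_pos; lra).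
    assert (X : lin (IZR a) (IZR b) (1/2 - / IZR b) (- (IZR m/2)) - quad (IZR a) (IZR b) (1/2 - / IZR b) (- (IZR m/2))
       = alternating_gap (IZR a) (IZR b) (IZR m)); [|lra].
    unfold lin, quad, alternating_gap.
    replace (IZR a - 1) with (IZR b - IZR a * IZR m - 2) by lra. field. lra. }
  destruct (regular_d1 (IZR a) (IZR b) (IZR m) M) as [R G]; auto.
  - eexists; eauto.
  - destruct E as [E|[E|E]]; auto. right; right; split; [exact E|].
    apply eq_IZR in E. apply (IZR_le 1). lia.
  - destruct (straight_of_large a b m M y0 s t Ha Hodd Hab Hev R G Hy L) as (u & vv & k & S).
    assert (S' : straight (IZR a) (IZR b) (IZR m) M (fun i => u (3+i)%nat) (fun i => vv (3+i)%nat) (fun i => k (3+i)%nat)).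
    { destruct S as [S1 S2 S3 S4]. split; intros i; rewrite ?Nat.add_succ_r; auto. }
    assert (K : forall i, k (3+i)%nat + k (4+i)%nat = - IZR m - 1).
    { intros i. apply (alternate R S); auto. }
    destruct (straight_limit (IZR a) (IZR b) (IZR m) M (- IZR m - 1) (- (IZR m / 2)) w _ _ _ R S') as [X _].
    + lra.
    + intros i. apply (K (Datatypes.S i)).
    + intros n. destruct (str_k _ _ _ _ _ _ _ S' n) as [X|X].
      * exists n. split; [lia|exact X].
      * exists (Datatypes.S n). split; [lia|]. assert (Y := K (Datatypes.S n)). cbn [Nat.add] in *. lra.
    + rewrite Ev in Hw. replace v with ((- (IZR m/2) + 2 * w) / IZR b) in Hw by (rewrite <- Hv; field; lra).
      apply Rmult_eq_reg_l with (/ IZR b); [|apply Rinv_neq_0_compat; lra].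
      apply Rminus_diag_uniq. rewrite <- (Rminus_diag_eq _ _ Hw). field. lra.
    + replace ((- (IZR m / 2) + 2 * w) / IZR b) with v in X by (rewrite <- Hv; field; lra). lra.
Qed.

End Upper.

(** * Minima over periodic grids *)

(** A reflection that shortens |s| or |t| decreases the natural number Q (|s| + |t|), so repeated
    reflection reaches a point that neither reflection shortens. *)
Lemma qf_descent (a b mu : R) (Q : R) (G : R -> R -> Prop) : 0 < Q ->
  (forall s t, G s t -> G (- s - b * t) t) -> (forall s t, G s t -> G s (- t - a * s)) ->
  (forall s t, G s t -> exists i j, Q * s = IZR i /\ Q * t = IZR j) ->
  (forall s t, G s t -> Rabs s <= Rabs (s + b * t) -> Rabs t <= Rabs (t + a * s) -> mu <= Rabs (qf a b s t)) ->
  forall s t, G s t -> mu <= Rabs (qf a b s t).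
Proof.
  intros HQ G1 G2 GZ Red.
  assert (P : forall n s t i j, G s t -> Q * s = IZR i -> Q * t = IZR j -> (Z.abs i + Z.abs j < Z.of_nat n)%Z ->
    mu <= Rabs (qf a b s t)).
  { induction n as [|n IH]; intros s t i j H Hi Hj Hn; [lia|].
    assert (Dec : forall x y i j, Q * x = IZR i -> Q * y = IZR j -> Rabs x < Rabs y -> (Z.abs i < Z.abs j)%Z).
    { intros x y i' j' Hx Hy L. apply lt_IZR. rewrite !abs_IZR, <- Hx, <- Hy, !Rabs_mult.
      apply Rmult_lt_compat_l; [rewrite Rabs_right; lra|exact L]. }
    destruct (Rle_or_lt (Rabs s) (Rabs (s + b * t))) as [L1|L1].
    - destruct (Rle_or_lt (Rabs t) (Rabs (t + a * s))) as [L2|L2]; [auto|].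
      rewrite <- qf_reflect_t. assert (H' := G2 _ _ H). destruct (GZ _ _ H') as (i' & j' & Hi' & Hj').
      apply (IH _ _ i' j'); auto.
      assert (Z.abs j' < Z.abs j)%Z.
      { apply (Dec (- t - a * s) t); auto. replace (- t - a * s) with (- (t + a * s)) by ring. rewrite Rabs_Ropp; auto. }
      assert (i' = i) by (apply eq_IZR; lra). lia.
    - rewrite <- qf_reflect_s. assert (H' := G1 _ _ H). destruct (GZ _ _ H') as (i' & j' & Hi' & Hj').
      apply (IH _ _ i' j'); auto.
      assert (Z.abs i' < Z.abs i)%Z.
      { apply (Dec (- s - b * t) s); auto. replace (- s - b * t) with (- (s + b * t)) by ring. rewrite Rabs_Ropp; auto. }
      assert (j' = j) by (apply eq_IZR; lra). lia. }
  intros s t H. destruct (GZ _ _ H) as (i & j & Hi & Hj).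
  apply (P (Z.to_nat (Z.abs i + Z.abs j + 1)) s t i j); auto. lia.
Qed.

(* Reduced points lie in the cone 2 s <= b t, 2 t <= a s, where -f(s,-t) increases in both
   variables; if (s0, t0) is outside it, concavity in t allows to lower t0 to a s0 / 2. *)
Lemma qf_cone_mono (a b s t s0 t0 : R) : 0 <= a -> 0 <= b -> s0 <= s -> t0 <= t ->
  4 <= a * b -> 0 <= s0 -> 2 * s <= b * t -> 2 * t <= a * s -> 2 * s0 <= b * t0 ->
  - qf a b s0 (- t0) <= - qf a b s (- t).
Proof.
  intros Ha Hb Hs Ht Hab Hs0 C1 C2 C3.
  assert (Cone : forall t1, t1 <= t -> 2 * s0 <= b * t1 -> 2 * t1 <= a * s0 -> - qf a b s0 (- t1) <= - qf a b s (- t)).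
  { clear t0 Ht C3. intros t0 Ht C3 C4. unfold qf.
  assert (0 <= a * ((b*t-2*s) + (b*t0-2*s0)) * (s-s0)).
  { apply Rmult_le_pos; [apply Rmult_le_pos|]; lra. }
  assert (0 <= b * ((a*s-2*t) + (a*s0-2*t0)) * (t-t0)).
  { apply Rmult_le_pos; [apply Rmult_le_pos|]; lra. }
  lra. }
  destruct (Rle_or_lt (2 * t0) (a * s0)) as [C4|C4]; [auto|].
  apply Rle_trans with (- qf a b s0 (- (a * s0 / 2))).
  - assert (0 <= b * ((t0 - a * s0 / 2) * (t0 - a * s0 / 2))).
    { apply Rmult_le_pos; [lra|apply Rle_0_sqr]. }
    unfold qf. lra.
  - assert (0 <= (a * b - 4) * s0) by (apply Rmult_le_pos; lra). apply Cone; lra.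
Qed.

Lemma qf_mono (a b s t s0 t0 : R) : 0 <= a -> 0 <= b -> 0 <= s0 <= s -> 0 <= t0 <= t ->
  qf a b s0 t0 <= qf a b s t.
Proof.
  intros Ha Hb Hs Ht. unfold qf.
  assert (0 <= a * ((s-s0)*(s+s0))) by (apply Rmult_le_pos; [lra|apply Rmult_le_pos; lra]).
  assert (0 <= b * ((t-t0)*(t+t0))) by (apply Rmult_le_pos; [lra|apply Rmult_le_pos; lra]).
  assert (0 <= a * b * ((s-s0)*t + s0*(t-t0))).
  { apply Rmult_le_pos; [apply Rmult_le_pos; lra|]. apply Rplus_le_le_0_compat; apply Rmult_le_pos; lra. }
  lra.
Qed.

(** [cor_s1] combines the cone conditions 2s <= bt and 2(1-s) <= b(1-t), which [qf_cone_mono] asks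
    of the two corners where f is negative. *)
Record corners (a b mu s t : R) : Prop := {
  cor_s : 0 < s < 1;
  cor_t : 0 < t < 1;
  cor_s1 : 2 * s <= b * t <= b - 2 * (1 - s);
  cor_pp : mu <= - qf a b s (- t);
  cor_mm : mu <= - qf a b (1 - s) (- (1 - t));
  cor_pm : mu <= qf a b s (1 - t);
  cor_mp : mu <= qf a b (1 - s) t }.

(** Every grid point lies beyond one of the four corners of the central cell. Where s and t have
    equal signs f grows outwards; where they differ, being reduced means lying in the cone in which
    -f grows outwards. *)
Lemma corners_reduced (a b mu s0 t0 : R) (i j : Z) : 0 <= a -> 0 <= b -> 4 <= a * b -> corners a b mu s0 t0 ->
  let s := s0 + IZR i in let t := - t0 + IZR j in
  Rabs s <= Rabs (s + b * t) -> Rabs t <= Rabs (t + a * s) -> mu <= Rabs (qf a b s t).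
Proof.
  intros Ha Hb Hab [S T S1 PP MM PM MP] s t Rs Rt.
  assert (Hi : s0 <= s \/ 1 - s0 <= - s).
  { unfold s. destruct (Z_le_gt_dec 0 i) as [L|L].
    - apply IZR_le in L. left; lra.
    - assert (L' : (i <= -1)%Z) by lia. apply IZR_le in L'. right; lra. }
  assert (Hj : t0 <= - t \/ 1 - t0 <= t).
  { unfold t. destruct (Z_le_gt_dec j 0) as [L|L].
    - apply IZR_le in L. left; lra.
    - assert (L' : (1 <= j)%Z) by lia. apply IZR_le in L'. right; lra. }
  clearbody s t.
  assert (bt : forall x, 0 <= x -> 0 <= b * x) by (intros; apply Rmult_le_pos; lra).
  assert (at' : forall x, 0 <= x -> 0 <= a * x) by (intros; apply Rmult_le_pos; lra).
  destruct Hi as [Hi|Hi]; destruct Hj as [Hj|Hj].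
  - assert (B1 := bt (-t-t0) ltac:(lra)). assert (A1 := at' (s-s0) ltac:(lra)).
    rewrite (Rabs_right s) in Rs by lra. rewrite (Rabs_left t) in Rt by lra.
    assert (C1 : 2 * s <= b * - t) by (revert Rs; unfold Rabs; destruct Rcase_abs; lra).
    assert (C2 : 2 * - t <= a * s) by (destruct (Req_dec a 0) as [->|]; [lra|]; assert (0 < a * s) by (apply Rmult_lt_0_compat; lra); revert Rt; unfold Rabs; destruct Rcase_abs; lra).
    assert (X := qf_cone_mono a b s (-t) s0 t0 Ha Hb Hi Hj Hab ltac:(lra) C1 C2 ltac:(lra)).
    rewrite Ropp_involutive in X. rewrite <- Rabs_Ropp. eapply Rle_trans; [|apply Rle_abs]. lra.
  - assert (X := qf_mono a b s t s0 (1-t0) Ha Hb ltac:(lra) ltac:(lra)).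
    eapply Rle_trans; [|apply Rle_abs]. lra.
  - assert (X := qf_mono a b (-s) (-t) (1-s0) t0 Ha Hb ltac:(lra) ltac:(lra)).
    replace (qf a b s t) with (qf a b (-s) (-t)) by (unfold qf; ring).
    eapply Rle_trans; [|apply Rle_abs]. lra.
  - assert (B1 := bt (t-(1-t0)) ltac:(lra)). assert (A1 := at' (-s-(1-s0)) ltac:(lra)).
    rewrite (Rabs_left s) in Rs by lra. rewrite (Rabs_right t) in Rt by lra.
    assert (C1 : 2 * - s <= b * t) by (revert Rs; unfold Rabs; destruct Rcase_abs; lra).
    assert (C2 : 2 * t <= a * - s) by (destruct (Req_dec a 0) as [->|]; [lra|]; assert (0 < a * - s) by (apply Rmult_lt_0_compat; lra); revert Rt; unfold Rabs; destruct Rcase_abs; lra).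
    assert (X := qf_cone_mono a b (-s) t (1-s0) (1-t0) Ha Hb Hi Hj Hab ltac:(lra) C1 C2 ltac:(lra)).
    replace (qf a b s t) with (qf a b (-s) (-t)) by (unfold qf; ring).
    rewrite <- Rabs_Ropp. eapply Rle_trans; [|apply Rle_abs]. lra.
Qed.

Definition in_grid (s0 t0 s t : R) : Prop := exists i j : Z, s = s0 + IZR i /\ t = - t0 + IZR j.

Lemma in_grid_refl (s0 t0 : R) (i j : Z) : in_grid s0 t0 (s0 + IZR i) (- t0 + IZR j).
Proof. exists i, j; auto. Qed.

Lemma grid_reflect_s (b : Z) (s0 t0 s t : R) : (exists z, 2 * s0 - IZR b * t0 = IZR z) ->
  in_grid s0 t0 s t -> in_grid s0 t0 (- s - IZR b * t) t.
Proof.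
  intros [z Hz] (i & j & -> & ->). exists (- z - i - b * j)%Z, j. split; [|reflexivity].
  rewrite !minus_IZR, opp_IZR, mult_IZR. lra.
Qed.

Lemma grid_reflect_t (a : Z) (s0 t0 t1 s t : R) : (exists z, t0 + t1 - IZR a * s0 = IZR z) ->
  in_grid s0 t0 s t -> in_grid s0 t1 s (- t - IZR a * s).
Proof.
  intros [z Hz] (i & j & -> & ->). exists i, (z - j - a * i)%Z. split; [reflexivity|].
  rewrite !minus_IZR, mult_IZR. lra.
Qed.

Lemma grid_lower_bound (a b : Z) (mu Q s0 t0 t1 : R) : (0 <= a)%Z -> (0 <= b)%Z -> 4 <= IZR a * IZR b ->
  corners (IZR a) (IZR b) mu s0 t0 -> corners (IZR a) (IZR b) mu s0 t1 ->
  (exists z, 2 * s0 - IZR b * t0 = IZR z) -> (exists z, 2 * s0 - IZR b * t1 = IZR z) ->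
  (exists z, t0 + t1 - IZR a * s0 = IZR z) ->
  0 < Q -> (exists z, Q = IZR z) -> (exists z, Q * s0 = IZR z) -> (exists z, Q * t0 = IZR z) -> (exists z, Q * t1 = IZR z) ->
  forall s t, in_grid s0 t0 s t -> mu <= Rabs (qf (IZR a) (IZR b) s t).
Proof.
  intros Ha Hb Hab C0 C1 Z0 Z1 Z2 HQ [zq Eq] [zs Es] [z0 E0] [z1 E1] s t H.
  apply IZR_le in Ha, Hb.
  apply (qf_descent _ _ mu Q (fun s t => in_grid s0 t0 s t \/ in_grid s0 t1 s t)); auto.
  - intros x y [X|X]; [left|right]; apply grid_reflect_s; auto.
  - intros x y [X|X]; [right; apply (grid_reflect_t a s0 t0)|left; apply (grid_reflect_t a s0 t1)]; auto.
    destruct Z2 as [z Hz]. exists z. lra.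
  - intros x y [(i & j & -> & ->)|(i & j & -> & ->)].
    + exists (zs + zq * i)%Z, (- z0 + zq * j)%Z. rewrite !plus_IZR, opp_IZR, !mult_IZR, <- Eq, <- Es, <- E0. split; ring.
    + exists (zs + zq * i)%Z, (- z1 + zq * j)%Z. rewrite !plus_IZR, opp_IZR, !mult_IZR, <- Eq, <- Es, <- E1. split; ring.
  - intros x y [(i & j & -> & ->)|(i & j & -> & ->)] R1 R2; apply corners_reduced; auto.
Qed.

Lemma distZ_lt_1 (x : R) : distZ x < 1.
Proof.
  unfold distZ. destruct (base_Int_part x) as [H1 H2].
  eapply Rle_lt_trans; [apply Rmin_l|]. lra.
Qed.

(** * The lower limit for a grid with attained minimum *)

Section GridMinimum.

Context {a b : Z} (Ha : (3 <= a)%Z) (Hb : (a < b)%Z) (mu s0 t0 : R) (mu0 : 0 < mu)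
  (Low : forall s t, in_grid s0 t0 s t -> mu <= Rabs (qf (IZR a) (IZR b) s t))
  (Att : exists s t, in_grid s0 t0 s t /\ Rabs (qf (IZR a) (IZR b) s t) = mu)
  (Step : forall s t, in_grid s0 t0 s t -> exists s' t', in_grid s0 t0 s' t' /\
     qf (IZR a) (IZR b) s' t' = qf (IZR a) (IZR b) s t /\
     Rabs (ycoord a b s' t') <= Dc a b * Rabs (ycoord a b s t)).

Let gamma := ycoord a b s0 (- t0).
(** On grid points with |f| = mu and y tending to 0, |n| |y| approaches |xy|/(1 - D), which is l.
    The error from replacing |x| by |n| (1 - D) is at most C |y|. *)
Let l := (1 + Dc a b) * mu / (IZR a * IZR b * (1 - Dc a b)).
Let C := Rabs t0 + 1 / (1 - Dc a b).

Lemma grid_consts : 0 < eta a b < 1 /\ 0 < beta a b < 1 /\ 0 < Dc a b < 1 /\ 0 < IZR a * IZR b /\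
  0 < l /\ 0 < C /\ (1 - Dc a b) * C = Rabs t0 * (1 - Dc a b) + 1.
Proof.
  destruct (eta_beta a b Ha Hb) as (_ & _ & E & B & D).
  assert (Ha' := Ha). assert (Hb' : (3 <= b)%Z) by lia. apply IZR_le in Ha', Hb'.
  assert (AB : 0 < IZR a * IZR b) by (apply Rmult_lt_0_compat; lra).
  repeat split; try lra.
  - unfold l. apply Rdiv_lt_0_compat; apply Rmult_lt_0_compat; lra.
  - unfold C. assert (0 < 1 / (1 - Dc a b)) by (apply Rdiv_lt_0_compat; lra).
    assert (X := Rabs_pos t0). lra.
  - unfold C. field. lra.
Qed.

Lemma grid_xy (s t : R) :
  Rabs (xcoord a b s t) * Rabs (ycoord a b s t) = (1 - Dc a b) * l * (Rabs (qf (IZR a) (IZR b) s t) / mu).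
Proof.
  destruct grid_consts as (E & B & D & AB & _).
  assert (X := xy_qf a b s t Ha Hb). apply (f_equal Rabs) in X. rewrite Rabs_mult, !(Rabs_mult (_ + _)) in X.
  rewrite (Rabs_right (IZR a * IZR b)), (Rabs_right (1 + Dc a b)), Rabs_mult in X by lra.
  apply Rmult_eq_reg_l with (IZR a * IZR b); [|lra]. rewrite X. unfold l. field. repeat split; try lra; intros H; rewrite H in AB; lra.
Qed.

Lemma grid_x_bound (s t : R) (j : Z) : t = - t0 + IZR j -> Rabs (ycoord a b s t) <= 1 ->
  Rabs (xcoord a b s t) <= (IZR (Z.abs j) + Rabs t0) * (1 - Dc a b) + Rabs (ycoord a b s t) /\
  IZR (Z.abs j) * (1 - Dc a b) <= Rabs (xcoord a b s t) + Rabs t0 * (1 - Dc a b) + Rabs (ycoord a b s t).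
Proof.
  intros -> Hy. destruct grid_consts as (E & B & D & _). rewrite abs_IZR.
  set (y := ycoord a b s (- t0 + IZR j)) in *.
  assert (X : xcoord a b s (- t0 + IZR j) = IZR j * (1 - Dc a b) + (- t0 * (1 - Dc a b) + beta a b * y)).
  { rewrite xcoord_ycoord. fold y. ring. }
  assert (Y : Rabs (- t0 * (1 - Dc a b) + beta a b * y) <= Rabs t0 * (1 - Dc a b) + Rabs y).
  { eapply Rle_trans; [apply Rabs_triang|]. rewrite !Rabs_mult, Rabs_Ropp.
    rewrite (Rabs_right (1 - Dc a b)), (Rabs_right (beta a b)) by lra.
    assert (0 <= (1 - beta a b) * Rabs y) by (apply Rmult_le_pos; [lra|apply Rabs_pos]). lra. }
  assert (Z : Rabs (IZR j * (1 - Dc a b)) = Rabs (IZR j) * (1 - Dc a b)).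
  { rewrite Rabs_mult, (Rabs_right (1 - Dc a b)); lra. }
  rewrite X. split.
  - eapply Rle_trans; [apply Rabs_triang|]. lra.
  - rewrite <- Z.
    replace (IZR j * (1 - Dc a b)) with ((IZR j * (1 - Dc a b) + (- t0 * (1 - Dc a b) + beta a b * y)) + - (- t0 * (1 - Dc a b) + beta a b * y)) at 1 by ring.
    eapply Rle_trans; [apply Rabs_triang|]. rewrite Rabs_Ropp. lra.
Qed.

Lemma grid_not_in : ~ in_Z_alphaZ (eta a b) gamma.
Proof.
  intros (p & q & H).
  assert (X := Low _ _ (in_grid_refl s0 t0 (- p) (- q))).
  assert (Y := xy_qf a b (s0 + IZR (- p)) (- t0 + IZR (- q)) Ha Hb).
  destruct grid_consts as (E & B & D & _).
  replace (ycoord a b (s0 + IZR (- p)) (- t0 + IZR (- q))) with 0 in Y.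
  - assert (Z : qf (IZR a) (IZR b) (s0 + IZR (- p)) (- t0 + IZR (- q)) = 0).
    { apply Rmult_eq_reg_l with (1 + Dc a b); lra. }
    rewrite Z, Rabs_R0 in X. lra.
  - unfold gamma, ycoord in *. rewrite !opp_IZR. lra.
Qed.

Lemma grid_small (e : R) : 0 < e -> exists s t, in_grid s0 t0 s t /\
  Rabs (qf (IZR a) (IZR b) s t) = mu /\ Rabs (ycoord a b s t) < e.
Proof.
  intros He. destruct grid_consts as (E & B & D & _).
  destruct Att as (s & t & G & Q).
  assert (P : forall k, exists s' t', in_grid s0 t0 s' t' /\ Rabs (qf (IZR a) (IZR b) s' t') = mu /\
     Rabs (ycoord a b s' t') <= Dc a b ^ k * Rabs (ycoord a b s t)).
  { induction k as [|k (s' & t' & G' & Q' & Y')].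
    - exists s, t. cbn [pow]. repeat split; auto. lra.
    - destruct (Step _ _ G') as (s'' & t'' & G'' & Q'' & Y'').
      exists s'', t''. split; [exact G''|]. split; [rewrite Q''; exact Q'|].
      cbn [pow]. eapply Rle_trans; [exact Y''|]. rewrite Rmult_assoc. apply Rmult_le_compat_l; lra. }
  assert (Y0 := Rabs_pos (ycoord a b s t)).
  destruct (pow_lt_1_zero (Dc a b)) with (y := e / (Rabs (ycoord a b s t) + 1)) as [N HN].
  - rewrite Rabs_right; lra.
  - apply Rdiv_lt_0_compat; lra.
  - specialize (HN N (le_n N)). destruct (P N) as (s' & t' & G' & Q' & Y').
    exists s', t'. repeat split; auto.
    assert (Dp : 0 <= Dc a b ^ N) by (apply pow_le; lra).
    rewrite Rabs_right in HN by lra.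
    apply Rmult_lt_compat_r with (r := Rabs (ycoord a b s t) + 1) in HN; [|lra].
    replace (e / (Rabs (ycoord a b s t) + 1) * (Rabs (ycoord a b s t) + 1)) with e in HN by (field; lra). lra.
Qed.

Lemma grid_is_M : is_M (eta a b) gamma l.
Proof.
  destruct grid_consts as (E & B & D & AB & L & C0 & HC).
  assert (Nat : forall x, exists N : nat, x <= IZR (Z.of_nat N)).
  { intros x. exists (Z.to_nat (up x)). destruct (archimed x) as [A _].
    destruct (Z_le_gt_dec 0 (up x)) as [U|U].
    - rewrite Z2Nat.id; lra || lia.
    - assert (up x <= 0)%Z as U' by lia. apply IZR_le in U'.
      apply Rle_trans with 0; [lra|]. apply IZR_le. lia. }
  split.
  - intros eps He. destruct (Nat (l * C / eps)) as [N HN].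
    exists N. intros n Hn. apply IZR_le in Hn.
    destruct (distZ_attained (IZR n * eta a b - gamma)) as [i Hi].
    assert (Hd := distZ_lt_1 (IZR n * eta a b - gamma)).
    set (s := s0 + IZR (- i)). set (t := - t0 + IZR (- n)).
    assert (Hy : Rabs (ycoord a b s t) = distZ (IZR n * eta a b - gamma)).
    { rewrite Hi, <- Rabs_Ropp. f_equal. unfold s, t, gamma, ycoord. rewrite !opp_IZR. ring. }
    destruct (grid_x_bound s t (- n) eq_refl) as [X _]; [lra|].
    assert (Q := Low s t (in_grid_refl _ _ _ _)).
    assert (XY := grid_xy s t).
    assert (Q' : 1 <= Rabs (qf (IZR a) (IZR b) s t) / mu).
    { apply Rmult_le_reg_r with mu; [exact mu0|]. unfold Rdiv. rewrite Rmult_assoc, Rinv_l; lra. }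
    rewrite Z.abs_opp in X. rewrite <- Hy in *. set (y := Rabs (ycoord a b s t)) in *.
    assert (y0 : 0 <= y) by apply Rabs_pos.
    assert (P1 : 0 <= (1 - Dc a b) * l * (Rabs (qf (IZR a) (IZR b) s t) / mu - 1)).
    { apply Rmult_le_pos; [apply Rmult_le_pos; lra|lra]. }
    assert (P2 : 0 <= ((IZR (Z.abs n) + Rabs t0) * (1 - Dc a b) + y - Rabs (xcoord a b s t)) * y) by (apply Rmult_le_pos; lra).
    assert (P3 : 0 <= y * (1 - y)) by (apply Rmult_le_pos; lra).
    assert (K : l <= IZR (Z.abs n) * y + C * y).
    { apply Rmult_le_reg_l with (1 - Dc a b); [lra|].
      replace ((1 - Dc a b) * (IZR (Z.abs n) * y + C * y)) with ((1 - Dc a b) * IZR (Z.abs n) * y + ((1 - Dc a b) * C) * y) by ring.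
      rewrite HC. lra. }
    (* Either the error C y is below eps, or y >= eps/C and then |n| y >= l already by the choice of
       N. *)
    destruct (Rlt_or_le (C * y) eps) as [S|S]; [lra|].
    assert (IZR (Z.abs n) * y >= l); [|lra].
    apply Rle_ge, Rmult_le_reg_l with C; [exact C0|].
    apply Rle_trans with (IZR (Z.abs n) * eps).
    + apply Rle_trans with ((l * C / eps) * eps); [right; field; lra|]. apply Rmult_le_compat_r; lra.
    + assert (0 <= IZR (Z.abs n)) by (apply IZR_le; lia).
      assert (0 <= IZR (Z.abs n) * (C * y - eps)) by (apply Rmult_le_pos; lra). lra.
  - intros eps He N.
    (* K bounds |x| as long as |j| <= N; then |x| |y| = (1 - D) l is impossible for |y| below (1 -
       D) l / K. *)
    set (K := IZR (Z.of_nat N) + Rabs t0 + 1).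
    assert (T0 := Rabs_pos t0). assert (N0 : 0 <= IZR (Z.of_nat N)) by (apply IZR_le; lia).
    assert (K0 : 1 <= K) by (unfold K; lra).
    destruct (grid_small (Rmin 1 (Rmin (eps / C) ((1 - Dc a b) * l / K)))) as (s & t & G & Q & Y).
    { repeat apply Rmin_glb_lt; try lra; apply Rdiv_lt_0_compat; try lra. apply Rmult_lt_0_compat; lra. }
    assert (Y1 := Rmin_l 1 (Rmin (eps / C) ((1 - Dc a b) * l / K))).
    assert (Y2 := Rmin_r 1 (Rmin (eps / C) ((1 - Dc a b) * l / K))).
    assert (Y3 := Rmin_l (eps / C) ((1 - Dc a b) * l / K)).
    assert (Y4 := Rmin_r (eps / C) ((1 - Dc a b) * l / K)).
    destruct G as (i & j & Es & Et).
    destruct (grid_x_bound s t j Et) as [X1 X2]; [lra|].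
    assert (XY := grid_xy s t). rewrite Q in XY.
    replace (mu / mu) with 1 in XY by (field; lra).
    set (y := Rabs (ycoord a b s t)) in *. set (x := Rabs (xcoord a b s t)) in *.
    assert (y0 : 0 <= y) by apply Rabs_pos.
    exists (- j)%Z. rewrite Z.abs_opp. split.
    + destruct (Z_le_gt_dec (Z.of_nat N) (Z.abs j)) as [|W]; [assumption|exfalso].
      assert (W' : (Z.abs j <= Z.of_nat N)%Z) by lia. apply IZR_le in W'.
      assert (W0 : 0 <= IZR (Z.abs j)) by (apply IZR_le; lia).
      assert (x <= K).
      { assert (0 <= (IZR (Z.abs j) + Rabs t0) * Dc a b) by (apply Rmult_le_pos; lra). unfold K. lra. }
      assert (KY : K * y < (1 - Dc a b) * l).
      { apply Rlt_le_trans with (K * ((1 - Dc a b) * l / K)); [apply Rmult_lt_compat_l; lra|right; field; lra]. }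
      assert (0 <= (K - x) * y) by (apply Rmult_le_pos; lra). lra.
    + assert (Hd : distZ (IZR (- j) * eta a b - gamma) <= y).
      { eapply Rle_trans; [apply (distZ_le _ (- i))|]. right. unfold y. rewrite <- Rabs_Ropp. f_equal.
        rewrite Es, Et. unfold gamma, ycoord. rewrite !opp_IZR. ring. }
      assert (CY : C * y < eps).
      { apply Rlt_le_trans with (C * (eps / C)); [apply Rmult_lt_compat_l; lra|right; field; lra]. }
      assert (W0 : 0 <= IZR (Z.abs j)) by (apply IZR_le; lia).
      assert (P0 : 0 <= IZR (Z.abs j) * (y - distZ (IZR (- j) * eta a b - gamma))) by (apply Rmult_le_pos; lra).
      assert (P2 : 0 <= (x + Rabs t0 * (1 - Dc a b) + y - IZR (Z.abs j) * (1 - Dc a b)) * y) by (apply Rmult_le_pos; lra).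
      assert (P3 : 0 <= y * (1 - y)) by (apply Rmult_le_pos; lra).
      assert (IZR (Z.abs j) * y <= l + C * y); [|lra].
      apply Rmult_le_reg_l with (1 - Dc a b); [lra|].
      replace ((1 - Dc a b) * (l + C * y)) with ((1 - Dc a b) * l + ((1 - Dc a b) * C) * y) by ring.
      rewrite HC. lra.
Qed.

Lemma grid_rho
  (upper : forall gamma w, ~ in_Z_alphaZ (eta a b) gamma -> is_Mstar a b gamma w ->
    w <= 4 * (1 + Dc a b) * mu / (IZR a * IZR b)) :
  exists v, is_Mstar a b gamma v /\ is_rho_star a b v.
Proof.
  destruct grid_consts as (E & B & D & AB & _).
  assert (S : is_Mstar a b gamma (4 * (1 + Dc a b) * mu / (IZR a * IZR b))).
  { exists l. split; [exact grid_is_M|]. unfold l. field.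
    repeat split; try lra; intros H; rewrite H in AB; lra. }
  eexists. split; [exact S|]. split; [|exact upper].
  exists gamma. split; [exact grid_not_in|exact S].
Qed.

End GridMinimum.

(** * Expansions of periodic words and their grids *)

Lemma series_sum_eq (s : nat -> R) (l : R) : infinite_sum s l -> series_sum s = l.
Proof.
  intros H. apply (uniqueness_sum s); [|exact H].
  unfold series_sum. apply epsilon_spec. exists l; exact H.
Qed.

Lemma telescoping_sum (D B : R) (s T : nat -> R) : 0 < D < 1 -> (forall n, Rabs (T n) <= B) ->
  (forall n, s n = (T n - D * T (S n)) * D ^ n) -> infinite_sum s (T 0%nat).
Proof.
  intros HD HB Hs.
  assert (P : forall n, sum_f_R0 s n = T 0%nat - D ^ (S n) * T (S n)).
  { induction n as [|n IH]; cbn [sum_f_R0].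
    - rewrite Hs. cbn [pow]. ring.
    - rewrite IH, Hs. cbn [pow]. ring. }
  assert (B0 : 0 <= B) by (eapply Rle_trans; [apply Rabs_pos|apply (HB 0%nat)]).
  intros eps He.
  destruct (pow_lt_1_zero D) with (y := eps / (B + 1)) as [N HN]; [rewrite Rabs_right; lra|apply Rdiv_lt_0_compat; lra|].
  exists N. intros n Hn. unfold Rdist. rewrite P.
  replace (T 0%nat - D ^ S n * T (S n) - T 0%nat) with (- (D ^ S n * T (S n))) by ring.
  rewrite Rabs_Ropp, Rabs_mult.
  specialize (HN (S n) ltac:(lia)).
  apply Rle_lt_trans with (Rabs (D ^ S n) * B).
  - apply Rmult_le_compat_l; [apply Rabs_pos|apply HB].
  - apply Rmult_lt_compat_r with (r := B + 1) in HN; [|lra].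
    replace (eps / (B + 1) * (B + 1)) with eps in HN by (field; lra).
    assert (X := Rabs_pos (D ^ S n)). lra.
Qed.

(* Each block of an expansion is one double reflection: it maps the coordinate y of
   (s0, -t) to D times that of (s0, -t'), which makes the series telescope. *)
Lemma block_step (a b : Z) (s0 t t' : R) : (3 <= a)%Z -> (a < b)%Z ->
  (IZR a * s0 - t - t') * eta a b + (IZR b * t' - 2 * s0) * Dc a b =
  ycoord a b s0 (- t) - Dc a b * ycoord a b s0 (- t').
Proof.
  intros Ha Hb. destruct (eta_beta a b Ha Hb) as (E & B & _).
  assert (X : eta a b * Dc a b = IZR b * Dc a b - eta a b).
  { replace (IZR b * Dc a b) with (eta a b * (IZR b * beta a b)) by (unfold Dc; ring). rewrite B. ring. }
  unfold ycoord.
  replace ((IZR a * s0 - t - t') * eta a b) with (s0 * (IZR a * eta a b) - (t + t') * eta a b) by ring.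
  rewrite E.
  replace (Dc a b * (s0 + eta a b * - t')) with (Dc a b * s0 - t' * (eta a b * Dc a b)) by ring.
  rewrite X. ring.
Qed.

Lemma gamma_word_1 (a b : Z) (B : Z * Z) (s0 t0 : R) : (3 <= a)%Z -> (a < b)%Z ->
  IZR (fst B) = IZR a * s0 - 2 * t0 -> IZR (snd B) = IZR b * t0 - 2 * s0 ->
  gamma_word a b (B :: nil) = ycoord a b s0 (- t0).
Proof.
  intros Ha Hb H1 H2. unfold gamma_word, gamma_blocks. apply series_sum_eq.
  destruct (eta_beta a b Ha Hb) as (_ & _ & _ & _ & D).
  apply (telescoping_sum (Dc a b) (Rabs (ycoord a b s0 (- t0))) _ (fun _ => ycoord a b s0 (- t0))); auto.
  - intros; lra.
  - intros n. rewrite <- block_step by auto.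
    replace (n mod length (B :: nil))%nat with 0%nat by (cbn [length]; rewrite Nat.mod_1_r; reflexivity).
    cbn [nth]. rewrite H1, H2. ring.
Qed.

Lemma gamma_word_2 (a b : Z) (B B' : Z * Z) (s0 t0 t1 : R) : (3 <= a)%Z -> (a < b)%Z ->
  IZR (fst B) = IZR a * s0 - t0 - t1 -> IZR (snd B) = IZR b * t1 - 2 * s0 ->
  IZR (fst B') = IZR a * s0 - t0 - t1 -> IZR (snd B') = IZR b * t0 - 2 * s0 ->
  gamma_word a b (B :: B' :: nil) = ycoord a b s0 (- t0).
Proof.
  intros Ha Hb H1 H2 H3 H4. unfold gamma_word, gamma_blocks. apply series_sum_eq.
  destruct (eta_beta a b Ha Hb) as (_ & _ & _ & _ & D).
  set (T := fun n => if Nat.even n then ycoord a b s0 (- t0) else ycoord a b s0 (- t1)).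
  change (ycoord a b s0 (- t0)) with (T 0%nat).
  apply (telescoping_sum (Dc a b) (Rmax (Rabs (ycoord a b s0 (- t0))) (Rabs (ycoord a b s0 (- t1))))); auto.
  - intros n. unfold T. destruct (Nat.even n); [apply Rmax_l|apply Rmax_r].
  - intros n. unfold T. rewrite Nat.even_succ, <- Nat.negb_even. cbn [length].
    destruct (Nat.even n) eqn:En; cbn [negb]; rewrite <- block_step by auto.
    + apply Nat.even_spec in En as [c ->].
      replace ((2 * c) mod 2)%nat with 0%nat by (rewrite Nat.mul_comm, Nat.Div0.mod_mul; reflexivity).
      cbn [nth]. rewrite H1, H2. ring.
    + assert (Ho : Nat.odd n = true) by (rewrite <- Nat.negb_even, En; reflexivity).
      apply Nat.odd_spec in Ho as [c ->].
      replace ((2 * c + 1) mod 2)%nat with 1%nat by (rewrite Nat.add_comm, Nat.mul_comm, Nat.Div0.mod_add; reflexivity).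
      cbn [nth]. rewrite H3, H4. ring.
Qed.

(** A double reflection may lead from the grid of t0 to that of t1, so it is applied twice; y is
    then multiplied by D^2 <= D. *)
Lemma grid_step (a b : Z) (s0 t0 t1 s t : R) : (3 <= a)%Z -> (a < b)%Z ->
  (exists z, 2 * s0 - IZR b * t0 = IZR z) -> (exists z, 2 * s0 - IZR b * t1 = IZR z) ->
  (exists z, t0 + t1 - IZR a * s0 = IZR z) -> in_grid s0 t0 s t ->
  exists s' t', in_grid s0 t0 s' t' /\ qf (IZR a) (IZR b) s' t' = qf (IZR a) (IZR b) s t /\
     Rabs (ycoord a b s' t') <= Dc a b * Rabs (ycoord a b s t).
Proof.
  intros Ha Hb Z0 Z1 Z2 G. destruct (eta_beta a b Ha Hb) as (_ & _ & _ & _ & D).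
  set (A := IZR a). set (B := IZR b).
  set (f := fun x : R * R => (- fst x - B * snd x, - snd x - A * (- fst x - B * snd x))).
  assert (Hq : forall x, qf A B (fst (f x)) (snd (f x)) = qf A B (fst x) (snd x)).
  { intros x. cbn [f fst snd]. rewrite qf_reflect_t, qf_reflect_s. reflexivity. }
  assert (Hy : forall x, ycoord a b (fst (f x)) (snd (f x)) = Dc a b * ycoord a b (fst x) (snd x)).
  { intros x. cbn [f fst snd]. unfold A, B. rewrite ycoord_reflect_t, xcoord_reflect_s by auto. unfold Dc. ring. }
  set (z := f (f (s, t))). exists (fst z), (snd z). unfold z. split; [|split].
  - apply (grid_reflect_t a s0 t1 t0); [destruct Z2 as [y Hz]; exists y; lra|].
    apply grid_reflect_s; [exact Z1|]. apply (grid_reflect_t a s0 t0 t1); [exact Z2|].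
    apply grid_reflect_s; auto.
  - rewrite !Hq. reflexivity.
  - rewrite !Hy. cbn [fst snd]. rewrite !Rabs_mult, (Rabs_right (Dc a b)) by lra.
    apply Rmult_le_compat_l; [lra|]. assert (X := Rabs_pos (ycoord a b s t)).
    assert (0 <= (1 - Dc a b) * Rabs (ycoord a b s t)) by (apply Rmult_le_pos; lra). lra.
Qed.

(** The two positive corners are rewritten through the negative ones: f(s, 1-t) = f(s, -t) + ab/2 -
    bH for s = 1/2 - w, t = 1/2 - v, and the same with +bH at the opposite corner. *)
Lemma corners_of_digits (a b mu w v H K : R) : 3 <= a -> 0 < b -> -1/2 < w < 1/2 -> -1/2 < v < 1/2 ->
  a * w - 2 * v = H -> b * v - 2 * w = K -> - (b - 2) <= 2 * K <= b - 2 ->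
  mu <= - qf a b (1/2 - w) (- (1/2 - v)) -> mu <= - qf a b (1/2 + w) (- (1/2 + v)) ->
  mu <= a * b / 2 - b * H + qf a b (1/2 - w) (- (1/2 - v)) ->
  mu <= a * b / 2 + b * H + qf a b (1/2 + w) (- (1/2 + v)) ->
  corners a b mu (1/2 - w) (1/2 - v).
Proof.
  intros Ha Hb Hw Hv <- <- HK F2 F1 F3 F4. unfold qf in *.
  split; unfold qf; lra.
Qed.

Lemma grid_rho_star (a b : Z) (mu Q s0 t0 t1 : R) : (3 <= a)%Z -> (a < b)%Z -> 0 < mu ->
  corners (IZR a) (IZR b) mu s0 t0 -> corners (IZR a) (IZR b) mu s0 t1 ->
  (exists z, 2 * s0 - IZR b * t0 = IZR z) -> (exists z, 2 * s0 - IZR b * t1 = IZR z) ->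
  (exists z, t0 + t1 - IZR a * s0 = IZR z) ->
  0 < Q -> (exists z, Q = IZR z) -> (exists z, Q * s0 = IZR z) -> (exists z, Q * t0 = IZR z) -> (exists z, Q * t1 = IZR z) ->
  (exists s t, in_grid s0 t0 s t /\ Rabs (qf (IZR a) (IZR b) s t) = mu) ->
  (forall M y0 s t, mu < M -> 0 < y0 -> ~ large_y a b M y0 1 s t) ->
  exists v, is_Mstar a b (ycoord a b s0 (- t0)) v /\ is_rho_star a b v.
Proof.
  intros Ha Hb M0 C0 C1 Z0 Z1 Z2 Q0 ZQ Qs Qt0 Qt1 At U.
  apply (grid_rho Ha Hb mu s0 t0 M0); [|exact At| |exact (Mstar_upper a b mu Ha Hb U)].
  - apply (grid_lower_bound a b mu Q s0 t0 t1); auto; try lia.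
    assert (3 <= IZR a) by (apply (IZR_le 3); lia). assert (3 <= IZR b) by (apply (IZR_le 3); lia).
    prod (IZR a - 3) (IZR b - 3). lra.
  - intros s t G. apply (grid_step a b s0 t0 t1); auto.
Qed.

Lemma qf_opposite (a b w v : R) : - qf a b (1/2 + w) (- (1/2 + v)) =
  - qf a b (1/2 - w) (- (1/2 - v)) + b * (a * w - 2 * v) + a * (b * v - 2 * w).
Proof. unfold qf. field. Qed.

Section PeriodicWords.

Context {a b m : Z} (Ha : (3 <= a)%Z) (Hodd : Z.odd a = true) (Hab : (a < b)%Z)
  (Hm : (0 <= m)%Z) (Hev : Z.even (b - m) = true).

Local Notation N := (IZR a * IZR b - 4).

Lemma half_b : exists z, IZR b = IZR m + 2 * IZR z.
Proof.
  apply Z.even_spec in Hev as [z Hz]. exists z. rewrite <- mult_IZR, <- plus_IZR. f_equal. lia.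
Qed.

Lemma half_a : exists z, IZR a = 3 + 2 * IZR z.
Proof.
  apply Z.odd_spec in Hodd as [z Hz]. exists (z - 1)%Z. rewrite <- mult_IZR, <- plus_IZR. f_equal. lia.
Qed.

Lemma Bblk_value (t : Z) : Z.even (t - m) = true ->
  IZR (fst (Bblk a b t)) = (IZR a - 3) / 2 /\ IZR (snd (Bblk a b t)) = (IZR b - 2 + IZR t) / 2.
Proof.
  intros Ht. cbn [Bblk fst snd].
  apply Z.odd_spec in Hodd as [z Hz]. apply Z.even_spec in Ht as [y Hy]. apply Z.even_spec in Hev as [x Hx].
  assert (E1 : (a - 3 = (z - 1) * 2)%Z) by lia. assert (E2 : (b - 2 + t = (x + m + y - 1) * 2)%Z) by lia.
  rewrite E1, E2, !Z.div_mul by lia. split.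
  - assert (X : IZR a = 3 + IZR (z - 1) * 2); [|lra]. rewrite <- mult_IZR, <- plus_IZR. f_equal. lia.
  - assert (X : IZR b = 2 - IZR t + IZR (x + m + y - 1) * 2); [|lra].
    rewrite <- mult_IZR, <- minus_IZR, <- plus_IZR. f_equal. lia.
Qed.

Lemma gamma_Bblk (t : Z) (w v : R) : Z.even (t - m) = true ->
  IZR a * w - 2 * v = 1/2 -> IZR b * v - 2 * w = - (IZR t / 2) ->
  gamma_word a b (Bblk a b t :: nil) = ycoord a b (1/2 - w) (- (1/2 - v)).
Proof.
  intros Ht H K. destruct (Bblk_value t Ht) as [B1 B2].
  apply gamma_word_1; auto; [rewrite B1|rewrite B2]; lra.
Qed.

Lemma digit_denominator (c : Z) (kk w v : R) : IZR b * v - 2 * w = kk / 2 -> (exists z, kk = IZR z) ->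
  w = (IZR b / 2 + IZR c) / N ->
  let Q := 2 * IZR b * N in
  0 < Q /\ (exists z, Q = IZR z) /\ (exists z, Q * (1/2 - w) = IZR z) /\ (exists z, Q * (1/2 - v) = IZR z).
Proof.
  intros K [z ->] W Q. destruct (@parameter_bounds a b m Ha Hodd Hab Hm) as (A & B & C & D & E).
  assert (W' : N * w = IZR b / 2 + IZR c) by (rewrite W; field; lra).
  split; [|split; [|split]].
  - apply Rmult_lt_0_compat; lra.
  - exists (2 * b * (a * b - 4))%Z. rewrite !mult_IZR, minus_IZR, mult_IZR. reflexivity.
  - exists (b * (a * b - 4) - b * (b + 2 * c))%Z.
    replace (Q * (1/2 - w)) with (IZR b * N - 2 * IZR b * (N * w)) by (unfold Q; field).
    rewrite W', minus_IZR, !mult_IZR, minus_IZR, plus_IZR, !mult_IZR. field.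
  - exists (b * (a * b - 4) - (a * b - 4) * z - 2 * (b + 2 * c))%Z.
    replace (Q * (1/2 - v)) with (IZR b * N - 2 * N * (IZR b * v)) by (unfold Q; field).
    replace (IZR b * v) with (IZR z / 2 + 2 * w) by lra.
    replace (IZR b * N - 2 * N * (IZR z / 2 + 2 * w)) with (IZR b * N - N * IZR z - 4 * (N * w)) by field.
    rewrite W', !minus_IZR, !mult_IZR, !minus_IZR, plus_IZR, !mult_IZR. field.
Qed.

Lemma digit_integrality (t : Z) (w v v' : R) : Z.even (t - m) = true ->
  IZR b * v - 2 * w = - (IZR t / 2) -> IZR a * w - v - v' = 1/2 ->
  (exists z, 2 * (1/2 - w) - IZR b * (1/2 - v) = IZR z) /\
  (exists z, (1/2 - v') + (1/2 - v) - IZR a * (1/2 - w) = IZR z).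
Proof.
  intros Ht K H. destruct half_b as [z Hz], half_a as [y Hy].
  apply Z.even_spec in Ht as [x Hx]. assert (T : IZR t = IZR m + 2 * IZR x).
  { rewrite <- mult_IZR, <- plus_IZR. f_equal. lia. }
  split.
  - exists (1 - m - x - z)%Z. rewrite !minus_IZR. lra.
  - exists (- y)%Z. rewrite opp_IZR. lra.
Qed.

Lemma digit_w_bound (c : Z) (w : R) : 0 <= IZR b / 2 + IZR c -> (c <= 0)%Z -> w = (IZR b / 2 + IZR c) / N -> 0 <= w < 1/2.
Proof.
  intros C0 C1 W. destruct (@parameter_bounds a b m Ha Hodd Hab Hm) as (A & B & C & D & E).
  apply IZR_le in C1. assert (W' : N * w = IZR b / 2 + IZR c) by (rewrite W; field; lra).
  prod (IZR a - 3) (IZR b - 4).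
  split; apply Rmult_le_reg_l with N || apply Rmult_lt_reg_l with N; lra.
Qed.

Lemma digit_v_bound (k w v : R) : 0 <= w < 1/2 -> - (IZR b / 2) < k <= 0 -> IZR b * v - 2 * w = k -> -1/2 < v < 1/2.
Proof.
  intros W K V. destruct (@parameter_bounds a b m Ha Hodd Hab Hm) as (A & B & C & D & E).
  split; apply Rmult_lt_reg_l with (IZR b); lra.
Qed.

Lemma rho_d0 : (1 <= m)%Z -> (a * m + 2 <= b <= a * m + a - 1)%Z -> (5 <= a \/ b = 3 * m + 2 /\ 2 <= m)%Z ->
  exists v, is_Mstar a b (gamma_word a b (Bblk a b m :: nil)) v /\ is_rho_star a b v.
Proof.
  intros H1 H2 H3. destruct (@parameter_bounds a b m Ha Hodd Hab Hm) as (A & B & C & D & E).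
  assert (M1 : 1 <= IZR m) by (apply (IZR_le 1); auto).
  assert (H2' : IZR a * IZR m + 2 <= IZR b <= IZR a * IZR m + IZR a - 1).
  { rewrite <- mult_IZR, <- !plus_IZR, <- minus_IZR; split; apply IZR_le; lia. }
  set (w := (IZR b / 2 + IZR (- m)) / N). set (v := (- (IZR m / 2) + 2 * w) / IZR b).
  assert (Kv : IZR b * v - 2 * w = - (IZR m / 2)) by (unfold v; field; lra).
  assert (Hw : IZR a * w - 2 * v = 1/2).
  { unfold v, w. rewrite opp_IZR. field. lra. }
  prod (IZR a - 3) (IZR m).
  assert (W : 0 <= w < 1/2) by (apply (digit_w_bound (- m)); [rewrite opp_IZR; lra|lia|reflexivity]).
  assert (V : -1/2 < v < 1/2) by (apply (digit_v_bound (- (IZR m / 2)) w); lra).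
  set (mu := - qf (IZR a) (IZR b) (1/2 - w) (- (1/2 - v))).
  assert (G := gap_eq_mm (a:=a) (b:=b) mu w v _ _ Hw Kv). fold mu in G.
  destruct (regular_d0 (IZR a) (IZR b) (IZR m) mu) as [R _]; auto; try lra.
  { eexists; eauto. }
  { destruct H3 as [H3|[H3 H4]]; [left; apply (IZR_le 5); auto|].
    destruct (Z_le_gt_dec 5 a) as [a5|a5]; [left; apply (IZR_le 5); auto|right].
    destruct E as [E|[E|E]]; [|apply eq_IZR in E; lia|apply (le_IZR 7) in E; lia].
    split; [exact E|]. split; [rewrite H3, plus_IZR, mult_IZR; reflexivity|apply (IZR_le 2); auto]. }
  { rewrite G. unfold lin, quad. lra. }
  apply regular_M in R.
  assert (F1 : - qf (IZR a) (IZR b) (1/2 + w) (- (1/2 + v)) = mu + (IZR b - IZR a * IZR m) / 2).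
  { rewrite qf_opposite, Hw, Kv. unfold mu. field. }
  (* This is the positive corner with H = 1/2: mu <= ab/2 - b/2 - mu. *)
  assert (G' : 4 * mu <= IZR a * IZR b - IZR b).
  { apply Rmult_le_reg_l with N; [lra|]. unfold gap, lin, quad in G.
    prod (IZR a * IZR m) (IZR b - IZR m). prod N (IZR b - IZR a * IZR m). prod (IZR a - 3) N.
    prod (IZR a - 3) (IZR b - 4). lra. }
  assert (Hmm : Z.even (m - m) = true) by (rewrite Z.sub_diag; reflexivity).
  destruct (digit_integrality m w v v Hmm Kv ltac:(lra)) as [I1 I2].
  destruct (digit_denominator (- m) (IZR (- m)) w v ltac:(rewrite opp_IZR; lra) ltac:(eexists; reflexivity) eq_refl) as (Q0 & Q1 & Q2 & Q3).
  assert (Cor : corners (IZR a) (IZR b) mu (1/2 - w) (1/2 - v)).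
  { apply (corners_of_digits _ _ _ _ _ (1/2) (- (IZR m / 2))); try lra; fold mu.
    - right; reflexivity.
    - replace (qf (IZR a) (IZR b) (1/2 - w) (- (1/2 - v))) with (- mu) by (unfold mu; ring). lra. }
  rewrite (gamma_Bblk m w v Hmm Hw Kv).
  apply (grid_rho_star a b mu (2 * IZR b * N) (1/2 - w) (1/2 - v) (1/2 - v)); auto; try lra.
  - exists (1/2 - w), (- (1/2 - v)). split.
    + exists 0%Z, 0%Z. split; ring.
    + rewrite <- Rabs_Ropp. fold mu. apply Rabs_right. lra.
  - intros M y0 s t HM Hy. apply (upper_d0 (m:=m) Ha Hodd Hab Hm Hev w v); auto.
Qed.

Lemma rho_d2 : (a * m + a + 3 <= b <= a * m + 2 * a)%Z ->
  exists v, is_Mstar a b (gamma_word a b (Bblk a b (m + 2) :: nil)) v /\ is_rho_star a b v.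
Proof.
  intros H2. destruct (@parameter_bounds a b m Ha Hodd Hab Hm) as (A & B & C & D & E).
  assert (H2' : IZR a * IZR m + IZR a + 3 <= IZR b <= IZR a * IZR m + 2 * IZR a).
  { rewrite <- !mult_IZR, <- !plus_IZR; split; apply IZR_le; lia. }
  set (w := (IZR b / 2 + IZR (- m - 2)) / N). set (v := (- (IZR (m + 2) / 2) + 2 * w) / IZR b).
  assert (Kv : IZR b * v - 2 * w = - (IZR (m + 2) / 2)) by (unfold v; field; lra).
  assert (Kv' : IZR b * v - 2 * w = - (IZR m / 2) - 1) by (rewrite Kv, plus_IZR; field).
  assert (Hw : IZR a * w - 2 * v = 1/2).
  { unfold v, w. rewrite minus_IZR, opp_IZR, plus_IZR. field. lra. }
  prod (IZR a - 3) (IZR m).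
  assert (W : 0 <= w < 1/2) by (apply (digit_w_bound (- m - 2)); [rewrite minus_IZR, opp_IZR; lra|lia|reflexivity]).
  assert (V : -1/2 < v < 1/2) by (apply (digit_v_bound (- (IZR m / 2) - 1) w); lra).
  set (mu := - qf (IZR a) (IZR b) (1/2 + w) (- (1/2 + v))).
  assert (G := gap_eq_pp (a:=a) (b:=b) mu w v _ _ Hw Kv'). fold mu in G.
  destruct (regular_d2 (IZR a) (IZR b) (IZR m) mu) as [R _]; auto; try lra.
  { eexists; eauto. }
  { rewrite G. unfold lin, quad. lra. }
  apply regular_M in R.
  assert (F2 : - qf (IZR a) (IZR b) (1/2 - w) (- (1/2 - v)) = mu + (IZR a * IZR m + 2 * IZR a - IZR b) / 2).
  { unfold mu. rewrite qf_opposite, Hw, Kv'. field. }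
  assert (G' : 4 * mu <= IZR a * IZR b - IZR a * IZR m - 2 * IZR a).
  { apply Rmult_le_reg_l with N; [lra|]. unfold gap, lin, quad in G.
    prod (IZR a * (IZR m + 2)) (IZR b - IZR m - 2). prod (IZR a - 3) N. prod (IZR a - 3) (IZR b - 4). lra. }
  assert (Hmm : Z.even (m + 2 - m) = true) by (replace (m + 2 - m)%Z with 2%Z by ring; reflexivity).
  destruct (digit_integrality (m + 2) w v v Hmm Kv ltac:(lra)) as [I1 I2].
  destruct (digit_denominator (- m - 2) (IZR (- m - 2)) w v ltac:(rewrite minus_IZR, opp_IZR; lra) ltac:(eexists; reflexivity) eq_refl) as (Q0 & Q1 & Q2 & Q3).
  assert (Cor : corners (IZR a) (IZR b) mu (1/2 - w) (1/2 - v)).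
  { apply (corners_of_digits _ _ _ _ _ (1/2) (- (IZR m / 2) - 1)); try lra; fold mu.
    - right; reflexivity.
    - replace (qf (IZR a) (IZR b) (1/2 + w) (- (1/2 + v))) with (- mu) by (unfold mu; ring). lra. }
  rewrite (gamma_Bblk (m + 2) w v Hmm Hw Kv).
  apply (grid_rho_star a b mu (2 * IZR b * N) (1/2 - w) (1/2 - v) (1/2 - v)); auto; try lra.
  - exists (- (1/2 + w)), (1/2 + v). split.
    + exists (-1)%Z, 1%Z. split; field.
    + replace (qf (IZR a) (IZR b) (- (1/2 + w)) (1/2 + v)) with (- mu) by (unfold mu, qf; ring).
      rewrite Rabs_Ropp. apply Rabs_right. lra.
  - intros M y0 s t HM Hy. apply (upper_d2 (m:=m) Ha Hodd Hab Hm Hev w v); auto.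
Qed.

(** The two cells over w are balanced: the corner (1/2 - w, -(1/2 - v)) of one and the corner (1/2 +
    w, -(1/2 + v')) of the other both give mu, while the remaining negative corners exceed it by
    (a-1)/2 and (a-3)/2. *)
Lemma rho_d1 : (b = a * m + a + 1)%Z -> (5 <= a \/ 1 <= m)%Z ->
  exists v, is_Mstar a b (gamma_word a b (Bblk a b m :: Bblk a b (m + 2) :: nil)) v /\ is_rho_star a b v.
Proof.
  intros H2 H3. destruct (@parameter_bounds a b m Ha Hodd Hab Hm) as (A & B & C & D & E).
  assert (H2' : IZR b = IZR a * IZR m + IZR a + 1).
  { rewrite <- !mult_IZR, <- !plus_IZR; f_equal; lia. }
  set (w := (IZR b / 2 + IZR (- m - 1)) / N).
  set (v := (- (IZR m / 2) + 2 * w) / IZR b). set (v' := (- (IZR (m + 2) / 2) + 2 * w) / IZR b).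
  assert (Kv : IZR b * v - 2 * w = - (IZR m / 2)) by (unfold v; field; lra).
  assert (Kn : IZR b * v' - 2 * w = - (IZR (m + 2) / 2)) by (unfold v'; field; lra).
  assert (Kv' : IZR b * v' - 2 * w = - (IZR m / 2) - 1) by (rewrite Kn, plus_IZR; field).
  assert (Hw : IZR a * w - v - v' = 1/2).
  { unfold v, v', w. rewrite minus_IZR, opp_IZR, plus_IZR. field. lra. }
  assert (Ev : v = v' + / IZR b) by (unfold v, v'; rewrite plus_IZR; field; lra).
  assert (Hb0 : IZR b * / IZR b = 1) by (apply Rinv_r; lra).
  assert (Hm' : IZR a * w - 2 * v = 1/2 - / IZR b) by lra.
  assert (Hn' : IZR a * w - 2 * v' = 1/2 + / IZR b) by lra.
  assert (Ib : 0 < / IZR b) by (apply Rinv_0_lt_compat; lra).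
  prod (IZR a - 3) (IZR m).
  assert (W : 0 <= w < 1/2) by (apply (digit_w_bound (- m - 1)); [rewrite minus_IZR, opp_IZR; lra|lia|reflexivity]).
  assert (V : -1/2 < v < 1/2) by (apply (digit_v_bound (- (IZR m / 2)) w); lra).
  assert (V' : -1/2 < v' < 1/2) by (apply (digit_v_bound (- (IZR m / 2) - 1) w); lra).
  set (mu := - qf (IZR a) (IZR b) (1/2 - w) (- (1/2 - v))).
  assert (G : gap (IZR a) (IZR b) mu = alternating_gap (IZR a) (IZR b) (IZR m)).
  { rewrite (gap_eq_mm (a:=a) (b:=b) mu w v _ _ Hm' Kv). fold mu. unfold lin, quad, alternating_gap.
    replace (IZR a - 1) with (IZR b - IZR a * IZR m - 2) by lra. field. lra. }
  destruct (regular_d1 (IZR a) (IZR b) (IZR m) mu) as [R _]; auto; try lra.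
  { eexists; eauto. }
  { destruct E as [E|[E|E]]; auto. right; right; split; [exact E|].
    apply eq_IZR in E. apply (IZR_le 1). lia. }
  apply regular_M in R.
  assert (F1 : - qf (IZR a) (IZR b) (1/2 + w) (- (1/2 + v)) = mu + (IZR a - 1) / 2).
  { rewrite qf_opposite, Hm', Kv. fold mu. lra. }
  assert (F1' : - qf (IZR a) (IZR b) (1/2 + w) (- (1/2 + v')) = mu).
  { replace (- qf (IZR a) (IZR b) (1/2 + w) (- (1/2 + v'))) with
      (- qf (IZR a) (IZR b) (1/2 + w) (- (1/2 + v)) - IZR b * (v - v') * (IZR a / 2 + (IZR a * w - v - v') - 1)) by (unfold qf; field).
    replace (IZR b * (v - v')) with 1 by (rewrite Ev; field; lra).
    rewrite F1, Hw. field. }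
  assert (F2 : - qf (IZR a) (IZR b) (1/2 - w) (- (1/2 - v)) = mu) by reflexivity.
  assert (F2' : - qf (IZR a) (IZR b) (1/2 - w) (- (1/2 - v')) = mu + (IZR a - 3) / 2).
  { assert (X := qf_opposite (IZR a) (IZR b) w v'). rewrite F1', Hn', Kv' in X. lra. }
  assert (G' : 4 * mu <= IZR a * IZR b - IZR a - IZR b).
  { apply Rmult_le_reg_l with N; [lra|]. unfold gap, alternating_gap in G.
    prod (IZR a * IZR m) (IZR b - IZR m - 2). prod (IZR a - 3) N.
    prod (IZR a - 3) (IZR b - 4). lra. }
  assert (Hmm : Z.even (m - m) = true) by (rewrite Z.sub_diag; reflexivity).
  assert (Hnm : Z.even (m + 2 - m) = true) by (replace (m + 2 - m)%Z with 2%Z by ring; reflexivity).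
  destruct (digit_integrality m w v v' Hmm Kv Hw) as [I1 I2].
  destruct (digit_integrality (m + 2) w v' v Hnm Kn ltac:(lra)) as [I1' _].
  destruct (digit_denominator (- m - 1) (IZR (- m)) w v ltac:(rewrite opp_IZR; lra) ltac:(eexists; reflexivity) eq_refl) as (Q0 & Q1 & Q2 & Q3).
  destruct (digit_denominator (- m - 1) (IZR (- m - 2)) w v' ltac:(rewrite minus_IZR, opp_IZR; lra) ltac:(eexists; reflexivity) eq_refl) as (_ & _ & _ & Q3').
  assert (Cor : corners (IZR a) (IZR b) mu (1/2 - w) (1/2 - v)).
  { apply (corners_of_digits _ _ _ _ _ (1/2 - / IZR b) (- (IZR m / 2))); try lra. }
  assert (Cor' : corners (IZR a) (IZR b) mu (1/2 - w) (1/2 - v')).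
  { apply (corners_of_digits _ _ _ _ _ (1/2 + / IZR b) (- (IZR m / 2) - 1)); try lra. }
  destruct (Bblk_value m Hmm) as [B1 B2]. destruct (Bblk_value (m + 2) Hnm) as [B3 B4].
  (* The expansion starts on the grid of v': its first block, with t = m, is the one that leads to
     v. *)
  rewrite (gamma_word_2 a b _ _ (1/2 - w) (1/2 - v') (1/2 - v)); auto;
    [|rewrite B1; lra|rewrite B2; lra|rewrite B3; lra|rewrite B4; lra].
  apply (grid_rho_star a b mu (2 * IZR b * N) (1/2 - w) (1/2 - v') (1/2 - v)); auto; try lra.
  - exists (- (1/2 + w)), (1/2 + v'). split.
    + exists (-1)%Z, 1%Z. split; field.
    + replace (qf (IZR a) (IZR b) (- (1/2 + w)) (1/2 + v')) with (- mu) by (rewrite <- F1'; unfold qf; ring).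
      rewrite Rabs_Ropp. apply Rabs_right. lra.
  - intros M y0 s t HM Hy. apply (upper_d1 (m:=m) Ha Hodd Hab Hm Hev w v v'); auto.
Qed.

End PeriodicWords.

(** * The exceptional cases (3,4) and (3,5) *)

Lemma nearest_integer (x : R) : exists (c : Z) (z : R), 0 <= z <= 1/2 /\ (x = IZR c + z \/ x = IZR c - z).
Proof.
  destruct (base_fp x) as [F0 F1]. assert (F : x = IZR (Int_part x) + frac_part x) by (unfold frac_part; ring).
  destruct (Rle_or_lt (frac_part x) (1/2)).
  - exists (Int_part x), (frac_part x). split; [lra|auto].
  - exists (Int_part x + 1)%Z, (1 - frac_part x). rewrite plus_IZR. split; [lra|right; lra].
Qed.

(* f = 3 z^2 - 8 t^2 with z = s + 2 t, where z and t range independently over classes mod 1. *)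
Lemma grid_34_fold (M p q : R) : 0 <= p < 1 -> 0 <= q < 1 -> grid_avoids 3 4 M p (- q) ->
  exists z t, 0 <= z <= 1/2 /\ 0 <= t <= 1/2 /\
    forall n k : Z, (-10 <= n <= 10)%Z -> (-10 <= k <= 10)%Z -> M < Rabs (3 * (IZR n + z)^2 - 8 * (IZR k + t)^2).
Proof.
  intros Hp Hq G.
  destruct (nearest_integer (- q)) as (d & t & Ht & Ed). destruct (nearest_integer (p - 2 * q)) as (c & z & Hz & Ec).
  exists z, t. split; [exact Hz|]. split; [exact Ht|]. intros n k Hn Hk.
  assert (Bd : (-2 <= d <= 1)%Z) by (split; apply le_IZR; lra).
  assert (Bc : (-3 <= c <= 2)%Z) by (split; apply le_IZR; lra).
  assert (X : exists j, (-20 <= j <= 20)%Z /\ (- q + IZR j)^2 = (IZR k + t)^2).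
  { destruct Ed as [Ed|Ed].
    - exists (k - d)%Z. split; [lia|]. rewrite minus_IZR. f_equal. lra.
    - exists (- k - d)%Z. split; [lia|]. rewrite minus_IZR, opp_IZR.
      replace (- q + (- IZR k - IZR d)) with (- (IZR k + t)) by lra. ring. }
  destruct X as (j & Hj & Ej). rewrite <- Ej.
  assert (Y : exists i, (-100 <= i <= 100)%Z /\ (p + IZR i + 2 * (- q + IZR j))^2 = (IZR n + z)^2).
  { destruct Ec as [Ec|Ec].
    - exists (n - c - 2 * j)%Z. split; [lia|]. rewrite !minus_IZR, mult_IZR. f_equal. lra.
    - exists (- n - c - 2 * j)%Z. split; [lia|]. rewrite !minus_IZR, mult_IZR, opp_IZR.
      replace (p + (- IZR n - IZR c - 2 * IZR j) + 2 * (- q + IZR j)) with (- (IZR n + z)) by lra. ring. }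
  destruct Y as (i & Hi & Ei). rewrite <- Ei.
  replace (3 * (p + IZR i + 2 * (- q + IZR j)) ^ 2 - 8 * (- q + IZR j) ^ 2) with (qf 3 4 (p + IZR i) (- q + IZR j)) by (unfold qf; ring).
  apply G; lia.
Qed.

(** The extremal grid folds to (z, t) = (0, 1/2), where the shifts (-1,0) and (1,-1) both give
    exactly 1. The covering is sharp at this point, and the last case treats its neighbourhood. *)
Lemma cover_34 (M p q : R) : 1 < M -> 0 <= p < 1 -> 0 <= q < 1 -> ~ grid_avoids 3 4 M p (- q).
Proof.
  intros HM Hp Hq G. destruct (grid_34_fold M p q Hp Hq G) as (z & t & Hz & Ht & F).
  assert (F' : forall n k : Z, (-10 <= n <= 10)%Z -> (-10 <= k <= 10)%Z ->
    3 * (IZR n + z)^2 - 8 * (IZR k + t)^2 < -1 \/ 1 < 3 * (IZR n + z)^2 - 8 * (IZR k + t)^2).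
  { intros n k Hn Hk. specialize (F n k Hn Hk). revert F. unfold Rabs. destruct Rcase_abs; lra. }
  clear F G. prod t t. prod z z. prod z (1/2 - z). prod t (1/2 - t).
  assert (A : 8 * t^2 > 3 * z^2 + 1).
  { destruct (F' 0%Z 0%Z) as [X|X]; try lia; lra. }
  assert (T : 7/20 < t).
  { apply Rnot_le_lt. intros L. prod (7/20 - t) (7/20 + t). assert (0 <= z * z) by rpos. lra. }
  destruct (F' (-1)%Z 0%Z) as [X|X]; try lia.
  - assert (Z : 21/50 < z).
    { apply Rnot_le_lt. intros L. prod (21/50 - z) (2 - 21/50 - z). lra. }
    assert (T' : 93/200 < t).
    { apply Rnot_le_lt. intros L. prod (93/200 - t) (93/200 + t). prod (1/2 - z) (1/2 - z). lra. }
    destruct (F' 2%Z (-2)%Z) as [Y|Y]; try lia.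
    + prod (1/2 - t) (t - 93/200). prod (z - 21/50) (z + 21/50). lra.
    + prod (1/2 - t) (7/2 - t). lra.
  - assert (Z : z < 1/6).
    { apply Rnot_le_lt. intros L. lra. }
    destruct (F' 1%Z (-1)%Z) as [Y|Y]; try lia.
    + prod z z. prod (t - 7/20) (33/20 - t). lra.
    (* With e = 1/2 - t, the inequalities of the two shifts add up to 16 e^2 < 6 z^2, whereas the
       first alone gives 8 e > 11 z / 2 for z < 1/6. *)
    + prod (1 - 2 * t) (1 - 2 * t). prod (1/6 - z) z.
      assert (z * 11 / 2 < 4 * (1 - 2 * t)) by lra.
      prod (4 * (1 - 2 * t) - z * 11/2) (4 * (1 - 2 * t) + z * 11/2). lra.
Qed.

(* 4 f = 5 w^2 - 33 s^2 with w = 2 t + 3 s; translations change s and w by integers of equal parity. *)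
Lemma grid_35_fold (M p q : R) : 0 <= p < 1 -> 0 <= q < 1 -> grid_avoids 3 5 M p (- q) ->
  exists s w, 0 <= s <= 1/2 /\ 0 <= w <= 1 /\
    forall n k : Z, Z.even (n - k) = true -> (-60 <= n <= 60)%Z -> (-25 <= k <= 25)%Z ->
      4 * M < Rabs (5 * (IZR n + w)^2 - 33 * (IZR k + s)^2).
Proof.
  intros Hp Hq G.
  destruct (nearest_integer p) as (c & s & Hs & Ec).
  destruct (nearest_integer (- q + 3 / 2 * (p - IZR c))) as (d & w & Hw & Ed).
  exists s, (2 * w). split; [exact Hs|]. split; [lra|]. intros n k Hnk Hn Hk.
  assert (Bc : (-1 <= c <= 2)%Z) by (split; apply le_IZR; lra).
  assert (Bs : - (1/2) <= p - IZR c <= 1/2) by (destruct Ec; lra).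
  assert (Bd : (-3 <= d <= 2)%Z) by (split; apply le_IZR; destruct Ed; lra).
  apply Z.even_spec in Hnk as [e He].
  assert (X : exists (x y : Z), (x = k \/ x = - k)%Z /\ (p - IZR c + IZR x)^2 = (IZR k + s)^2 /\
    (y = n \/ y = - n)%Z /\ (2 * (- q + 3 / 2 * (p - IZR c)) - 2 * IZR d + IZR y)^2 = (IZR n + 2 * w)^2).
  { assert (A : exists x, (x = k \/ x = - k)%Z /\ (p - IZR c + IZR x)^2 = (IZR k + s)^2).
    { destruct Ec as [Ec|Ec].
      - exists k. split; [auto|f_equal; lra].
      - exists (- k)%Z. split; [auto|]. rewrite opp_IZR.
        replace (p - IZR c + - IZR k) with (- (IZR k + s)) by lra. ring. }
    assert (B : exists y, (y = n \/ y = - n)%Z /\ (2 * (- q + 3 / 2 * (p - IZR c)) - 2 * IZR d + IZR y)^2 = (IZR n + 2 * w)^2).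
    { destruct Ed as [Ed|Ed].
      - exists n. split; [auto|f_equal; lra].
      - exists (- n)%Z. split; [auto|]. rewrite opp_IZR.
        replace (2 * (- q + 3 / 2 * (p - IZR c)) - 2 * IZR d + - IZR n) with (- (IZR n + 2 * w)) by lra. ring. }
    destruct A as (x & A1 & A2), B as (y & B1 & B2). exists x, y. auto. }
  destruct X as (x & y & Hx & Ex & Hy & Ey). rewrite <- Ex, <- Ey.
  assert (J : exists j, (y - 2 * d - 3 * x = 2 * j)%Z).
  { destruct Hx as [-> | ->]; destruct Hy as [-> | ->];
    [exists (e - d - k)%Z | exists (- e - d - 2 * k)%Z | exists (e - d + 2 * k)%Z | exists (- e - d + k)%Z]; lia. }
  destruct J as [j Hj].
  replace (2 * (- q + 3 / 2 * (p - IZR c)) - 2 * IZR d + IZR y) with (3 * (p + IZR (x - c)) + 2 * (- q + IZR j)).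
  2: { assert (Y := f_equal IZR Hj). rewrite !minus_IZR, !mult_IZR in Y. rewrite minus_IZR. lra. }
  replace (p - IZR c + IZR x) with (p + IZR (x - c)) by (rewrite minus_IZR; ring).
  replace (5 * (3 * (p + IZR (x - c)) + 2 * (- q + IZR j)) ^ 2 - 33 * (p + IZR (x - c)) ^ 2) with
    (4 * qf 3 5 (p + IZR (x - c)) (- q + IZR j)) by (unfold qf; ring).
  rewrite Rabs_mult, (Rabs_right 4) by lra. apply Rmult_lt_compat_l; [lra|]. apply G; lia.
Qed.

(** The extremal point is (s, w) = (1/11, 1), which bounds s at once. The long shifts work near (0,
    1) because 5 * 18^2 - 33 * 7^2 = 3: there (n + w, k + s) is close to (18, 7) up to signs, or to
    its triple (54, 21). *)
Lemma cover_35_high (s w : R) : 0 <= s -> w <= 1 ->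
  (forall n k : Z, Z.even (n - k) = true -> (-60 <= n <= 60)%Z -> (-25 <= k <= 25)%Z ->
     5 * (IZR n + w)^2 - 33 * (IZR k + s)^2 < - (52/11) \/ 52/11 < 5 * (IZR n + w)^2 - 33 * (IZR k + s)^2) ->
  0 <= w -> 33 * s^2 + 52/11 < 5 * w^2 -> False.
Proof.
  intros Hs Hw F Hw0 A.
  assert (S : s < 1/11).
  { apply Rnot_le_lt. intros L. prod (s - 1/11) (s + 1/11). prod (1 - w) (1 + w). lra. }
  assert (W : 97/100 < w).
  { apply Rnot_le_lt. intros L. prod (97/100 - w) (97/100 + w). prod s s. lra. }
  prod (1/11 - s) s. prod s s. prod (1 - w) (w - 97/100). prod (1 - w) (1 - w).
  assert (B : 132 * s + 50 * (1 - w) + 5 * (1 - w)^2 - 33 * s^2 < 25/11).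
  { destruct (F (-6)%Z (-2)%Z) as [X|X]; try lia; [reflexivity|lra|exfalso]. prod (1/11 - s) (1/11 - s). lra. }
  assert (S' : s < 18/1000) by lra.
  prod (18/1000 - s) s.
  assert (C : 85/11 < 180 * (1 - w) + 462 * s - 5 * (1 - w)^2 + 33 * s^2).
  { destruct (F 17%Z 7%Z) as [X|X]; try lia; [reflexivity|lra|exfalso]. lra. }
  assert (D : 462 * s - 180 * (1 - w) > 17/10).
  { destruct (F 17%Z (-7)%Z) as [X|X]; try lia; [reflexivity|exfalso; lra|]. lra. }
  assert (E : 85/11 < 462 * s - 180 * (1 - w) - 5 * (1 - w)^2 + 33 * s^2).
  { destruct (F (-19)%Z 7%Z) as [X|X]; try lia; [reflexivity|lra|exfalso]. lra. }
  destruct (F 53%Z 21%Z) as [X|X]; try lia; [reflexivity| |]; lra.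
Qed.

Lemma cover_35_low (s w : R) : s <= 1/2 -> 0 <= w ->
  (forall n k : Z, Z.even (n - k) = true -> (-60 <= n <= 60)%Z -> (-25 <= k <= 25)%Z ->
     5 * (IZR n + w)^2 - 33 * (IZR k + s)^2 < - (52/11) \/ 52/11 < 5 * (IZR n + w)^2 - 33 * (IZR k + s)^2) ->
  0 <= s -> 5 * w^2 + 52/11 < 33 * s^2 -> False.
Proof.
  intros Hs Hw F Hs0 A. set (e := 1/2 - s). assert (Es : s = 1/2 - e) by (unfold e; ring).
  assert (e0 : 0 <= e) by (unfold e; lra). clearbody e. subst s.
  assert (E : e < 122/1000).
  { apply Rnot_le_lt. intros L. prod (e - 122/1000) (1/2 - e). prod w w. lra. }
  prod e (122/1000 - e). prod w w. prod e e.
  assert (W : w < 84/100).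
  { apply Rnot_le_lt. intros L. prod (w - 84/100) (w + 84/100). lra. }
  prod w (84/100 - w).
  destruct (F 1%Z (-1)%Z) as [X|X]; try lia; [reflexivity| |].
  (* 10477/1000 rounds down 80 - 297/4 + 52/11, from the shift (4,-2) at e = w = 0. *)
  - assert (Y : 10477/1000 + 40 * w + 5 * w^2 < 99 * e + 33 * e^2).
    { destruct (F 4%Z (-2)%Z) as [Y|Y]; try lia; [reflexivity|lra|exfalso].
      destruct (Rle_or_lt e (11/100)) as [L|L].
      - prod e (11/100 - e). lra.
      - assert (w < 242/1000).
        { apply Rnot_le_lt. intros L'. prod (w - 242/1000) (w + 242/1000). prod (e - 11/100) (122/1000 - e). lra. }
        prod w (242/1000 - w). lra. }
    destruct (F (-19)%Z 7%Z) as [Z|Z]; try lia; [reflexivity|lra|].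
    destruct (F 17%Z (-7)%Z) as [T|T]; try lia; [reflexivity| |]; lra.
  - assert (W' : 6/10 < w).
    { apply Rnot_le_lt. intros L. prod (6/10 - w) w. lra. }
    prod (w - 6/10) (84/100 - w). prod (84/100 - w) (84/100 - w).
    destruct (F (-2)%Z 0%Z) as [Y|Y]; try lia; [reflexivity| |]; lra.
Qed.

Lemma cover_35 (M p q : R) : 13/11 < M -> 0 <= p < 1 -> 0 <= q < 1 -> ~ grid_avoids 3 5 M p (- q).
Proof.
  intros HM Hp Hq G. destruct (grid_35_fold M p q Hp Hq G) as (s & w & Hs & Hw & F).
  assert (F' : forall n k : Z, Z.even (n - k) = true -> (-60 <= n <= 60)%Z -> (-25 <= k <= 25)%Z ->
     5 * (IZR n + w)^2 - 33 * (IZR k + s)^2 < - (52/11) \/ 52/11 < 5 * (IZR n + w)^2 - 33 * (IZR k + s)^2).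
  { intros n k Hnk Hn Hk. specialize (F n k Hnk Hn Hk). revert F. unfold Rabs. destruct Rcase_abs; lra. }
  destruct (F' 0%Z 0%Z) as [X|X]; try lia; [reflexivity| |].
  - apply (cover_35_low s w); auto; lra.
  - apply (cover_35_high s w); auto; lra.
Qed.

Lemma upper_of_cover (a b : Z) (mu : R) : (3 <= a)%Z -> (a < b)%Z ->
  (forall M p q, mu < M -> 0 <= p < 1 -> 0 <= q < 1 -> ~ grid_avoids a b M p (- q)) ->
  forall M y0 s t, mu < M -> 0 < y0 -> ~ large_y a b M y0 1 s t.
Proof.
  intros Ha Hb C M y0 s t HM Hy L.
  destruct (large_chain a b M y0 s t Ha Hb Hy L) as (p & q & _ & _ & H & _ & _ & G).
  destruct (H 0%nat) as [Hp Hq]. exact (C M _ _ HM Hp Hq (proj1 (G 0%nat))).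
Qed.

(** For odd T the value is odd when S is even, and 2 modulo 4 when S is odd. *)
Lemma form_34_nonzero (S T : Z) : Z.odd T = true -> (3 * S * S + 6 * S * T + T * T <> 0)%Z.
Proof.
  intros HT H. apply Z.odd_spec in HT as [y ->].
  destruct (Z.Even_or_Odd S) as [[x ->]|[x ->]]; lia.
Qed.

Lemma rho_34 : exists v, is_Mstar 3 4 (gamma_word 3 4 (Fblk 3 4 2 :: nil)) v /\ is_rho_star 3 4 v.
Proof.
  rewrite (gamma_word_1 3 4 _ 1 (1/2)); try lia; [|cbn; lra|cbn; lra].
  assert (Z0 : exists z, 2 * 1 - IZR 4 * (1/2) = IZR z) by (exists 0%Z; lra).
  assert (Z1 : exists z, 1/2 + 1/2 - IZR 3 * 1 = IZR z) by (exists (-2)%Z; lra).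
  apply (grid_rho (a:=3) (b:=4) ltac:(lia) ltac:(lia) 1 1 (1/2)); [lra| | | |].
  - intros s t (i & j & -> & ->).
    assert (E : 4 * qf 3 4 (1 + IZR i) (- (1/2) + IZR j) =
      4 * IZR (3 * (1 + i) * (1 + i) + 6 * (1 + i) * (2 * j - 1) + (2 * j - 1) * (2 * j - 1)) ).
    { rewrite !plus_IZR, !mult_IZR, !minus_IZR, !plus_IZR, !mult_IZR. unfold qf. field. }
    assert (N := form_34_nonzero (1 + i) (2 * j - 1) ltac:(rewrite Z.odd_sub, Z.odd_mul; reflexivity)).
    replace (qf 3 4 (1 + IZR i) (- (1/2) + IZR j)) with (IZR (3 * (1 + i) * (1 + i) + 6 * (1 + i) * (2 * j - 1) + (2 * j - 1) * (2 * j - 1))) by lra.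
    rewrite <- abs_IZR. apply (IZR_le 1). lia.
  - exists 0, (1/2). split.
    + exists (-1)%Z, 1%Z. split; lra.
    + unfold qf. rewrite Rabs_right; lra.
  - intros s t G. apply (grid_step 3 4 1 (1/2) (1/2)); auto; lia.
  - apply Mstar_upper; try lia. apply upper_of_cover; try lia. exact cover_34.
Qed.

(** The residues modulo 11 force the value 22 modulo 121. Of the candidates of small size, 22 is
    excluded modulo 3 and -99 modulo 5; the next ones are 143 = 121 * 13/11 and -220. *)
Lemma form_35_residue (S T x y : Z) : (S = 1 + 11 * x)%Z -> (T = 4 + 11 * y)%Z ->
  143 <= Rabs (3 * IZR S * IZR S + 15 * IZR S * IZR T + 5 * IZR T * IZR T).
Proof.
  intros HS HT. rewrite <- !mult_IZR, <- !plus_IZR, <- abs_IZR. apply (IZR_le 143).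
  set (V := (3 * S * S + 15 * S * T + 5 * T * T)%Z).
  assert (E : (V = 22 + 121 * (1 + 6 * x + 5 * y + 3 * x * x + 15 * x * y + 5 * y * y))%Z) by (unfold V; subst; ring).
  assert (A : V <> 22%Z).
  { unfold V. intros H.
    assert (D := Z.div_mod T 3 ltac:(lia)). assert (R := Z.mod_pos_bound T 3 ltac:(lia)).
    set (u := (T / 3)%Z) in *. set (e := (T mod 3)%Z) in *. clearbody u e. clear HT E.
    assert (e = 0 \/ e = 1 \/ e = 2)%Z as [-> | [-> | ->]] by lia; rewrite D in H; lia. }
  assert (B : V <> (-99)%Z).
  { unfold V. intros H.
    assert (D := Z.div_mod S 5 ltac:(lia)). assert (R := Z.mod_pos_bound S 5 ltac:(lia)).
    set (u := (S / 5)%Z) in *. set (e := (S mod 5)%Z) in *. clearbody u e. clear HS E.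
    assert (e = 0 \/ e = 1 \/ e = 2 \/ e = 3 \/ e = 4)%Z as [-> | [-> | [-> | [-> | ->]]]] by lia; rewrite D in H; lia. }
  lia.
Qed.

Lemma rho_35 : exists v, is_Mstar 3 5 (gamma_word 3 5 (Fblk 3 5 1 :: nil)) v /\ is_rho_star 3 5 v.
Proof.
  rewrite (gamma_word_1 3 5 _ (12/11) (7/11)); try lia; [|cbn; lra|cbn; lra].
  assert (Z0 : exists z, 2 * (12/11) - IZR 5 * (7/11) = IZR z) by (exists (-1)%Z; lra).
  assert (Z1 : exists z, 7/11 + 7/11 - IZR 3 * (12/11) = IZR z) by (exists (-2)%Z; lra).
  apply (grid_rho (a:=3) (b:=5) ltac:(lia) ltac:(lia) (13/11) (12/11) (7/11)); [lra| | | |].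
  - intros s t (i & j & -> & ->).
    assert (X := form_35_residue _ _ (1 + i) (j - 1) eq_refl eq_refl).
    set (S := (1 + 11 * (1 + i))%Z) in X. set (T := (4 + 11 * (j - 1))%Z) in X.
    replace (12 / 11 + IZR i) with (IZR S / 11) by (unfold S; rewrite plus_IZR, mult_IZR, plus_IZR; field).
    replace (- (7 / 11) + IZR j) with (IZR T / 11) by (unfold T; rewrite plus_IZR, mult_IZR, minus_IZR; field).
    replace (qf 3 5 (IZR S / 11) (IZR T / 11)) with
      ((3 * IZR S * IZR S + 15 * IZR S * IZR T + 5 * IZR T * IZR T) * (/ 121)) by (unfold qf; field).
    rewrite Rabs_mult, (Rabs_right (/ 121)) by lra. lra.
  - exists (1/11), (4/11). split.
    + exists (-1)%Z, 1%Z. split; lra.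
    + unfold qf. rewrite Rabs_right; lra.
  - intros s t G. apply (grid_step 3 5 (12/11) (7/11) (7/11)); auto; lia.
  - apply Mstar_upper; try lia. apply upper_of_cover; try lia. exact cover_35.
Qed.

Theorem theorem2 (a b m r : Z) :
  (3 <= a)%Z -> Z.odd a = true -> (a < b)%Z ->
  (0 <= m)%Z -> Z.even r = true -> (0 < r <= 2 * a)%Z -> b = (m * a + r)%Z ->
  let n := (m + 2)%Z in
  (* delta_0 *)
  ((((2 <= r <= a - 1)%Z /\ (5 <= a)%Z) \/ (a = 3 /\ 2 <= m /\ r = 2)%Z) ->
     exists v, is_Mstar a b (gamma_word a b (Bblk a b m :: nil)) v /\ is_rho_star a b v) /\
  (* delta_{-1} *)
  ((r = a + 1 /\ ((5 <= a) \/ (a = 3 /\ 1 <= m)))%Z ->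
     exists v, is_Mstar a b (gamma_word a b (Bblk a b m :: Bblk a b n :: nil)) v
               /\ is_rho_star a b v) /\
  (* delta_{-2} *)
  ((a + 3 <= r <= 2 * a)%Z ->
     exists v, is_Mstar a b (gamma_word a b (Bblk a b n :: nil)) v /\ is_rho_star a b v) /\
  (* delta_{-6} *)
  ((a = 3 /\ b = 4)%Z ->
     exists v, is_Mstar a b (gamma_word a b (Fblk a b 2 :: nil)) v /\ is_rho_star a b v) /\
  (* delta_{-7} *)
  ((a = 3 /\ b = 5)%Z ->
     exists v, is_Mstar a b (gamma_word a b (Fblk a b 1 :: nil)) v /\ is_rho_star a b v).
Proof.
  intros Ha Hodd Hab Hm Hr Hr2 Hb n.
  assert (Hev : Z.even (b - m) = true).
  { apply Z.odd_spec in Hodd as [c Hc]. apply Z.even_spec in Hr as [d Hd].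
    apply Z.even_spec. exists (m * c + d)%Z. subst; ring. }
  assert (E : (b = a * m + r)%Z) by lia.
  repeat split.
  (* m = 0 would mean b = r <= a - 1, against a < b. *)
  - intros H. assert (1 <= m)%Z by (destruct (Z.eq_dec m 0) as [->|]; lia).
    apply rho_d0; auto; lia.
  - intros H. apply rho_d1; auto; lia.
  - intros H. apply rho_d2; auto; lia.
  - intros [-> ->]. exact rho_34.
  - intros [-> ->]. exact rho_35.
Qed.
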